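(* Let $Y^{k+1}$ be an asymptotically CMC submanifold of an asymptotically hyperbolic space $(X^{n+1},g_+)$ with asymptotic mean curvature $C$. Then $Y$ (with the induced metric) is asymptotically hyperbolic with asymptotic sectional curvatures equal to $$-\left(1-\frac{C^2}{(k+1)^2}\right).$$ In particular, if $Y$ is asymptotically minimal, then $Y$ is asymptotically hyperbolic (with asymptotic sectional curvatures equal to $-1$).
   Context: Let $\overline{X}^{n+1}$ be a compact manifold with boundary $M=\partial\overline{X}$ and interior $X$. A defining function for $M$ is a function $r$ on $\overline{X}$ with $r>0$ on $X$, $r=0$ on $M$ and $dr\neq 0$ on $M$. A complete Riemannian metric $g_+$ on $X$ is conformally compact (CC) if, for a defining function $r$, $\overline{g}:=r^2g_+$ extends to a metric on $\overline{X}$; for the ambient metric $g_+$ the extension is assumed throughout to be of class $C^{3,\theta}(\overline{X})$ for a Hölder exponent $\theta\in(0,1)$. A CC manifold is asymptotically hyperbolic with asymptotic sectional curvatures $-\kappa^2$, where $\kappa>0$, written $\mathrm{AH}(-\kappa^2)$, if its sectional curvatures approach the constant $-\kappa^2$ at the boundary at infinity (equivalently $|dr|^2_{r^2g_+}=\kappa^2$ on the boundary). Without further specification, ''asymptotically hyperbolic'' means $\mathrm{AH}(-1)$. Conformally compact submanifold: let $\overline{Y}^{k+1}$ be a compact manifold with boundary and interior $Y$, and let $\iota\colon\overline{Y}\to\overline{X}^{n+1}$ be a $C^{2,\theta}$ immersion. If $(Y,\iota^*g_+)$ is conformally compact, $\iota|_{\partial\overline{Y}}\colon\partial\overline{Y}\to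 M$ is an immersion, and $\iota(\overline{Y})$ meets $M$ transversely, then $(Y^{k+1},\iota^*g_+)$ is called a conformally compact submanifold of $(X^{n+1},g_+)$. If furthermore its mean curvature vector $H$ (the trace, not divided by dimension, of the vector-valued second fundamental form) satisfies $g_+(H,H)=C^2+O(r)$ for some constant $C\in[0,\infty)$, where $r$ is any defining function for $M$, then $(Y,\iota^*g_+)$ is called asymptotically CMC with asymptotic mean curvature $C$. If $C=0$, $Y$ is called asymptotically minimal. *)

(* Defs.v *)
From mathcomp Require Import all_boot all_order all_algebra.
From mathcomp Require Import all_classical all_reals all_analysis.
Import Order.TTheory GRing.Theory Num.Theory.
Import numFieldNormedType.Exports.

Set Implicit Arguments.
Unset Strict Implicit.
Unset Printing Implicit Defensive.

Local Open Scope classical_set_scope.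
Local Open Scope ring_scope.

(* Dimensions are written n.+1 and coordinate 0 is the boundary coordinate of
   the model half-space, so a manifold "of index n" has dimension n + 1.
   Tangent vectors are row vectors; the differential of a map with Jacobian J
   acts by v |-> v *m J. *)

Definition half_space (R : realType) (n : nat) : set 'rV[R]_n.+1 :=
  [set x | 0 <= x 0 0].

Section Calculus.
Context {R : realType}.

Section OneFunction.
Context {n : nat}.
Notation V := ('rV[R]_n.+1).
Implicit Types (A : set V) (f : V -> R).

(* Partial derivatives relative to A, which in practice is a relatively open
   subset of the half-space: two-sided at interior points, one-sided in the
   direction 0 at boundary points. *)
Definition diff_quot f (i : 'I_n.+1) (x : V) (h : R) : R :=
  h^-1 * (f (x + h *: delta_mx 0 i) - f x).

Definition pd_nbhs A (i : 'I_n.+1) (x : V) : set_system R :=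
  within [set h | A (x + h *: delta_mx 0 i)] (0^').

Definition pd A (i : 'I_n.+1) f (x : V) : R :=
  lim (diff_quot f i x @ pd_nbhs A i x).

Definition C0 A f : Prop := {within A, continuous f}.

Definition loc_holder (theta : R) A f : Prop :=
  forall x, A x -> exists L d : R, 0 < d /\
    forall y z, A y -> A z -> `|y - x| < d -> `|z - x| < d ->
      `|f y - f z| <= L * `|y - z| `^ theta.

(* k times continuously differentiable up to the boundary, with all partial
   derivatives of order k in the class B. *)
Fixpoint Creg (B : set V -> (V -> R) -> Prop) (k : nat) A f : Prop :=
  match k with
  | 0 => B A f
  | k'.+1 => C0 A f /\
      forall i : 'I_n.+1,
        (forall x, A x -> cvg (diff_quot f i x @ pd_nbhs A i x)) /\
        Creg B k' A (pd A i f)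
  end.

Definition Ck (k : nat) A f : Prop := Creg C0 k A f.
Definition Ckh (k : nat) (theta : R) A f : Prop := Creg (loc_holder theta) k A f.
Definition Coo A f : Prop := forall k, Ck k A f.

End OneFunction.

Definition jac m n (A : set 'rV[R]_m.+1) (F : 'rV[R]_m.+1 -> 'rV[R]_n.+1)
    (x : 'rV[R]_m.+1) : 'M[R]_(m.+1, n.+1) :=
  \matrix_(p, c) pd A p (fun y => F y 0 c) x.

Definition ip n (G : 'M[R]_n) (u v : 'rV[R]_n) : R := (u *m G *m v^T) 0 0.

(* Christoffel symbols of the first kind, <nabla_{e_a} e_b, e_c>. *)
Definition christoffel n (A : set 'rV[R]_n.+1) (G : 'rV[R]_n.+1 -> 'M[R]_n.+1)
    (a b c : 'I_n.+1) (x : 'rV[R]_n.+1) : R :=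
  2^-1 * (pd A a (fun y => G y b c) x + pd A b (fun y => G y a c) x
          - pd A c (fun y => G y a b) x).

(* <nabla_{e_a} e_b, nabla_{e_c} e_d> *)
Definition christoffel_ip n (A : set 'rV[R]_n.+1)
    (G : 'rV[R]_n.+1 -> 'M[R]_n.+1) (a b c d : 'I_n.+1) (x : 'rV[R]_n.+1) : R :=
  \sum_s \sum_t invmx (G x) s t * christoffel A G a b s x
                                * christoffel A G c d t x.

(* Rm p q k l = <R(e_p, e_q) e_k, e_l> is the Riemann tensor of the metric G on
   the open set A.  For a C^2 metric the definition says
     Rm p q k l = d_p <nabla_q e_k, e_l> - d_q <nabla_p e_k, e_l>
                  - <nabla_q e_k, nabla_p e_l> + <nabla_p e_k, nabla_q e_l>.
   A metric induced by a C^2 immersion is in general only C^1, so the identity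
   is required in the form integrated over all coordinate rectangles
     { x + a e_p + b e_q | 0 <= a <= s, 0 <= b <= t }
   (Hartman-Wintner); this determines the continuous tensor Rm. *)
Definition riemann_tensor n (A : set 'rV[R]_n.+1)
    (G : 'rV[R]_n.+1 -> 'M[R]_n.+1)
    (Rm : 'I_n.+1 -> 'I_n.+1 -> 'I_n.+1 -> 'I_n.+1 -> 'rV[R]_n.+1 -> R) : Prop :=
  [/\ forall a b, Ck 1 A (fun x => G x a b),
      forall p q k l, C0 A (Rm p q k l) &
      forall (p q k l : 'I_n.+1) (x : 'rV[R]_n.+1) (s t : R),
        let pt a b := x + a *: delta_mx 0 p + b *: delta_mx 0 q in
        0 <= s -> 0 <= t ->
        (forall a b, 0 <= a <= s -> 0 <= b <= t -> A (pt a b)) ->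
        \int[lebesgue_measure]_(b in `[0, t])
          (christoffel A G q k l (pt s b) - christoffel A G q k l (pt 0 b))
        - \int[lebesgue_measure]_(a in `[0, s])
          (christoffel A G p k l (pt a t) - christoffel A G p k l (pt a 0))
        = \int[lebesgue_measure]_(a in `[0, s])
            \int[lebesgue_measure]_(b in `[0, t])
              (Rm p q k l (pt a b)
               + christoffel_ip A G q k p l (pt a b)
               - christoffel_ip A G p k q l (pt a b))].

Definition sectional n (G : 'rV[R]_n.+1 -> 'M[R]_n.+1)
    (Rm : 'I_n.+1 -> 'I_n.+1 -> 'I_n.+1 -> 'I_n.+1 -> 'rV[R]_n.+1 -> R)
    (u v x : 'rV[R]_n.+1) : R :=
  (\sum_p \sum_q \sum_k \sum_l
     Rm p q k l x * u 0 p * v 0 q * v 0 k * u 0 l)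
  / (ip (G x) u u * ip (G x) v v - ip (G x) u v ^+ 2).

End Calculus.

(* Compact smooth (n+1)-manifolds with nonempty boundary, given by an atlas. *)
Record bmanifold (R : realType) (n : nat) := BManifold {
  bm_sort :> topologicalType;
  chart : Type;
  dom : chart -> set bm_sort;
  phi : chart -> bm_sort -> 'rV[R]_n.+1;
  psi : chart -> 'rV[R]_n.+1 -> bm_sort;
  dom_open : forall i, open (dom i);
  dom_cover : forall p, exists i, dom i p;
  phi_image : forall i, exists W : set 'rV[R]_n.+1,
    open W /\ phi i @` dom i = W `&` @half_space R n;
  phiK : forall i p, dom i p -> psi i (phi i p) = p;
  phi_continuous : forall i, {within dom i, continuous (phi i)};
  psi_continuous : forall i, {within phi i @` dom i, continuous (psi i)};
  transition_smooth : forall i j c,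
    Coo (phi i @` (dom i `&` dom j)) (fun x => phi j (psi i x) 0 c);
  bm_hausdorff : hausdorff_space bm_sort;
  bm_compact : compact [set: bm_sort];
  bm_boundary : exists p i, dom i p /\ phi i p 0 0 = 0
}.

Section Manifold.
Context {R : realType} {n : nat} (X : bmanifold R n).
Notation V := ('rV[R]_n.+1).

Definition bdry : set X := [set p | exists i, dom i p /\ phi i p 0 0 = 0].
Definition inter : set X := ~` bdry.

Definition chart_at (p : X) : chart X := sval (cid (dom_cover p)).

Definition cdom (D : set X) (i : chart X) : set V :=
  phi i @` (dom i `&` D).

(* Metrics are families of component matrices, one function per chart. *)
Definition tensor_field := chart X -> V -> 'M[R]_n.+1.

Definition is_metric (reg : set V -> (V -> R) -> Prop) (D : set X)
    (g : tensor_field) : Prop :=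
  [/\ forall i a b, reg (cdom D i) (fun x => g i x a b),
      forall i x, cdom D i x -> (g i x)^T = g i x,
      forall i x (v : V), cdom D i x -> v != 0 -> 0 < ip (g i x) v v &
      forall i j x, cdom (dom j `&` D) i x ->
        let J := jac (cdom (dom j) i) (fun y => phi j (psi i y)) x in
        g i x = J *m g j (phi j (psi i x)) *m J^T].

Definition defining_function (r : X -> R) : Prop :=
  [/\ forall i, Coo (phi i @` dom i) (fun x => r (psi i x)),
      forall p, inter p -> 0 < r p,
      forall p, bdry p -> r p = 0 &
      forall i x, cdom bdry i x ->
        exists a, pd (phi i @` dom i) a (fun y => r (psi i y)) x != 0].

(* gamma is of class C^1 on a neighbourhood of [0, 1] and maps [0, 1] to the
   interior. *)
Definition interior_curve (gamma : R -> X) : Prop :=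
  forall t, 0 <= t <= 1 ->
    [/\ inter (gamma t), {for t, continuous gamma} &
        forall i c, dom i (gamma t) ->
          let f := fun s => phi i (gamma s) 0 c in
          (\forall s \near t, derivable f s 1) /\ {for t, continuous (f^`()%classic)}].

Definition curve_length (g : tensor_field) (gamma : R -> X) : R :=
  \int[lebesgue_measure]_(t in `[0, 1])
    (let i := chart_at (gamma t) in
     let v : V := \row_c (fun s => phi i (gamma s) 0 c)^`()%classic t in
     Num.sqrt (ip (g i (phi i (gamma t))) v v)).

Definition complete_metric (g : tensor_field) : Prop :=
  forall x : nat -> X, (forall m, inter (x m)) ->
    (forall e : R, 0 < e -> exists N : nat, forall a b : nat,
       (N <= a)%N -> (N <= b)%N ->
       exists gamma, [/\ interior_curve gamma, gamma 0 = x a, gamma 1 = x b &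
                         curve_length g gamma < e]) ->
    exists p, inter p /\ x @ \oo --> p.

Definition compactification (reg : set V -> (V -> R) -> Prop)
    (g : tensor_field) (r : X -> R) (gbar : tensor_field) : Prop :=
  [/\ defining_function r, is_metric reg setT gbar &
      forall i x, cdom inter i x -> gbar i x = r (psi i x) ^+ 2 *: g i x].

Definition conf_compact (reg : set V -> (V -> R) -> Prop)
    (g : tensor_field) : Prop :=
  [/\ is_metric C0 inter g, complete_metric g &
      exists r gbar, compactification reg g r gbar].

Definition sectional_limit (g : tensor_field) (c : R) : Prop :=
  forall i, exists2 Rm, riemann_tensor (cdom inter i) (g i) Rm &
    forall q, cdom bdry i q -> forall e : R, 0 < e ->
      \forall x \near within (cdom inter i) (nbhs q),
        forall u v : V, row_free (col_mx u v) ->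
          `|sectional (g i) Rm u v x - c| < e.

(* |dr|^2 with respect to r^2 g on the boundary *)
Definition boundary_dr2 (g : tensor_field) (c : R) : Prop :=
  forall r gbar, compactification C0 g r gbar ->
    forall i x, cdom bdry i x ->
      let d : V := \row_a pd (phi i @` dom i) a (fun y => r (psi i y)) x in
      ip (invmx (gbar i x)) d d = c.

(* AH(c) with c = - kappa^2, kappa > 0.  The two last conditions are the two
   usual forms of the definition; the second one also covers dimension 1, where
   there are no sectional curvatures. *)
Definition asym_hyperbolic (g : tensor_field) (c : R) : Prop :=
  [/\ c < 0, conf_compact C0 g, sectional_limit g c & boundary_dr2 g (- c)].

End Manifold.

Arguments bdry {R n} X.
Arguments inter {R n} X.

Section Submanifold.
Context {R : realType} {n k : nat} (X : bmanifold R n) (Y : bmanifold R k).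
Variables (iota : Y -> X) (g : tensor_field X).

(* iota in the chart i of Y and the chart a of X, and its domain *)
Definition loc (i : chart Y) (a : chart X) (y : 'rV[R]_k.+1) : 'rV[R]_n.+1 :=
  phi a (iota (psi i y)).

Definition ldom (i : chart Y) (a : chart X) : set 'rV[R]_k.+1 :=
  cdom (iota @^-1` dom a) i.

Definition ljac i a (y : 'rV[R]_k.+1) : 'M[R]_(k.+1, n.+1) :=
  jac (ldom i a) (loc i a) y.

Definition pullback : tensor_field Y := fun i y =>
  let a := chart_at (iota (psi i y)) in
  ljac i a y *m g a (loc i a y) *m (ljac i a y)^T.

Definition immersion_C2h (theta : R) : Prop :=
  [/\ continuous iota,
      forall i a c, Ckh 2 theta (ldom i a) (fun y => loc i a y 0 c) &
      forall i a y, ldom i a y -> row_free (ljac i a y)].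

Definition boundary_immersion : Prop :=
  (forall q, bdry Y q -> bdry X (iota q)) /\
  forall i a y, cdom (bdry Y `&` iota @^-1` dom a) i y ->
    row_free (row' 0 (col' 0 (ljac i a y))).

(* At a boundary point the tangent space of the boundary is { t | t 0 0 = 0 }. *)
Definition transverse_to_boundary : Prop :=
  forall i a y, ldom i a y -> bdry X (iota (psi i y)) ->
    forall w : 'rV[R]_n.+1, exists v (t : 'rV[R]_n.+1),
      t 0 0 = 0 /\ w = v *m ljac i a y + t.

Definition cc_submanifold (theta : R) : Prop :=
  [/\ immersion_C2h theta,
      forall p, inter Y p -> inter X (iota p),
      conf_compact C0 pullback,
      boundary_immersion & transverse_to_boundary].

(* covariant derivative along iota: nabla_{d_p} (d_q iota) *)
Definition cov_hessian i a (p q : 'I_k.+1) (y : 'rV[R]_k.+1) : 'rV[R]_n.+1 :=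
  \row_c (pd (ldom i a) p (pd (ldom i a) q (fun z => loc i a z 0 c)) y
    + \sum_b \sum_d \sum_e
        invmx (g a (loc i a y)) c e
        * christoffel (cdom (inter X) a) (g a) b d e (loc i a y)
        * ljac i a y p b * ljac i a y q d).

Definition induced i a (y : 'rV[R]_k.+1) : 'M[R]_k.+1 :=
  ljac i a y *m g a (loc i a y) *m (ljac i a y)^T.

Definition normal_part i a (y : 'rV[R]_k.+1) (w : 'rV[R]_n.+1) : 'rV[R]_n.+1 :=
  w - w *m g a (loc i a y) *m (ljac i a y)^T *m invmx (induced i a y)
        *m ljac i a y.

Definition second_fundamental_form i a p q (y : 'rV[R]_k.+1) : 'rV[R]_n.+1 :=
  normal_part i a y (cov_hessian i a p q y).

Definition mean_curvature i a (y : 'rV[R]_k.+1) : 'rV[R]_n.+1 :=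
  \sum_p \sum_q invmx (induced i a y) p q *: second_fundamental_form i a p q y.

(* g(H, H) = C^2 + O(r) at the boundary; g(H, H) is independent of the charts
   in which it is evaluated. *)
Definition mean_curvature_limit (C : R) : Prop :=
  forall r : X -> R, defining_function r ->
    exists K d : R, 0 < d /\
      forall i a y, cdom (inter Y `&` iota @^-1` dom a) i y ->
        r (iota (psi i y)) < d ->
        `| ip (g a (loc i a y)) (mean_curvature i a y) (mean_curvature i a y)
           - C ^+ 2 | <= K * r (iota (psi i y)).

Definition asym_CMC (theta C : R) : Prop :=
  [/\ cc_submanifold theta, 0 <= C & mean_curvature_limit C].

Definition asym_minimal (theta : R) : Prop := asym_CMC theta 0.

End Submanifold.

(* Main.v *)
(* Let r be a defining function of X, gbar = r^2 g, rho = r o iota and let hb be the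
   metric induced by gbar, so that the pullback of g is h = hb / rho^2.

   Curvature.  hb is only C^1, but in Gamma_{qkl} = <nabla_q e_k, e_l> the second
   derivatives of iota appear only as exact differentials with C^1 coefficients, so
   the 1-form q |-> Gamma_{qkl} has a continuous weak exterior derivative up to the
   boundary.  The conformal change then gives
     rho^4 Rm_{pqkl} = - |d rho|^2 (hb_qk hb_pl - hb_pk hb_ql) + rho E_{pqkl}
   with E continuous up to the boundary and with the antisymmetries of Rm.  As the
   denominator of the sectional curvature is rho^-4 times that of hb, the sectional
   curvatures tend to - |d rho|^2_hb.

   Mean curvature.  The second fundamental forms for g and gbar differ by a multiple
   of hb and the normal part N of grad r, whence g(H, H) = |rho Z + (k + 1) N|^2
   with Z bounded.  At the boundary |N|^2 = |dr|^2 - |d rho|^2 = 1 - |d rho|^2, so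
   C^2 = (k + 1)^2 (1 - |d rho|^2). *)

Require Import Defs.
From mathcomp Require Import all_boot all_order all_algebra.
From mathcomp Require Import all_classical all_reals all_analysis.
From mathcomp Require Import ring lra.
Import Order.TTheory GRing.Theory Num.Theory.
Import numFieldNormedType.Exports.

Set Implicit Arguments.
Unset Strict Implicit.
Unset Printing Implicit Defensive.

Local Open Scope classical_set_scope.
Local Open Scope ring_scope.

(** The sectional curvatures must converge uniformly over all planes, however small the angle
    between the spanning vectors, so boundedness of E is not enough: its contribution has to be
    compared with the Gram determinant. The antisymmetries of E in both pairs of indices allow v to
    be replaced by its component orthogonal to u, which gives the bound. In the first pair,
    antisymmetry is built into an exterior derivative. In the second it would usually come from
    commuting second derivatives of the metric, which need not exist here. It is obtained from
    uniqueness instead: Gamma_{qkl} + Gamma_{qlk} is the differential of h_kl, and a 1-form has at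
    most one continuous weak exterior derivative. The same uniqueness yields the symmetry of second
    derivatives and makes the tensor independent of the chart of X.

    Two conditions go beyond these limits. The asymptotic curvature must be negative, that is C < k
    + 1; this holds because transversality forces d rho to be nonzero on the boundary. And |dr'|^2
    must be computed for every compactification of Y, not only for the one given by rho. *)

Lemma cvg_bigsum {R : realType} {T : Type} (F : set_system T) {FF : Filter F}
    (I : Type) (f : I -> T -> R) (s : seq I) (l : I -> R) :
  (forall i, f i @ F --> l i) ->
  (fun x => \sum_(i <- s) f i x) @ F --> \sum_(i <- s) l i.
Proof.
move=> H; elim: s => [|i s IH].
  by under eq_fun do rewrite big_nil; rewrite big_nil; exact: cvg_cst.
by under eq_fun do rewrite big_cons; rewrite big_cons; apply: cvgD.
Qed.

(** * Calculus up to the boundary of the half-space *)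

Section Continuity.
Context {R : realType} {T : topologicalType}.
Implicit Types (A : set T) (f g : T -> R).

Definition cont A f : Prop := forall x, A x -> f @ within A (nbhs x) --> f x.

Lemma contP A f : {within A, continuous f} <-> cont A f.
Proof. exact: subspace_continuousP. Qed.

Lemma cont_cst A (c : R) : cont A (fun=> c).
Proof. by move=> x Ax; exact: cvg_cst. Qed.

Lemma contD A f g : cont A f -> cont A g -> cont A (fun x => f x + g x).
Proof. by move=> cf cg x Ax; apply: cvgD; [exact: cf|exact: cg]. Qed.

Lemma contN A f : cont A f -> cont A (fun x => - f x).
Proof. by move=> cf x Ax; apply: cvgN; exact: cf. Qed.

Lemma contB A f g : cont A f -> cont A g -> cont A (fun x => f x - g x).
Proof. by move=> cf cg; apply: contD => //; exact: contN. Qed.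

Lemma contM A f g : cont A f -> cont A g -> cont A (fun x => f x * g x).
Proof. by move=> cf cg x Ax; apply: cvgM; [exact: cf|exact: cg]. Qed.

Lemma contV A f : (forall x, A x -> f x != 0) -> cont A f ->
  cont A (fun x => (f x)^-1).
Proof. by move=> f0 cf x Ax; apply: cvgV; [exact: f0|exact: cf]. Qed.

Lemma cont_sum A (I : Type) (s : seq I) (P : pred I) (F : I -> T -> R) :
  (forall i, cont A (F i)) -> cont A (fun x => \sum_(i <- s | P i) F i x).
Proof.
move=> cF; elim: s => [|i s IH].
  by under eq_fun do rewrite big_nil; exact: cont_cst.
under eq_fun do rewrite big_cons.
by case: (P i) => //; apply: contD.
Qed.

Lemma cont_prod A (I : Type) (s : seq I) (P : pred I) (F : I -> T -> R) :
  (forall i, cont A (F i)) -> cont A (fun x => \prod_(i <- s | P i) F i x).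
Proof.
move=> cF; elim: s => [|i s IH].
  by under eq_fun do rewrite big_nil; exact: cont_cst.
under eq_fun do rewrite big_cons.
by case: (P i) => //; apply: contM.
Qed.

Lemma contX A f m : cont A f -> cont A (fun x => f x ^+ m).
Proof.
move=> cf; elim: m => [|m IH].
  by under eq_fun do rewrite expr0; exact: cont_cst.
by under eq_fun do rewrite exprS; exact: contM.
Qed.

Lemma cont_eq A f g : (forall x, A x -> f x = g x) -> cont A f -> cont A g.
Proof.
move=> fg cf x Ax; rewrite -fg//; apply: cvg_trans (cf x Ax).
apply: near_eq_cvg; rewrite near_withinE.
by apply: nearW => y Ay; rewrite fg.
Qed.

Lemma cont_sub A B f : A `<=` B -> cont B f -> cont A f.
Proof.
move=> AB cf x Ax; apply: cvg_trans (cf x (AB _ Ax)).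
by apply: cvg_app; apply: within_subset => //; exact: nearW.
Qed.

Lemma cont_local A f : (forall x, A x -> exists2 B, nbhs x B & cont (A `&` B) f) ->
  cont A f.
Proof.
move=> H x Ax; have [B Bx cf] := H x Ax.
move=> P /(cf x (conj Ax (nbhs_singleton Bx))) HP.
have {}HP : \forall y \near x, (A `&` B) y -> P (f y) := HP.
change (\forall y \near x, A y -> P (f y)).
by apply: filterS2 HP Bx => y HP By Ay; apply: HP.
Qed.

End Continuity.

Lemma cont_comp {R : realType} {T T' : topologicalType} (A : set T) (B : set T')
    (f : T -> R) (phi : T' -> T) :
  (forall x, B x -> A (phi x)) ->
  (forall x, B x -> phi @ within B (nbhs x) --> phi x) ->
  cont A f -> cont B (fun x => f (phi x)).
Proof.
move=> BA cphi cf x Bx P /(cf _ (BA _ Bx)) HP.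
have {}HP : \forall y \near phi x, A y -> P (f y) := HP.
have {}HP : \forall y \near x, B y -> A (phi y) -> P (f (phi y)) := cphi x Bx _ HP.
change (\forall y \near x, B y -> P (f (phi y))).
by apply: filterS HP => y HP By; apply: HP => //; exact: BA.
Qed.

(** * Continuity of matrix-valued maps *)

Section MatrixContinuity.
Context {R : realType} {T : topologicalType}.
Implicit Types (A : set T).

Definition contmx A m n (F : T -> 'M[R]_(m, n)) : Prop :=
  forall i j, cont A (fun x => F x i j).

Lemma contmx_mul A m n p (F : T -> 'M[R]_(m, n)) (G : T -> 'M[R]_(n, p)) :
  contmx A F -> contmx A G -> contmx A (fun x => F x *m G x).
Proof.
move=> cF cG i j; under eq_fun do rewrite mxE.
by apply: cont_sum => l; apply: contM; [exact: cF|exact: cG].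
Qed.

Lemma contmx_tr A m n (F : T -> 'M[R]_(m, n)) :
  contmx A F -> contmx A (fun x => (F x)^T).
Proof. by move=> cF i j; under eq_fun do rewrite mxE; exact: cF. Qed.

Lemma contmx_cst A m n (M : 'M[R]_(m, n)) : contmx A (fun=> M).
Proof. by move=> i j; exact: cont_cst. Qed.

Lemma contmxD A m n (F G : T -> 'M[R]_(m, n)) :
  contmx A F -> contmx A G -> contmx A (fun x => F x + G x).
Proof. by move=> cF cG i j; under eq_fun do rewrite mxE; exact: contD. Qed.

Lemma contmxN A m n (F : T -> 'M[R]_(m, n)) :
  contmx A F -> contmx A (fun x => - F x).
Proof. by move=> cF i j; under eq_fun do rewrite mxE; exact: contN. Qed.

Lemma contmxZ A m n f (F : T -> 'M[R]_(m, n)) :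
  cont A f -> contmx A F -> contmx A (fun x => f x *: F x).
Proof. by move=> cf cF i j; under eq_fun do rewrite mxE; exact: contM. Qed.

Lemma contmx_sum A m n (I : Type) (s : seq I) (P : pred I)
    (F : I -> T -> 'M[R]_(m, n)) :
  (forall i, contmx A (F i)) -> contmx A (fun x => \sum_(i <- s | P i) F i x).
Proof.
by move=> cF i j; under eq_fun do rewrite summxE; apply: cont_sum => l; exact: cF.
Qed.

Lemma cont_det A n (F : T -> 'M[R]_n) :
  contmx A F -> cont A (fun x => \det (F x)).
Proof.
move=> cF; apply: cont_sum => s; apply: contM; first exact: cont_cst.
by apply: cont_prod => i; exact: cF.
Qed.

Lemma contmx_inv A n (F : T -> 'M[R]_n) :
  (forall x, A x -> F x \in unitmx) -> contmx A F ->
  contmx A (fun x => invmx (F x)).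
Proof.
move=> uF cF i j.
apply: (@cont_eq _ _ _ (fun x => (\det (F x))^-1 * \adj (F x) i j)).
  by move=> x Ax; rewrite /invmx (uF _ Ax) [RHS]mxE.
apply: contM.
  apply: contV; last exact: cont_det.
  by move=> x /uF; rewrite unitmxE unitfE.
under eq_fun do rewrite mxE /cofactor.
apply: contM; first exact: cont_cst.
by apply: cont_det => a b; under eq_fun do rewrite !mxE; exact: cF.
Qed.

Lemma cont_ip A n (G : T -> 'M[R]_n) (u v : T -> 'rV[R]_n) :
  contmx A G -> contmx A u -> contmx A v ->
  cont A (fun x => ip (G x) (u x) (v x)).
Proof.
move=> cG cu cv.
exact: (contmx_mul (contmx_mul cu cG) (contmx_tr cv)).
Qed.

End MatrixContinuity.

Lemma cvg_mx_entries {R : realType} {I : Type} (F : set_system I) {FF : Filter F}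
    m n (f : I -> 'M[R]_(m, n)) (M : 'M[R]_(m, n)) :
  (forall i j, f x i j @[x --> F] --> M i j) -> f @ F --> M.
Proof.
move=> H; apply/cvg_ballP => e e0.
have : forall i j, \forall x \near F, ball (M i j) e (f x i j).
  by move=> i j; have /cvg_ballP := H i j; exact.
move=> /(_ _)/filter_forall H'.
have : \forall x \near F, forall i j, ball (M i j) e (f x i j).
  by apply: filter_forall => i; exact: H'.
by apply: filterS => x Hx; split.
Qed.

Lemma contmx_cvg {R : realType} {T : topologicalType} (A : set T) m n
    (F : T -> 'M[R]_(m, n)) x : contmx A F -> A x ->
  F @ within A (nbhs x) --> F x.
Proof. by move=> cF Ax; apply: cvg_mx_entries => i j; exact: cF. Qed.

Section Calculus.
Context {R : realType}.

Section Domain.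
Context {n : nat}.
Notation V := ('rV[R]_n.+1).
Notation H := (@half_space R n).
Notation e_ i := (delta_mx 0 i : V).
Implicit Types (A B : set V) (i : 'I_n.+1).

Definition hopen A : Prop :=
  A `<=` H /\ forall x, A x -> \forall y \near x, H y -> A y.

Lemma entry_norm (v : V) i : `|v 0 i| <= `|v|.
Proof.
rewrite [leRHS]/Num.norm/= mx_normrE.
by rewrite (@le_bigmax _ R _ 0 (fun ij : 'I_1 * 'I_n.+1 => `|v ij.1 ij.2|) (0, i)).
Qed.

Lemma norm_entries (v : V) (c : R) : 0 <= c -> (forall i, `|v 0 i| <= c) -> `|v| <= c.
Proof.
move=> c0 vc; rewrite [leLHS]/Num.norm/= mx_normrE.
by apply/bigmax_leP; split => // -[i j] _ /=; rewrite ord1.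
Qed.

Lemma norm_e i : `|e_ i| <= 1 :> R.
Proof.
apply: norm_entries => // j; rewrite mxE eqxx/=.
by case: (_ == _); rewrite ?normr1 ?normr0.
Qed.

Lemma dir_cvg (x : V) i : (fun h : R => x + h *: e_ i) @ 0 --> x.
Proof.
rewrite -[X in _ --> X]addr0 -[X in _ + X](scale0r (e_ i)).
by apply: cvgD; [exact: cvg_cst|apply: cvgZr_tmp; exact: cvg_id].
Qed.

Lemma dir_cvg0 (x : V) i A : (\forall y \near x, A y) ->
  \forall h \near (0 : R), A (x + h *: e_ i).
Proof. by move=> Ax; have /(_ _ Ax) := @dir_cvg x i. Qed.

Lemma half_spaceD (x : V) i (h : R) : H x -> 0 <= h -> H (x + h *: e_ i).
Proof.
rewrite /half_space/= !mxE => x0 h0; rewrite addr_ge0//.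
by rewrite mulr_ge0//; case: (_ && _); rewrite ?ler01.
Qed.

(** Close to [x], a displacement stays in [A] exactly when it stays in the half-space, so
    derivatives can be taken along a filter that does not mention [A]. *)
Lemma pd_nbhs_hopen A i x : hopen A -> A x -> pd_nbhs A i x = pd_nbhs H i x.
Proof.
move=> [AH Aop] Ax; apply/seteqP; split => P; rewrite /pd_nbhs /within/= => HP.
- have H1 := dir_cvg0 i (Aop _ Ax).
  near=> h => Hh; have : H (x + h *: e_ i) -> A (x + h *: e_ i).
    by near: h; apply: nbhs_dnbhs.
  by move=> /(_ Hh); near: h.
- by apply: filterS HP => h HP Ah; apply: HP; exact: AH.
Unshelve. all: by end_near. Qed.

#[global] Instance pd_nbhs_filter A i x : Filter (pd_nbhs A i x).
Proof. exact: within_filter. Qed.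

(** Small positive displacements stay in the half-space even from a boundary point. Properness makes
    limits along this filter unique, so the [lim] in [pd] is the value of any limit found. *)
Lemma pd_nbhs_proper i x : H x -> ProperFilter (pd_nbhs H i x).
Proof.
move=> Hx; apply: Build_ProperFilter_ex.
  move=> P; rewrite /pd_nbhs /within/= => HP.
  have [e /= e0 He] := HP.
  exists (e / 2); apply: He => /=.
  - by rewrite sub0r normrN gtr0_norm ?divr_gt0// ltr_pdivrMr// ltr_pMr// ltr1n.
  - by rewrite gt_eqF// divr_gt0.
  - by apply: half_spaceD => //; rewrite ltW// divr_gt0.
Qed.

Lemma pd_cvg_eq A i x (u v : R -> R) (l : R) : hopen A -> A x ->
  (forall h, h != 0 -> A (x + h *: e_ i) -> u h = v h) ->
  u @ pd_nbhs H i x --> l -> v @ pd_nbhs H i x --> l.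
Proof.
move=> hA Ax uv; rewrite -(pd_nbhs_hopen i hA Ax).
have F := pd_nbhs_filter A i x.
apply: cvg_trans; apply: near_eq_cvg; rewrite /pd_nbhs near_withinE; near=> h => Ah.
by apply: uv => //; near: h; exact: nbhs_dnbhs_neq.
Unshelve. all: by end_near. Qed.

(** The derivatives are carried along as explicit functions [f'], so that the rules below produce
    formulas, while [pd] itself is a [lim]. *)
Definition C1on A f (f' : 'I_n.+1 -> V -> R) : Prop :=
  cont A f /\ forall i,
    (forall x, A x -> diff_quot f i x @ pd_nbhs H i x --> f' i x) /\ cont A (f' i).

Lemma pd_unique i f x (d : R) : H x -> diff_quot f i x @ pd_nbhs H i x --> d ->
  pd H i f x = d.
Proof.
move=> Hx; have := pd_nbhs_proper i Hx => PF.
by move=> /cvg_lim; apply.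
Qed.

Lemma pd_hopen A i f x : hopen A -> A x -> pd A i f x = pd H i f x.
Proof. by move=> hA Ax; rewrite /pd pd_nbhs_hopen. Qed.

Lemma C1on_pd A f f' i x : hopen A -> C1on A f f' -> A x -> pd A i f x = f' i x.
Proof.
move=> hA [_ /(_ i)[df _]] Ax; rewrite pd_hopen//; apply: pd_unique; last exact: df.
by case: hA => /(_ _ Ax).
Qed.

Lemma Ck1_C1on A f : hopen A -> Ck 1 A f -> C1on A f (fun i => pd A i f).
Proof.
move=> hA [cf H1]; split; first exact/contP.
move=> i; have [df cdf] := H1 i; split; last exact/contP.
move=> x Ax; rewrite /pd pd_nbhs_hopen//.
by have := df x Ax; rewrite pd_nbhs_hopen.
Qed.

Lemma diff_quot_cvg_eq A i (f g : V -> R) x (d : R) : hopen A -> A x ->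
  (forall y, A y -> f y = g y) ->
  diff_quot f i x @ pd_nbhs H i x --> d -> diff_quot g i x @ pd_nbhs H i x --> d.
Proof.
move=> hA Ax fg; apply: (pd_cvg_eq hA Ax) => h h0 Ah.
by rewrite /diff_quot (fg _ Ah) (fg _ Ax).
Qed.

Lemma C1on_eq A f g f' g' : hopen A -> (forall y, A y -> f y = g y) ->
  (forall i y, A y -> f' i y = g' i y) -> C1on A f f' -> C1on A g g'.
Proof.
move=> hA fg fg' [cf H1]; split; first exact: cont_eq cf.
move=> i; have [df cdf] := H1 i; split; last by apply: cont_eq cdf => y; exact: fg'.
by move=> x Ax; rewrite -fg'//; apply: diff_quot_cvg_eq fg _ => //; exact: df.
Qed.

Lemma C1on_sub A B f f' : A `<=` B -> C1on B f f' -> C1on A f f'.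
Proof.
move=> AB [cf H1]; split; first exact: cont_sub cf.
move=> i; have [df cdf] := H1 i; split; last exact: cont_sub cdf.
by move=> x /AB; exact: df.
Qed.

Lemma C1on_local A f f' : (forall x, A x -> exists2 B, nbhs x B & C1on (A `&` B) f f') ->
  C1on A f f'.
Proof.
move=> H1; split.
  by apply: cont_local => x /H1[B Bx [cf _]]; exists B.
move=> i; split.
  move=> x Ax; have [B Bx [_ /(_ i)[df _]]] := H1 x Ax.
  by apply: df; split => //; exact: nbhs_singleton.
by apply: cont_local => x /H1[B Bx [_ /(_ i)[_ cf]]]; exists B.
Qed.

Lemma C1on_Ck1 A f f' : hopen A -> C1on A f f' -> Ck 1 A f.
Proof.
move=> hA cf; split; first by apply/contP; case: cf.
move=> i; split.
  move=> x Ax; rewrite pd_nbhs_hopen//; apply/cvg_ex; exists (f' i x).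
  by case: cf => _ /(_ i)[+ _]; apply.
apply/contP; apply: (@cont_eq _ _ _ (f' i)); last by case: cf => _ /(_ i)[].
by move=> x Ax; rewrite (C1on_pd _ hA cf).
Qed.

Lemma C1on_cst A (c : R) : C1on A (fun=> c) (fun _ _ => 0).
Proof.
split; first exact: cont_cst.
move=> i; split; last exact: cont_cst.
move=> x _; rewrite (_ : diff_quot _ _ _ = cst 0); first exact: cvg_cst.
by apply/funext => h; rewrite /diff_quot subrr mulr0.
Qed.

Lemma C1onD A f f' g g' : C1on A f f' -> C1on A g g' ->
  C1on A (fun x => f x + g x) (fun i x => f' i x + g' i x).
Proof.
move=> [cf Hf] [cg Hg]; split; first exact: contD.
move=> i; have [df cdf] := Hf i; have [dg cdg] := Hg i; split; last exact: contD.
move=> x Ax; rewrite (_ : diff_quot _ _ _ = diff_quot f i x \+ diff_quot g i x).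
  by apply: cvgD; [exact: df|exact: dg].
by apply/funext => h; rewrite /= /diff_quot; ring.
Qed.

Lemma C1on_coord A c : hopen A -> C1on A (fun x => x 0 c) (fun i _ => (i == c)%:R).
Proof.
move=> hA; split.
  move=> x Ax; apply: cvg_trans; last exact: (@coord_continuous _ _ _ 0 c x).
  by apply: cvg_app; exact: cvg_within.
move=> i; split; last exact: cont_cst.
move=> x Ax; apply: (@pd_cvg_eq A i x (cst (i == c)%:R)) => //; last exact: cvg_cst.
move=> h h0 _; rewrite /diff_quot !mxE eqxx/= eq_sym addrAC subrr add0r mulrA.
by rewrite mulVf ?mul1r.
Qed.

Lemma diff_quot_shift A i (f : V -> R) x : A x -> cont A f -> hopen A ->
  f (x + h *: e_ i) @[h --> pd_nbhs H i x] --> f x.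
Proof.
move=> Ax cf hA P /(cf x Ax) HP.
have {}HP : \forall y \near x, A y -> P (f y) := HP.
have HP' := dir_cvg0 i HP.
rewrite -(pd_nbhs_hopen i hA Ax).
change (\forall h \near 0^', A (x + h *: e_ i) -> P (f (x + h *: e_ i))).
exact: nbhs_dnbhs.
Qed.

Lemma C1onM A f f' g g' : hopen A -> C1on A f f' -> C1on A g g' ->
  C1on A (fun x => f x * g x) (fun i x => f' i x * g x + f x * g' i x).
Proof.
move=> hA [cf Hf] [cg Hg]; split; first exact: contM.
move=> i; have [df cdf] := Hf i; have [dg cdg] := Hg i; split.
  move=> x Ax.
  rewrite (_ : diff_quot _ _ _ = (diff_quot f i x \* cst (g x)) \+
      ((fun h => f (x + h *: e_ i)) \* diff_quot g i x)).
    apply: cvgD; apply: cvgM; [exact: df|exact: cvg_cst| |exact: dg].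
    exact: diff_quot_shift hA.
  by apply/funext => h; rewrite /= /diff_quot; ring.
by apply: contD; apply: contM.
Qed.

Lemma C1on_sum A (I : Type) (s : seq I) (F : I -> V -> R) F' :
  (forall j, C1on A (F j) (F' j)) ->
  C1on A (fun x => \sum_(j <- s) F j x) (fun i x => \sum_(j <- s) F' j i x).
Proof.
move=> cF; elim: s => [|j s IH].
  under eq_fun do rewrite big_nil.
  rewrite [X in C1on _ _ X](_ : _ = (fun _ _ => 0)); first exact: C1on_cst.
  by apply/funext => i; apply/funext => x; rewrite big_nil.
under eq_fun do rewrite big_cons.
rewrite [X in C1on _ _ X](_ : _ = (fun i x => F' j i x + \sum_(j <- s) F' j i x)).
  exact: C1onD.
by apply/funext => i; apply/funext => x; rewrite big_cons.
Qed.

Lemma C1onV A f f' : hopen A -> (forall x, A x -> f x != 0) -> C1on A f f' ->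
  C1on A (fun x => (f x)^-1) (fun i x => - f' i x / (f x) ^+ 2).
Proof.
move=> hA f0 [cf Hf]; split; first exact: contV.
move=> i; have [df cdf] := Hf i; split.
  move=> x Ax.
  pose u h := - diff_quot f i x h * (f (x + h *: e_ i))^-1 * (f x)^-1.
  apply: (@pd_cvg_eq A i x u) => //.
    by move=> h h0 Ah; rewrite /u /diff_quot; field; rewrite !f0.
  rewrite expr2 invfM mulrA; apply: cvgM; last exact: cvg_cst.
  apply: cvgM; first by apply: cvgN; exact: df.
  by apply: cvgV; [exact: f0|exact: diff_quot_shift hA].
apply: contM; first exact: contN.
by apply: contV; [move=> x /f0; rewrite sqrf_eq0|exact: contX].
Qed.

(** A displacement in a direction other than 0 does not change coordinate 0. Derivatives are thus
    two-sided at interior points, and in tangential directions even on the boundary. *)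
Lemma pd_nbhs_interior i x : H x -> (i != 0) || (0 < x 0 0) -> pd_nbhs H i x = 0^'.
Proof.
move=> Hx ix.
have Hn : \forall h \near (0 : R), H (x + h *: e_ i).
  case/orP: ix => [i0|x0]; last first.
    apply: dir_cvg0; have := @coord_continuous R 1 n.+1 0 0 x.
    by move=> /cvgr_gt/(_ _ x0); apply: filterS => y /ltW.
  have E (h : R) : H (x + h *: e_ i).
    by rewrite /half_space/= !mxE eqxx eq_sym (negPf i0)/= mulr0 addr0.
  by apply: filterE => h; exact: E.
apply/seteqP; split => P; rewrite /pd_nbhs /within/= => HP; last first.
  by apply: filterS HP.
by apply: filterS2 (nbhs_dnbhs Hn) HP => h H1; apply.
Qed.

Lemma C1on_is_derive (f : V -> R) f' A i y (t : R) : C1on A f f' -> hopen A ->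
  A (y + t *: e_ i) -> (i != 0) || (0 < (y + t *: e_ i) 0 0) ->
  is_derive t (1 : R) (fun s : R => f (y + s *: e_ i)) (f' i (y + t *: e_ i)).
Proof.
move=> [_ /(_ i)[df _]] hA Ax x0.
have {}df := df _ Ax; rewrite pd_nbhs_interior// in df; last by case: hA => + _; exact.
have dq : (fun h => h^-1 *: (f (y + (h *: (1 : R) + t) *: e_ i) - f (y + t *: e_ i)))
    @ 0^' --> f' i (y + t *: e_ i).
  apply: cvg_trans df; apply: near_eq_cvg; apply: nearW => h /=.
  by rewrite /diff_quot -addrA -scalerDl (addrC t) /GRing.scale/= mulr1.
split; first by apply/cvg_ex; exists (f' i (y + t *: e_ i)).
by rewrite /derive; apply/cvg_lim.
Qed.

Lemma coordD (y : V) i (t : R) c : (y + t *: e_ i) 0 c = y 0 c + t * (c == i)%:R.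
Proof. by rewrite !mxE eqxx. Qed.

(** The mean value theorem asks for derivatives only on the open segment. For [i = 0] its points lie
    off the boundary because [h] is nonnegative, even when [y] lies on it. *)
Lemma partial_MVT (f : V -> R) f' A i (y : V) (h : R) : C1on A f f' -> hopen A -> 0 <= h ->
  (forall t, 0 <= t <= h -> A (y + t *: e_ i)) ->
  exists2 t, 0 <= t <= h & f (y + h *: e_ i) - f y = h * f' i (y + t *: e_ i).
Proof.
move=> cf hA h0 Ay.
pose u (s : R) := f (y + s *: e_ i).
have [t| |t th E] := @MVT_segment R u (fun t => f' i (y + t *: e_ i)) 0 h h0.
- rewrite in_itv/= => /andP[t0 th].
  apply: (C1on_is_derive cf) => //; first by apply: Ay; rewrite !ltW.
  have [i0|//] := eqVneq i 0.
  rewrite i0 coordD eqxx mulr1 ltr_wpDl//.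
  have : A y by have := Ay 0; rewrite scale0r addr0; apply; rewrite lexx h0.
  by case: hA => /(_ y).
- apply/contP.
  apply: (cont_comp (phi := fun s : R => y + s *: e_ i) (A := A)) cf.1.
    by move=> s /=; rewrite in_itv/=; exact: Ay.
  move=> s _; apply: cvg_within_filter; apply: cvgD; [exact: cvg_cst|apply: cvgZr_tmp; exact: cvg_id].
- exists t; first by move: th; rewrite in_itv.
  by move: E; rewrite /u scale0r addr0 subr0 mulrC.
Qed.

Lemma near_half (P : V -> Prop) (x : V) : (\forall y \near x, H y -> P y) ->
  exists2 d : R, 0 < d & forall y : V, H y -> `|y - x| < d -> P y.
Proof.
move=> /nbhs_ballP[d /= d0 Hd]; exists d => // y Hy yx; apply: Hd => //.
by rewrite -ball_normE/= distrC.
Qed.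

Lemma cont_dist A (f : V -> R) x (e : R) : hopen A -> cont A f -> A x -> 0 < e ->
  exists2 d : R, 0 < d & forall y : V, H y -> `|y - x| < d -> A y /\ `|f y - f x| < e.
Proof.
move=> [AH Aop] cf Ax e0; apply: near_half.
have /cvgr_dist_lt/(_ _ e0) Hf := cf x Ax.
have {}Hf : \forall y \near x, A y -> `|f x - f y| < e := Hf.
apply: filterS2 Hf (Aop x Ax) => y Hf Ay Hy; split; first exact: Ay.
by rewrite distrC; apply: Hf; exact: Ay.
Qed.

(** Strict differentiability: the base point [y] moves as well as the step. The total differential,
    built one coordinate at a time, and the joint limits in the weak exterior derivative rely on
    this uniformity. *)
Lemma partial_strict (f : V -> R) f' A i x (e : R) : C1on A f f' -> hopen A -> A x ->
  0 < e -> exists2 d : R, 0 < d & forall (y : V) (h : R), `|y - x| < d -> `|h| < d -> H y ->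
    H (y + h *: e_ i) -> `|f (y + h *: e_ i) - f y - h * f' i x| <= e * `|h|.
Proof.
move=> cf hA Ax e0.
have [d d0 Hd] := cont_dist hA (cf.2 i).2 Ax e0.
exists (d / 4); first by rewrite divr_gt0.
have main (y : V) (h : R) : 0 <= h -> `|y - x| + h < d -> H y ->
    `|f (y + h *: e_ i) - f y - h * f' i x| <= e * h.
  move=> h0 yx Hy.
  have close t : 0 <= t <= h -> H (y + t *: e_ i) /\ `|y + t *: e_ i - x| < d.
    move=> /andP[t0 th]; split; first exact: half_spaceD.
    apply: le_lt_trans yx; rewrite addrAC (le_trans (ler_normD _ _))// lerD2l.
    rewrite normrZ ger0_norm// (le_trans _ th)// ler_piMr//; exact: norm_e.
  have [|t th ->] := partial_MVT (i := i) cf hA h0 (y := y).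
    by move=> t /close[Ht tx]; case: (Hd _ Ht tx).
  have [Ht tx] := close t th.
  rewrite -mulrBr normrM (ger0_norm h0) mulrC ler_wpM2r// ltW//.
  by case: (Hd _ Ht tx).
move=> y h yx hd Hy Hyh.
have [h0|h0] := leP 0 h.
  rewrite (ger0_norm h0) main//; move: hd yx; rewrite (ger0_norm h0).
  by clear -d0; lra.
(* A negative step from [y] is a positive step from [y + h *: e_ i], so the case already treated
   applies with the end points exchanged. *)
have yE : y + h *: e_ i + (- h) *: e_ i = y.
  by rewrite scaleNr addrK.
have := main (y + h *: e_ i) (- h); rewrite yE (ltr0_norm h0) oppr_ge0 => M.
rewrite (_ : f _ - _ - _ = - (f y - f (y + h *: e_ i) - - h * f' i x)); last by ring.
rewrite normrN; apply: M => //; first exact: ltW.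
have : `|y + h *: e_ i - x| <= `|y - x| + - h.
  rewrite addrAC (le_trans (ler_normD _ _))// lerD2l normrZ (ltr0_norm h0).
  have hh : 0 <= - h by rewrite oppr_ge0 ltW.
  by rewrite ler_piMr//; exact: norm_e.
by move: hd yx; rewrite (ltr0_norm h0); clear -d0; lra.
Qed.

Lemma total_diff (f : V -> R) f' A x (e : R) : C1on A f f' -> hopen A -> A x ->
  0 < e -> exists2 d : R, 0 < d & forall y : V, `|y - x| < d -> H y ->
    `|f y - f x - \sum_i (y - x) 0 i * f' i x| <= e * `|y - x|.
Proof.
move=> cf hA Ax e0.
pose e1 := e / n.+1%:R.
have e10 : 0 < e1 by rewrite divr_gt0// ltr0n.
have Hd i := @partial_strict f f' A i x e1 cf hA Ax e10.
have [d d0 {}Hd] : exists2 d : R, 0 < d & forall i, forall (y : V) (h : R),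
    `|y - x| < d -> `|h| < d -> H y -> H (y + h *: e_ i) ->
    `|f (y + h *: e_ i) - f y - h * f' i x| <= e1 * `|h|.
  have /choice[d Hd'] : forall i, exists d : R, 0 < d /\ forall (y : V) (h : R),
      `|y - x| < d -> `|h| < d -> H y -> H (y + h *: e_ i) ->
      `|f (y + h *: e_ i) - f y - h * f' i x| <= e1 * `|h|.
    by move=> i; have [d ? ?] := Hd i; exists d.
  exists (\big[Order.min/1]_i d i).
    by apply/bigmin_gtP; split => // i _; case: (Hd' i).
  move=> i y h /bigmin_gtP[_ /(_ i isT) yd] /bigmin_gtP[_ /(_ i isT) hd].
  by case: (Hd' i) => _; apply.
exists d => // y yx Hy.
(* A staircase from [x] to [y]: [z j] takes its first [j] coordinates from [y] and the others from
   [x]. It stays in the half-space since its coordinate 0 is that of [x] or of [y]. *)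
pose z (j : nat) : V := \row_(c < n.+1) (if (c < j)%N then y 0 c else x 0 c).
have Hx : H x by case: hA => /(_ _ Ax).
have Hz j : H (z j) by rewrite /half_space/= mxE; case: ifP.
have zx j : `|z j - x| <= `|y - x|.
  apply: norm_entries => // c; rewrite !mxE; case: ifP => _.
    by have := entry_norm (y - x) c; rewrite !mxE.
  by rewrite subrr normr0.
have zS (j : 'I_n.+1) : z j.+1 = z j + (y - x) 0 j *: e_ j.
  apply/rowP => c; rewrite coordD !mxE ltnS; case: (ltngtP c j) => cj.
  - by rewrite (_ : c == j = false) ?mulr0 ?addr0//; apply/negbTE; rewrite -val_eqE/= ltn_eqF.
  - by rewrite (_ : c == j = false) ?mulr0 ?addr0//; apply/negbTE; rewrite -val_eqE/= gtn_eqF.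
  - by rewrite (val_inj cj) eqxx mulr1 addrCA subrr addr0.
have -> : f y - f x = \sum_(j < n.+1) (f (z j.+1) - f (z j)).
  rewrite -(big_mkord xpredT (fun j => f (z j.+1) - f (z j))).
  rewrite telescope_sumr//; congr (f _ - f _); apply/rowP => c; rewrite mxE//.
  by rewrite ltn_ord.
rewrite -sumrB (le_trans (ler_norm_sum _ _ _))//.
have -> : e * `|y - x| = \sum_(j < n.+1) e1 * `|y - x|.
  by rewrite sumr_const card_ord -mulr_natr /e1 mulrAC divfK ?pnatr_eq0.
apply: ler_sum => j _; rewrite zS (le_trans (Hd j (z j) ((y - x) 0 j) _ _ _ _))//.
- exact: le_lt_trans yx.
- by apply: le_lt_trans yx; exact: entry_norm.
- by rewrite -zS.
- by apply: ler_wpM2l; [exact: ltW|exact: entry_norm].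
Qed.

Lemma hopenI A B : hopen A -> hopen B -> hopen (A `&` B).
Proof.
move=> [AH Ao] [BH Bo]; split; first by move=> x [/AH].
by move=> x [Ax Bx]; apply: filterS2 (Ao x Ax) (Bo x Bx) => y Ay By Hy; split; auto.
Qed.

Lemma hopen_interior A : hopen A -> hopen (A `&` [set x | 0 < x 0 0]).
Proof.
move=> [AH Ao]; split; first by move=> x [/AH].
move=> x [Ax x0]; have := @coord_continuous R 1 n.+1 0 0 x.
move=> /cvgr_gt/(_ _ x0) x0'; apply: filterS2 (Ao x Ax) x0' => y Ay y0 Hy.
by split; auto.
Qed.

Lemma hopen_open_nbhs A x : hopen A -> A x -> 0 < x 0 0 -> \forall y \near x, A y.
Proof.
move=> [AH Ao] Ax x0; have := @coord_continuous R 1 n.+1 0 0 x.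
move=> /cvgr_gt/(_ _ x0) x0'; apply: filterS2 (Ao x Ax) x0' => y Ay y0.
by apply: Ay; exact: ltW.
Qed.

(* Interior points are dense in A. *)
Lemma cont_eq_interior A (f g : V -> R) : hopen A -> cont A f -> cont A g ->
  (forall x, A x -> 0 < x 0 0 -> f x = g x) -> forall x, A x -> f x = g x.
Proof.
move=> hA cf cg fg x Ax; apply/eqP; rewrite -subr_eq0; apply/eqP.
apply/eqP; rewrite -normr_le0; apply/ler_addgt0Pl => e e0; rewrite addr0.
have cfg := contB cf cg.
have [d d0 Hd] := cont_dist hA cfg Ax e0.
have Hx : H x by case: hA => /(_ _ Ax).
pose y := x + (d / 2) *: e_ 0.
have [||Ay] := Hd y.
- by apply: half_spaceD => //; rewrite divr_ge0// ltW.
- rewrite addrAC subrr add0r normrZ gtr0_norm ?divr_gt0//.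
  rewrite (@le_lt_trans _ _ (d / 2))//; last by lra.
  have d2 : 0 <= d / 2 by rewrite divr_ge0// ltW.
  by rewrite ler_piMr//; exact: norm_e.
rewrite fg//.
  by rewrite subrr add0r normrN => /ltW.
by rewrite coordD eqxx mulr1 ltr_wpDl// divr_gt0.
Qed.

End Domain.

(** * The chain rule *)

Section Chain.
Context {m n : nat}.
Notation V := ('rV[R]_m.+1).
Notation W := ('rV[R]_n.+1).

(** The difference quotient splits into the differential of [g] applied to the quotient [q] of [F],
    and a remainder. Total differentiability bounds the remainder by a small multiple of [|q|], and
    [q] is bounded because it converges. *)
Lemma C1on_comp (A : set V) (B : set W) (F : V -> W) (F' : 'I_n.+1 -> 'I_m.+1 -> V -> R)
    (g : W -> R) g' :
  hopen A -> hopen B -> (forall x, A x -> B (F x)) ->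
  (forall c, C1on A (fun x => F x 0 c) (F' c)) -> C1on B g g' ->
  C1on A (fun x => g (F x)) (fun i x => \sum_c g' c (F x) * F' c i x).
Proof.
move=> hA hB AB cF cg.
have cvF x : A x -> F @ within A (nbhs x) --> F x.
  move=> Ax; apply: (@contmx_cvg _ _ A 1 n.+1 F) => // i j; rewrite ord1.
  exact: (cF j).1.
split; first exact: (cont_comp AB cvF cg.1).
move=> i; split; last first.
  apply: cont_sum => c; apply: contM; last exact: ((cF c).2 i).2.
  exact: (cont_comp AB cvF (cg.2 c).2).
move=> x Ax.
pose q (h : R) : W := h^-1 *: (F (x + h *: delta_mx 0 i) - F x).
have qc c : q h 0 c @[h --> pd_nbhs (@half_space R m) i x] --> F' c i x.
  apply: cvg_trans (((cF c).2 i).1 x Ax); apply: near_eq_cvg.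
  by apply: filterE => h; rewrite /q /diff_quot !mxE.
have qF : q @ pd_nbhs (@half_space R m) i x --> \row_c F' c i x.
  apply: cvg_mx_entries => a c; rewrite ord1 mxE; exact: qc.
have PF := pd_nbhs_proper i (hA.1 _ Ax).
pose M := `|\row_c F' c i x| + 1.
have M0 : 0 < M by rewrite ltr_wpDl.
have bq : \forall h \near pd_nbhs (@half_space R m) i x, `|q h| < M.
  by have /cvgr_norm_lt := qF; apply; rewrite ltrDl.
have lin : \sum_c g' c (F x) * q h 0 c @[h --> pd_nbhs (@half_space R m) i x] -->
    \sum_c g' c (F x) * F' c i x.
  apply: (@cvg_bigsum _ _ _ _ _ (fun c h => g' c (F x) * q h 0 c)) => c.
  by apply: cvgM; [exact: cvg_cst|exact: qc].
suff rest : (diff_quot (fun x => g (F x)) i x h - \sum_c g' c (F x) * q h 0 c)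
    @[h --> pd_nbhs (@half_space R m) i x] --> 0.
  rewrite -(add0r (\sum_c _)) (_ : diff_quot _ i x = (fun h =>
    (diff_quot (fun x => g (F x)) i x h - \sum_c g' c (F x) * q h 0 c) +
    \sum_c g' c (F x) * q h 0 c)); first exact: cvgD.
  by apply/funext => h; rewrite subrK.
apply/cvgr0Pnorm_le => e e0.
have [d d0 Hd] := total_diff cg hB (AB _ Ax) (divr_gt0 e0 M0).
have Fn : \forall h \near pd_nbhs (@half_space R m) i x,
    A (x + h *: delta_mx 0 i) /\ `|F (x + h *: delta_mx 0 i) - F x| < d.
  rewrite -(pd_nbhs_hopen i hA Ax).
  have /cvgr_dist_lt/(_ _ d0) Hf := cvF x Ax.
  have {}Hf : \forall y \near x, A y -> `|F x - F y| < d := Hf.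
  have {}Hf := dir_cvg0 i Hf.
  rewrite /pd_nbhs near_withinE; apply: nbhs_dnbhs; apply: filterS Hf => h Hf Ah.
  by split => //; rewrite distrC; exact: Hf.
have hn0 : \forall h \near pd_nbhs (@half_space R m) i x, h != 0.
  by rewrite /pd_nbhs near_withinE; apply: filterS (nbhs_dnbhs_neq _).
near=> h.
have h0 : h != 0 by near: h.
have [Ah Fh] : A (x + h *: delta_mx 0 i) /\ `|F (x + h *: delta_mx 0 i) - F x| < d.
  by near: h.
have := Hd _ Fh (hB.1 _ (AB _ Ah)).
set D := F _ - F x => HD.
have -> : diff_quot (fun x => g (F x)) i x h - \sum_c g' c (F x) * q h 0 c =
    h^-1 * (g (F (x + h *: delta_mx 0 i)) - g (F x) - \sum_c D 0 c * g' c (F x)).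
  rewrite mulrBr mulr_sumr; congr (_ - _); apply: eq_bigr => c _.
  by rewrite /q -/D mxE; ring.
rewrite normrM (le_trans (ler_wpM2l _ HD))//.
have -> : `|h^-1| * (e / M * `|D|) = e / M * `|q h|.
  by rewrite /q -/D normrZ; ring.
rewrite -[leRHS](divfK (lt0r_neq0 M0)) ler_wpM2l ?divr_ge0 ?ltW//.
by near: h.
Unshelve. all: by end_near. Qed.

End Chain.
End Calculus.

(** * Weak exterior derivatives of 1-forms *)

Section Interval.
Context {R : realType}.
Notation mu := (@lebesgue_measure R).
Implicit Types (u v : R) (f : R -> R).

(** The supremum of the [b] with [Q u b] is reached and, were it below [v], could be passed. In this
    form compactness of [[u, v]] applies to any relation that is additive under concatenation, be it
    a uniform estimate or a limit of integrals. *)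
Lemma cousin u v (Q : R -> R -> Prop) : u <= v ->
  (forall a b c, u <= a -> a <= b -> b <= c -> c <= v -> Q a b -> Q b c -> Q a c) ->
  (forall x, u <= x <= v -> exists2 d : R, 0 < d & forall a b,
     u <= a -> a <= x -> x <= b -> b <= v -> x - d < a -> b < x + d -> Q a b) ->
  Q u v.
Proof.
move=> uv Qtrans Qloc.
pose S := [set b | u <= b <= v /\ Q u b].
have Su : S u.
  split; first by rewrite lexx.
  have [|d d0] := Qloc u; first by rewrite lexx.
  by apply => //; [rewrite ltrBlDr ltrDl|rewrite ltrDl].
have hS : has_sup S by split; [exists u|exists v => b [/andP[]]].
have um : u <= sup S by apply: ub_le_sup => //; case: hS.
have mv : sup S <= v by apply: ge_sup; [exists u|move=> b [/andP[]]].
have [|d d0 Hd] := Qloc (sup S); first by rewrite um.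
have [b Sb bm] := sup_adherent d0 hS.
have [/andP[ub bv] Qb] := Sb.
have bS : b <= sup S by apply: ub_le_sup => //; case: hS.
have Qm c : sup S <= c -> c <= v -> c < sup S + d -> Q u c.
  move=> mc cv cd; apply: (Qtrans u b c) => //; first exact: le_trans mc.
  exact: Hd.
have [mlt|] := ltP (sup S) v; last first.
  by move=> vm; apply: Qm => //; rewrite (le_lt_trans vm)// ltrDl.
exfalso.
pose c := Num.min v (sup S + d / 2).
have mc : sup S < c by rewrite /c lt_min mlt ltrDl divr_gt0.
have cv : c <= v by rewrite /c ge_min lexx.
have : S c.
  split; first by rewrite cv (le_trans um (ltW mc)).
  apply: Qm => //; first exact: ltW.
  by rewrite (@le_lt_trans _ _ (sup S + d / 2))// ?ge_min ?lexx ?orbT// ltrD2l; lra.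
move=> Sc; have : c <= sup S by apply: ub_le_sup => //; case: hS.
by rewrite leNgt mc.
Qed.

(** The tube lemma with a filter in place of a space: the joint neighbourhoods at each [b] are
    joined along [[u, v]], so that [h] can be chosen before [b]. *)
Lemma tube {T : Type} (F : set_system T) {FF : Filter F} u v (P : T -> R -> Prop) :
  u <= v ->
  (forall b, u <= b <= v ->
     \forall hb \near filter_prod F (within `[u, v] (nbhs b)), P hb.1 hb.2) ->
  \forall h \near F, forall b, u <= b <= v -> P h b.
Proof.
move=> uv Ploc.
apply: (@cousin u v (fun a b => \forall h \near F, forall c, a <= c <= b -> P h c)) => //.
- move=> a b c ua ab bc cv H1 H2; apply: filterS2 H1 H2 => h H1 H2 x /andP[ax xc].
  have [xb|bx] := leP x b; first by apply: H1; rewrite ax.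
  by apply: H2; rewrite xc ltW.
- move=> x /Ploc[[A B] /= [FA FB] AB].
  have [d /= d0 Bd] := FB.
  exists d => // a b ua ax xb bv ad bd; apply: filterS FA => h Ah c /andP[ac cb].
  apply: (AB (h, c)); split => //=; apply: Bd => /=; last first.
    by rewrite in_itv/= (le_trans ua ac) (le_trans cb bv).
  rewrite ltr_distlC; apply/andP; split; first by apply: lt_le_trans ac.
  exact: le_lt_trans bd.
Qed.

Lemma cont_integrable u v f : cont `[u, v] f -> mu.-integrable `[u, v] (EFin \o f).
Proof.
move=> cf; apply: continuous_compact_integrable; first exact: segment_compact.
exact/contP.
Qed.

Lemma intervalD u v f g : cont `[u, v] f -> cont `[u, v] g ->
  \int[mu]_(x in `[u, v]) (f x + g x) =
  \int[mu]_(x in `[u, v]) f x + \int[mu]_(x in `[u, v]) g x.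
Proof. by move=> cf cg; apply: RintegralD => //; exact: cont_integrable. Qed.

Lemma intervalB u v f g : cont `[u, v] f -> cont `[u, v] g ->
  \int[mu]_(x in `[u, v]) (f x - g x) =
  \int[mu]_(x in `[u, v]) f x - \int[mu]_(x in `[u, v]) g x.
Proof. by move=> cf cg; apply: RintegralB => //; exact: cont_integrable. Qed.

Lemma intervalZ u v f r : cont `[u, v] f ->
  \int[mu]_(x in `[u, v]) (r * f x) = r * \int[mu]_(x in `[u, v]) f x.
Proof. by move=> cf; apply: RintegralZl => //; exact: cont_integrable. Qed.

Lemma eq_interval u v f g : (forall b, u <= b <= v -> f b = g b) ->
  \int[mu]_(x in `[u, v]) f x = \int[mu]_(x in `[u, v]) g x.
Proof.
by move=> fg; apply: eq_Rintegral => x; rewrite inE/= in_itv/=; exact: fg.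
Qed.

Lemma interval_cat u v w f : u <= v -> v <= w -> cont `[u, w] f ->
  \int[mu]_(x in `[u, w]) f x =
  \int[mu]_(x in `[u, v]) f x + \int[mu]_(x in `[v, w]) f x.
Proof.
move=> uv vw /cont_integrable cf.
have := @Rintegral_itvB R f (BLeft u) (BRight w) v cf.
rewrite !bnd_simp => /(_ uv vw)/eqP; rewrite subr_eq addrC => /eqP ->.
congr (_ + _); apply: Rintegral_itv_obnd_cbnd.
apply: integrableS cf => //; apply: subset_itvr; rewrite bnd_simp//.
Qed.

Lemma interval_norm_le u v f (e : R) : u <= v -> cont `[u, v] f ->
  (forall b, u <= b <= v -> `|f b| <= e) ->
  `|\int[mu]_(x in `[u, v]) f x| <= e * (v - u).
Proof.
move=> uv cf fe; have If := cont_integrable cf.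
apply: (le_trans (le_normr_Rintegral _ If)) => //.
have -> : e * (v - u) = \int[mu]_(x in `[u, v]) (cst e x).
  rewrite Rintegral_cst//= lebesgue_measure_itv/= lte_fin.
  by move: uv; rewrite le_eqVlt => /predU1P[->|->//]; rewrite ltxx subrr.
apply: le_Rintegral => //.
- by apply: cont_integrable => x ux; apply: cvg_norm; exact: cf.
- by apply: cont_integrable; exact: cont_cst.
Qed.

Lemma interval_FTC u v (F f : R -> R) : u <= v -> cont `[u, v] f ->
  (forall b, u <= b <= v -> is_derive b (1 : R) F (f b)) ->
  \int[mu]_(x in `[u, v]) f x = F v - F u.
Proof.
rewrite le_eqVlt => /predU1P[<- _ _|uv cf dF].
  by rewrite set_itv1 Rintegral_set1 subrr.
have cF b : u <= b <= v -> {for b, continuous F}.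
  move=> /dF[dFb _]; apply: differentiable_continuous.
  exact/derivable1_diffP.
rewrite /Rintegral (@continuous_FTC2 R f F)//.
- exact/contP.
- split.
  + by move=> x; rewrite in_itv/= => /andP[ux xv]; case: (dF x); rewrite ?ltW.
  + by apply: cvg_at_right_filter; apply: cF; rewrite lexx ltW.
  + by apply: cvg_at_left_filter; apply: cF; rewrite lexx ltW.
- move=> x; rewrite in_itv/= => /andP[ux xv].
  by rewrite derive1E; have [|_ ->] := dF x; rewrite ?ltW.
Qed.

(** Joint convergence in [h] and [b] at every point of the compact interval is uniform in [b] by
    [tube], and uniform convergence passes to integrals. *)
Lemma interval_cvg {T : Type} (F : set_system T) {FF : Filter F} u v
    (phi : T -> R -> R) (phi0 : R -> R) : u <= v ->
  cont `[u, v] phi0 -> (\forall h \near F, cont `[u, v] (phi h)) ->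
  (forall b, u <= b <= v ->
    phi hb.1 hb.2 @[hb --> filter_prod F (within `[u, v] (nbhs b))] --> phi0 b) ->
  \int[mu]_(x in `[u, v]) phi h x @[h --> F] --> \int[mu]_(x in `[u, v]) phi0 x.
Proof.
move=> uv c0 cphi Hloc; apply/cvgrPdist_le => e e0.
(* Adding 1 keeps the quotient meaningful when [u = v]. *)
pose e1 := e / (v - u + 1).
have uv1 : 0 < v - u + 1 by rewrite ltr_wpDl// subr_ge0.
have e10 : 0 < e1 by rewrite divr_gt0.
have : \forall h \near F, forall b, u <= b <= v -> `|phi0 b - phi h b| < e1.
  apply: (@tube T F _ u v (fun h b => `|phi0 b - phi h b| < e1)) => // b ub.
  have Hb := Hloc b ub.
  have H0 : phi0 hb.2 @[hb --> filter_prod F (within `[u, v] (nbhs b))] --> phi0 b.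
    by apply: cvg_comp (c0 b _); [exact: cvg_snd|rewrite /= in_itv].
  have C : phi0 hb.2 - phi hb.1 hb.2
      @[hb --> filter_prod F (within `[u, v] (nbhs b))] --> (0 : R).
    by rewrite -(subrr (phi0 b)); apply: cvgB.
  by move/cvgr0_norm_lt: C; apply.
apply: filterS2 cphi => h ch Hh.
rewrite -intervalB//; apply: (@le_trans _ _ (e1 * (v - u))).
  apply: interval_norm_le => //; first exact: contB.
  by move=> b /Hh/ltW.
by rewrite /e1 mulrAC ler_pdivrMr// ler_pM2l// lerDl.
Qed.

End Interval.

Section PuncturedLimits.
Context {R : realType}.
Implicit Types (f g : R -> R) (a b : R).

Lemma dnbhs0_cvgD f g a b : f @ 0^' --> a -> g @ 0^' --> b ->
  (fun h => f h + g h) @ 0^' --> a + b.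
Proof. exact: cvgD. Qed.

Lemma dnbhs0_cvgB f g a b : f @ 0^' --> a -> g @ 0^' --> b ->
  (fun h => f h - g h) @ 0^' --> a - b.
Proof. exact: cvgB. Qed.

Lemma dnbhs0_unique f a b : f @ 0^' --> a -> f @ 0^' --> b -> a = b.
Proof. by move=> fa fb; apply: cvg_unique fa fb; exact: norm_hausdorff. Qed.

Lemma dnbhs0_cvg_eq f g a : (\forall h \near 0^', f h = g h) ->
  f @ 0^' --> a -> g @ 0^' --> a.
Proof. by move=> fg; apply: cvg_trans; apply: near_eq_cvg. Qed.

End PuncturedLimits.

Section WeakCurl.
Context {R : realType} {n : nat}.
Notation V := ('rV[R]_n.+1).
Notation H := (@half_space R n).
Notation mu := (@lebesgue_measure R).
Notation e_ i := (delta_mx 0 i : V).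
Implicit Types (A : set V) (p q : 'I_n.+1).

(** Relatively open sets inside the interior, where derivatives are two-sided in every direction and
    short segments in both senses stay in the set. *)
Definition iopen A : Prop := hopen A /\ forall x, A x -> 0 < x 0 0.

Lemma iopen_nbhs A x : iopen A -> A x -> nbhs x A.
Proof. by move=> [hA A0] Ax; apply: hopen_open_nbhs => //; exact: A0. Qed.

Lemma iopenI A B : iopen A -> hopen B -> iopen (A `&` B).
Proof. by move=> [hA A0] hB; split; [exact: hopenI|move=> x [/A0]]. Qed.

(* The 1-form w has exterior derivative K in the sense that
   d/dh int_u^v w_q(x + h e_p + b e_q) db at h = 0 is what differentiation under
   the integral sign would give if w were of class C^1. *)
Definition weak_curl A (w : 'I_n.+1 -> V -> R) (K : 'I_n.+1 -> 'I_n.+1 -> V -> R) :=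
  forall p q (x : V) (u v : R), u <= v ->
    (forall b, u <= b <= v -> A (x + b *: e_ q)) ->
    h^-1 * (\int[mu]_(b in `[u, v]) w q (x + h *: e_ p + b *: e_ q)
            - \int[mu]_(b in `[u, v]) w q (x + b *: e_ q)) @[h --> 0^'] -->
    \int[mu]_(b in `[u, v]) K p q (x + b *: e_ q)
      + w p (x + v *: e_ q) - w p (x + u *: e_ q).

Lemma pt_cvg p q (x : V) {F : set_system (R * R)} {FF : Filter F} (a b : R) :
  fst @ F --> a -> snd @ F --> b ->
  (x + z.1 *: e_ p + z.2 *: e_ q) @[z --> F] --> x + a *: e_ p + b *: e_ q.
Proof.
move=> Fa Fb; apply: cvgD; first apply: cvgD; first exact: cvg_cst.
  exact: cvgZr_tmp.
exact: cvgZr_tmp.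
Qed.

Lemma cont_seg A (g : V -> R) q (y : V) u v : cont A g ->
  (forall b, u <= b <= v -> A (y + b *: e_ q)) ->
  cont `[u, v] (fun b => g (y + b *: e_ q)).
Proof.
move=> cg yA; apply: (cont_comp (phi := fun b : R => y + b *: e_ q) (A := A)) cg.
  by move=> b /=; rewrite in_itv/=; exact: yA.
move=> b _; apply: cvg_within_filter; apply: cvgD; first exact: cvg_cst.
by apply: cvgZr_tmp; exact: cvg_id.
Qed.

Lemma iopen_cvg A (g : V -> R) x : iopen A -> cont A g -> A x -> g @ x --> g x.
Proof.
move=> iA cg Ax P /(cg x Ax) HP; have {}HP : \forall y \near x, A y -> P (g y) := HP.
by apply: filterS2 HP (iopen_nbhs iA Ax) => y HP /HP.
Qed.

Section Segment.
Variables (A : set V) (p q : 'I_n.+1) (x : V) (u v : R).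
Hypotheses (iA : iopen A) (uv : u <= v).
Hypothesis sA : forall b, u <= b <= v -> A (x + b *: e_ q).
Notation FP b := (filter_prod (0 : R)^' (within `[u, v] (nbhs (b : R)))).

Lemma fst_cvg b : (fst : R * R -> R) @ FP b --> (0 : R).
Proof. by apply: cvg_trans (@cvg_fst R R _ _ _) _; exact: cvg_within. Qed.

Lemma snd_cvg b : (snd : R * R -> R) @ FP b --> b.
Proof. by apply: cvg_trans (@cvg_snd R R _ _ _) _; exact: cvg_within. Qed.

Lemma base_cvg b : (x + z.2 *: e_ q) @[z --> FP b] --> x + b *: e_ q.
Proof. by apply: cvgD; [exact: cvg_cst|apply: cvgZr_tmp; exact: snd_cvg]. Qed.

Lemma shift_cvg b : (x + z.1 *: e_ p + z.2 *: e_ q) @[z --> FP b] --> x + b *: e_ q.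
Proof.
have -> : x + b *: e_ q = x + 0 *: e_ p + b *: e_ q by rewrite scale0r addr0.
by apply: pt_cvg; [exact: fst_cvg|exact: snd_cvg].
Qed.

Lemma tube_shift : \forall h \near (0 : R)^',
  forall b, u <= b <= v -> A (x + h *: e_ p + b *: e_ q).
Proof.
apply: tube => // b ub.
exact: (@shift_cvg b _ (iopen_nbhs iA (sA ub))).
Qed.

(** The limit is joint in the shift [z.1] and the position [z.2], which is why strict
    differentiability is called for rather than differentiability at a point. *)
Lemma shift_quot_cvg (f : V -> R) f' b : C1on A f f' -> u <= b <= v ->
  z.1^-1 * (f (x + z.1 *: e_ p + z.2 *: e_ q) - f (x + z.2 *: e_ q)) @[z --> FP b] -->
  f' p (x + b *: e_ q).
Proof.
move=> cf ub; apply/cvgrPdist_le => e e0.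
have [d d0 Hd] := @partial_strict R n f f' A p _ e cf iA.1 (sA ub) e0.
have Hh : \forall z \near FP b, `|z.1| < d.
  by have /cvgr0_norm_lt := @fst_cvg b; apply.
have Hb : \forall z \near FP b, `|(x + z.2 *: e_ q) - (x + b *: e_ q)| < d.
  have /cvgr_dist_lt/(_ _ d0) := @base_cvg b.
  by apply: filterS => z; rewrite distrC.
have Hs : \forall z \near FP b, A (x + z.1 *: e_ p + z.2 *: e_ q).
  exact: (@shift_cvg b _ (iopen_nbhs iA (sA ub))).
have Hs' : \forall z \near FP b, A (x + z.2 *: e_ q).
  exact: (@base_cvg b _ (iopen_nbhs iA (sA ub))).
have Hn : \forall z \near FP b, z.1 != 0 :> R.
  exists ([set h | h != 0], setT) => /=; last by move=> z [].
  split; last exact: filterT.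
  by apply: filterS (nbhs_dnbhs_neq (0 : R)) => h.
near=> z.
have z0 : z.1 != 0 by near: z.
have Az : A (x + z.1 *: e_ p + z.2 *: e_ q) by near: z.
have Az' : A (x + z.2 *: e_ q) by near: z.
rewrite addrAC in Az *.
have zb : `|(x + z.2 *: e_ q) - (x + b *: e_ q)| < d by near: z.
have zh : `|z.1| < d by near: z.
have HH := Hd (x + z.2 *: e_ q) z.1 zb zh (iA.1.1 _ Az') (iA.1.1 _ Az).
rewrite distrC -(ler_pM2r (_ : 0 < `|z.1|)) ?normr_gt0// -normrM mulrBl mulrAC.
by rewrite mulVf// mul1r (mulrC (f' _ _)).
Unshelve. all: by end_near. Qed.

Lemma shift_val_cvg (g : V -> R) b : cont A g -> u <= b <= v ->
  g (x + z.1 *: e_ p + z.2 *: e_ q) @[z --> FP b] --> g (x + b *: e_ q).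
Proof.
by move=> cg ub; apply: cvg_comp (@shift_cvg b) (iopen_cvg iA cg (sA ub)).
Qed.

Lemma base_val_cvg (g : V -> R) b : cont A g -> u <= b <= v ->
  g (x + z.2 *: e_ q) @[z --> FP b] --> g (x + b *: e_ q).
Proof.
by move=> cg ub; apply: cvg_comp (@base_cvg b) (iopen_cvg iA cg (sA ub)).
Qed.

End Segment.

Lemma is_derive_seg A (f : V -> R) f' q (y : V) b : C1on A f f' -> iopen A ->
  A (y + b *: e_ q) ->
  is_derive b (1 : R) (fun s : R => f (y + s *: e_ q)) (f' q (y + b *: e_ q)).
Proof.
move=> cf [hA A0] Ay; apply: (C1on_is_derive cf) => //.
by rewrite (A0 _ Ay) orbT.
Qed.

(* Integration by parts in b moves the derivative from f_q to w in the
   difference quotient, so that no second derivative of f appears. *)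
Lemma weak_curl_wdf A (w f : V -> R) w' f' : iopen A -> C1on A w w' -> C1on A f f' ->
  weak_curl A (fun q x => w x * f' q x)
    (fun p q x => w' p x * f' q x - w' q x * f' p x).
Proof.
move=> iA cw cf p q x u v uv sA.
(* [h * phi h b] is the increment of [w f'_q] under the shift, minus the derivative in [b] of [w]
   times the increment of [f]. It contains first derivatives only and gives the expected limit; the
   subtracted derivative integrates to the endpoint terms. *)
pose phi h b := h^-1 * (w (x + h *: e_ p + b *: e_ q) - w (x + b *: e_ q)) *
    f' q (x + h *: e_ p + b *: e_ q) -
  w' q (x + b *: e_ q) *
    (h^-1 * (f (x + h *: e_ p + b *: e_ q) - f (x + b *: e_ q))).
have cb (g : V -> R) : cont A g -> cont `[u, v] (fun b => g (x + b *: e_ q)).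
  by move=> cg; exact: cont_seg cg sA.
have tub := @tube_shift A p q x u v iA uv sA.
have cphi : \forall h \near (0 : R)^', cont `[u, v] (phi h).
  apply: filterS tub => h sh.
  have ch (g : V -> R) : cont A g -> cont `[u, v] (fun b => g (x + h *: e_ p + b *: e_ q)).
    by move=> cg; exact: cont_seg cg sh.
  apply: contB; last first.
    apply: contM; first exact: cb (cw.2 q).2.
    apply: contM; [exact: cont_cst|apply: contB; [exact: ch cf.1|exact: cb cf.1]].
  apply: contM; last exact: ch (cf.2 q).2.
  apply: contM; [exact: cont_cst|apply: contB; [exact: ch cw.1|exact: cb cw.1]].
have ck : cont `[u, v] (fun b => w' p (x + b *: e_ q) * f' q (x + b *: e_ q) -
    w' q (x + b *: e_ q) * f' p (x + b *: e_ q)).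
  apply: (cb (fun y => w' p y * f' q y - w' q y * f' p y)).
  by apply: contB; apply: contM; try exact: (cw.2 _).2; exact: (cf.2 _).2.
have I := interval_cvg uv ck cphi.
have {}I : \int[mu]_(b in `[u, v]) phi h b @[h --> (0 : R)^'] -->
    \int[mu]_(b in `[u, v]) (w' p (x + b *: e_ q) * f' q (x + b *: e_ q) -
      w' q (x + b *: e_ q) * f' p (x + b *: e_ q)).
  apply: I => b ub; rewrite /phi; apply: cvgB; apply: cvgM.
  - exact: (@shift_quot_cvg A p q x u v iA sA w w' b cw ub).
  - exact: (@shift_val_cvg A p q x u v iA sA (f' q) b (cf.2 q).2 ub).
  - exact: (@base_val_cvg A q x u v iA sA (w' q) b (cw.2 q).2 ub).
  - exact: (@shift_quot_cvg A p q x u v iA sA f f' b cf ub).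
have B b : u <= b <= v -> w (x + b *: e_ q) *
    (h^-1 * (f (x + h *: e_ p + b *: e_ q) - f (x + b *: e_ q))) @[h --> (0 : R)^']
    --> w (x + b *: e_ q) * f' p (x + b *: e_ q).
  move=> ub; apply: cvgM; first exact: cvg_cst.
  have /(_ (x + b *: e_ q) (sA _ ub)) := (cf.2 p).1.
  rewrite pd_nbhs_interior; last 2 first.
    by apply: iA.1.1; exact: sA.
    by rewrite (iA.2 _ (sA _ ub)) orbT.
  apply: cvg_trans; apply: near_eq_cvg; apply: filterE => h.
  by rewrite /diff_quot addrAC.
have := dnbhs0_cvgB (dnbhs0_cvgD I (B v _)) (B u _); rewrite !lexx uv => /(_ isT isT).
apply: cvg_trans; apply: near_eq_cvg.
near=> h.
have h0 : h != 0 by near: h; exact: nbhs_dnbhs_neq.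
have sh : forall b, u <= b <= v -> A (x + h *: e_ p + b *: e_ q) by near: h.
have ch (g : V -> R) : cont A g -> cont `[u, v] (fun b => g (x + h *: e_ p + b *: e_ q)).
  by move=> cg; exact: cont_seg cg sh.
pose D b := f (x + h *: e_ p + b *: e_ q) - f (x + b *: e_ q).
pose F b := w (x + b *: e_ q) * D b.
pose F' b := w (x + b *: e_ q) * (f' q (x + h *: e_ p + b *: e_ q) - f' q (x + b *: e_ q))
  + D b * w' q (x + b *: e_ q).
have cF' : cont `[u, v] F'.
  apply: contD.
    apply: contM; first exact: cb cw.1.
    by apply: contB; [exact: ch (cf.2 q).2|exact: cb (cf.2 q).2].
  apply: contM; last exact: cb (cw.2 q).2.
  by apply: contB; [exact: ch cf.1|exact: cb cf.1].
have FTC : \int[mu]_(b in `[u, v]) F' b = F v - F u.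
  apply: interval_FTC => // b ub.
  have d1 := is_derive_seg cw iA (sA _ ub).
  have d2 := is_derive_seg cf iA (sA _ ub).
  have d3 := is_derive_seg cf iA (sh _ ub).
  by apply: is_deriveM.
rewrite -intervalB; last 2 first.
  exact: (ch (fun y => w y * f' q y) (contM cw.1 (cf.2 q).2)).
  exact: (cb (fun y => w y * f' q y) (contM cw.1 (cf.2 q).2)).
have -> : \int[mu]_(b in `[u, v]) (w (x + h *: e_ p + b *: e_ q) *
      f' q (x + h *: e_ p + b *: e_ q) - w (x + b *: e_ q) * f' q (x + b *: e_ q)) =
   \int[mu]_(b in `[u, v]) (h * phi h b + F' b).
  apply: eq_interval => b ub; rewrite /phi /F' /D.
  by field.
have cphih : cont `[u, v] (phi h) by near: h.
rewrite (intervalD (contM (@cont_cst _ _ _ h) cphih) cF').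
rewrite intervalZ// FTC /F /D; field => //.
Unshelve. all: by end_near. Qed.

Lemma weak_curl_eq A (w w2 : 'I_n.+1 -> V -> R) (K K2 : 'I_n.+1 -> 'I_n.+1 -> V -> R) :
  iopen A ->
  (forall q x, A x -> w q x = w2 q x) -> (forall p q x, A x -> K p q x = K2 p q x) ->
  weak_curl A w K -> weak_curl A w2 K2.
Proof.
move=> iA ww KK H1 p q x u v uv sA.
have := H1 p q x u v uv sA.
rewrite (ww p _ (sA u _)) ?lexx// (ww p _ (sA v _)) ?lexx ?uv//.
rewrite -(eq_interval (fun b ub => KK p q _ (sA b ub))).
apply: dnbhs0_cvg_eq.
apply: filterS (@tube_shift A p q x u v iA uv sA) => h sh.
by rewrite (eq_interval (fun b ub => ww q _ (sA b ub)))
  (eq_interval (fun b ub => ww q _ (sh b ub))).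
Qed.

Lemma weak_curlD A (w w2 : 'I_n.+1 -> V -> R) (K K2 : 'I_n.+1 -> 'I_n.+1 -> V -> R) :
  iopen A -> (forall q, cont A (w q)) -> (forall q, cont A (w2 q)) ->
  (forall p q, cont A (K p q)) -> (forall p q, cont A (K2 p q)) ->
  weak_curl A w K -> weak_curl A w2 K2 ->
  weak_curl A (fun q x => w q x + w2 q x) (fun p q x => K p q x + K2 p q x).
Proof.
move=> iA cw cw2 cK cK2 H1 H2 p q x u v uv sA.
have := dnbhs0_cvgD (H1 p q x u v uv sA) (H2 p q x u v uv sA).
have cb (g : V -> R) : cont A g -> cont `[u, v] (fun b => g (x + b *: e_ q)).
  by move=> cg; exact: cont_seg cg sA.
rewrite (intervalD (cb _ (cK p q)) (cb _ (cK2 p q))).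
rewrite (_ : _ + _ - _ + (_ + _ - _) = \int[mu]_(b in `[u, v]) K p q (x + b *: e_ q) +
  \int[mu]_(b in `[u, v]) K2 p q (x + b *: e_ q) +
  (w p (x + v *: e_ q) + w2 p (x + v *: e_ q)) -
  (w p (x + u *: e_ q) + w2 p (x + u *: e_ q))); last by ring.
apply: dnbhs0_cvg_eq.
apply: filterS (@tube_shift A p q x u v iA uv sA) => h sh.
have ch (g : V -> R) : cont A g -> cont `[u, v] (fun b => g (x + h *: e_ p + b *: e_ q)).
  by move=> cg; exact: cont_seg cg sh.
rewrite /= (intervalD (ch _ (cw q)) (ch _ (cw2 q))).
by rewrite (intervalD (cb _ (cw q)) (cb _ (cw2 q))); ring.
Qed.

(** The relation is additive when segments are joined, since the endpoint terms of [w p] telescope.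
    By [cousin] a segment may therefore be cut into pieces lying in the local sets. *)
Lemma weak_curl_local A (w : 'I_n.+1 -> V -> R) (K : 'I_n.+1 -> 'I_n.+1 -> V -> R) :
  iopen A -> (forall q, cont A (w q)) -> (forall p q, cont A (K p q)) ->
  (forall x, A x -> exists2 B, nbhs x B & weak_curl (A `&` B) w K) ->
  weak_curl A w K.
Proof.
move=> iA cw cK loc p q x u v uv sA.
pose Q a b := h^-1 * (\int[mu]_(b in `[a, b]) w q (x + h *: e_ p + b *: e_ q)
            - \int[mu]_(b in `[a, b]) w q (x + b *: e_ q)) @[h --> (0 : R)^'] -->
    \int[mu]_(b in `[a, b]) K p q (x + b *: e_ q)
      + w p (x + b *: e_ q) - w p (x + a *: e_ q).
apply: (@cousin R u v Q) => //.
- move=> a b c ua ab bc cv H1 H2; rewrite /Q.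
  have sub t : a <= t <= c -> u <= t <= v.
    by move=> /andP[at_ tc]; rewrite (le_trans ua at_) (le_trans tc cv).
  have ci (g : V -> R) : cont A g -> cont `[a, c] (fun b => g (x + b *: e_ q)).
    by move=> cg; apply: cont_seg cg _ => t /sub; exact: sA.
  have := dnbhs0_cvgD H1 H2.
  rewrite (interval_cat ab bc (ci _ (cK p q))).
  rewrite (_ : _ + (_ + _ - _) = \int[mu]_(b in `[a, b]) K p q (x + b *: e_ q) +
    \int[mu]_(b in `[b, c]) K p q (x + b *: e_ q) +
    w p (x + c *: e_ q) - w p (x + a *: e_ q)); last by ring.
  apply: dnbhs0_cvg_eq.
  apply: filterS (@tube_shift A p q x u v iA uv sA) => h sh.
  have ch (g : V -> R) : cont A g -> cont `[a, c] (fun b => g (x + h *: e_ p + b *: e_ q)).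
    by move=> cg; apply: cont_seg cg _ => t /sub; exact: sh.
  rewrite /= (interval_cat ab bc (ci _ (cw q))) (interval_cat ab bc (ch _ (cw q))).
  by ring.
- move=> y uy; have [B By HB] := loc _ (sA _ uy).
  have [e e0 He] : exists2 e : R, 0 < e & forall b, `|b - y| < e -> B (x + b *: e_ q).
    have C : x + b *: e_ q @[b --> y] --> x + y *: e_ q.
      by apply: cvgD; [exact: cvg_cst|apply: cvgZr_tmp; exact: cvg_id].
    have /nbhs_ballP[e /= e0 He] := C _ By.
    by exists e => // b be; apply: He; rewrite -ball_normE/= distrC.
  exists e => // a b ua ay yb bv ad bd; apply: HB; first exact: le_trans yb.
  move=> t /andP[at_ tb]; split.
    by apply: sA; rewrite (le_trans ua at_) (le_trans tb bv).
  apply: He; rewrite ltr_distl; apply/andP; split.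
    exact: lt_le_trans at_.
  exact: le_lt_trans bd.
Qed.

(** Equality of the two limits gives [K p q - K2 p q] integral zero over every segment in direction
    [q]. On a short one starting at [x] the difference is nearly its value at [x], which is
    therefore arbitrarily small. *)
Lemma weak_curl_unique A (w : 'I_n.+1 -> V -> R) (K K2 : 'I_n.+1 -> 'I_n.+1 -> V -> R) :
  iopen A -> (forall p q, cont A (K p q)) -> (forall p q, cont A (K2 p q)) ->
  weak_curl A w K -> weak_curl A w K2 -> forall p q x, A x -> K p q x = K2 p q x.
Proof.
move=> iA cK cK2 H1 H2 p q x Ax.
apply/eqP; rewrite -subr_eq0 -normr_le0; apply/ler_addgt0Pl => e e0; rewrite addr0.
pose k y := K p q y - K2 p q y.
have ck : cont A k by exact: contB.
have [d d0 Hd] := cont_dist iA.1 ck Ax e0.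
have [r r0 Hr] : exists2 r : R, 0 < r & forall b, `|b| < r -> A (x + b *: e_ q) /\
    `|k (x + b *: e_ q) - k x| < e.
  have C : x + b *: e_ q @[b --> 0] --> x + (0 : R) *: e_ q.
    by apply: cvgD; [exact: cvg_cst|apply: cvgZr_tmp; exact: cvg_id].
  rewrite scale0r addr0 in C.
  have /nbhs_ballP[r1 /= r10 Hr1] := C _ (iopen_nbhs iA Ax).
  exists (Num.min r1 d); first by rewrite lt_min r10.
  move=> b; rewrite lt_min => /andP[b1 bd].
  have Ab : A (x + b *: e_ q) by apply: Hr1; rewrite -ball_normE/= sub0r normrN.
  apply: Hd; first exact: iA.1.1.
  rewrite addrAC subrr add0r normrZ (le_lt_trans _ bd)// ler_piMr//; exact: norm_e.
pose v := r / 2.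
have v0 : 0 < v by rewrite divr_gt0.
have rb b : 0 <= b <= v -> `|b| < r.
  move=> /andP[b0 bv]; rewrite ger0_norm// (le_lt_trans bv)// /v.
  by rewrite ltr_pdivrMr// ltr_pMr// ltr1n.
have sA b : 0 <= b <= v -> A (x + b *: e_ q) by move=> /rb/Hr[].
have E := dnbhs0_unique (H1 p q x 0 v (ltW v0) sA) (H2 p q x 0 v (ltW v0) sA).
have ci (g : V -> R) : cont A g -> cont `[0, v] (fun b => g (x + b *: e_ q)).
  by move=> cg; exact: cont_seg cg sA.
have I0 : \int[mu]_(b in `[0, v]) k (x + b *: e_ q) = 0.
  rewrite intervalB; [|exact: ci (cK p q)|exact: ci (cK2 p q)].
  move: E; set a1 := \int[mu]_(b in _) _; set a2 := \int[mu]_(b in _) _ => E.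
  by move: E; clear; lra.
have I1 : \int[mu]_(b in `[0, v]) (k (x + b *: e_ q) - k x) = - (k x * v).
  rewrite intervalB; [|exact: ci|exact: cont_cst].
  rewrite I0 sub0r Rintegral_cst//= lebesgue_measure_itv/= lte_fin v0.
  by rewrite /= oppr0 addr0.
have : `|k x * v| <= e * (v - 0).
  rewrite -normrN -I1; apply: interval_norm_le; first exact: ltW.
    by apply: contB; [exact: ci|exact: cont_cst].
  by move=> b /rb/Hr[_ /ltW].
by rewrite subr0 normrM (gtr0_norm v0) ler_pM2r.
Qed.

(** At every [a] the weak exterior derivative is the derivative of the integral of [w q] over the
    segment at [a]. Integrating in [a] turns the endpoint terms into the integrals of [w p] over the
    other two sides: Stokes on a rectangle. *)
Lemma weak_curl_rect A (w : 'I_n.+1 -> V -> R) (K : 'I_n.+1 -> 'I_n.+1 -> V -> R) :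
  iopen A -> (forall q, cont A (w q)) -> (forall p q, cont A (K p q)) ->
  weak_curl A w K ->
  forall p q (x : V) (s t : R),
    let pt a b := x + a *: e_ p + b *: e_ q in
    0 <= s -> 0 <= t ->
    (forall a b, 0 <= a <= s -> 0 <= b <= t -> A (pt a b)) ->
    \int[mu]_(b in `[0, t]) (w q (pt s b) - w q (pt 0 b))
    - \int[mu]_(a in `[0, s]) (w p (pt a t) - w p (pt a 0))
    = \int[mu]_(a in `[0, s]) \int[mu]_(b in `[0, t]) K p q (pt a b).
Proof.
move=> iA cw cK HK p q x s t pt s0 t0 sA.
pose F a := \int[mu]_(b in `[0, t]) w q (pt a b).
pose I a := \int[mu]_(b in `[0, t]) K p q (pt a b).
pose F' a := I a + w p (pt a t) - w p (pt a 0).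
have cI : cont `[0, s] I.
  move=> a as_; have {}as_ : 0 <= a <= s by move: as_; rewrite /= in_itv.
  apply: interval_cvg => //.
  - by apply: cont_seg (cK p q) _ => b; exact: sA.
  - rewrite near_withinE; apply: filterE => c; rewrite /= in_itv/= => cs.
    by apply: cont_seg (cK p q) _ => b; exact: sA.
  - move=> b bt; apply: cvg_comp (iopen_cvg iA (cK p q) (sA a b as_ bt)).
    apply: pt_cvg.
      by apply: cvg_trans (@cvg_fst R R _ _ _) _; exact: cvg_within.
    by apply: cvg_trans (@cvg_snd R R _ _ _) _; exact: cvg_within.
have cpt (g : V -> R) b : cont A g -> 0 <= b <= t -> cont `[0, s] (fun a => g (pt a b)).
  move=> cg bt.
  have -> : (fun a => g (pt a b)) = (fun a => g (x + b *: e_ q + a *: e_ p)).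
    by apply/funext => a; rewrite /pt addrAC.
  by apply: cont_seg cg _ => a as_; have := sA a b as_ bt; rewrite /pt addrAC.
have tt : 0 <= t <= t by rewrite t0 lexx.
have t00 : (0 : R) <= 0 <= t by rewrite lexx t0.
have cF' : cont `[0, s] F'.
  by apply: contB; [apply: contD => //|]; apply: cpt (cw p) _.
have dF a : 0 <= a <= s -> is_derive a (1 : R) F (F' a).
  move=> as_; have := HK p q (x + a *: e_ p) 0 t t0 (fun b => sA a b as_) => HKa.
  have dq : (fun h => h^-1 *: (F (h *: (1 : R) + a) - F a)) @ 0^' --> F' a.
    apply: cvg_trans HKa; apply: near_eq_cvg; apply: filterE => h.
    rewrite /F /pt (_ : h *: (1 : R) = h); last by rewrite /GRing.scale/= mulr1.
    congr (_ * (_ - _)).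
    by apply: eq_interval => b _; rewrite (addrC h) scalerDl addrA.
  split; first by apply/cvg_ex; exists (F' a).
  by rewrite /derive; apply/cvg_lim.
have := interval_FTC s0 cF' dF.
rewrite intervalB; [|by apply: contD => //; exact: cpt (cw p) _|exact: cpt (cw p) _].
rewrite intervalD//; last exact: cpt (cw p) _.
rewrite intervalB; [|by apply: cont_seg (cw q) _ => b; apply: sA; rewrite s0 lexx
  |by apply: cont_seg (cw q) _ => b; apply: sA; rewrite s0 lexx].
rewrite intervalB; [|exact: cpt (cw p) _|exact: cpt (cw p) _].
rewrite -/(F s) -/(F 0) => <-; rewrite /I; ring.
Qed.

End WeakCurl.

(** * Functions of class C^1 up to the boundary, and 1-forms that are sums of terms a df *)

Section Canonical.
Context {R : realType} {n : nat}.
Notation V := ('rV[R]_n.+1).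
Notation H := (@half_space R n).
Notation e_ i := (delta_mx 0 i : V).
Implicit Types (A : set V) (p q : 'I_n.+1).

(* Derivatives are taken relative to the half-space, not to A: on relatively open A
   this agrees with pd A and does not depend on A. *)
Definition dd : 'I_n.+1 -> (V -> R) -> V -> R := locked (fun p f => pd H p f).

Lemma ddE p f : dd p f = pd H p f. Proof. by rewrite /dd -lock. Qed.

Definition C1 A (f : V -> R) : Prop := C1on A f (fun p => dd p f).

Lemma C1on_dd A f f' p x : hopen A -> C1on A f f' -> A x -> dd p f x = f' p x.
Proof. by move=> hA cf Ax; rewrite ddE -(pd_hopen p f hA Ax) (C1on_pd p hA cf). Qed.

Lemma C1onW A f f' : hopen A -> C1on A f f' -> C1 A f.
Proof.
move=> hA cf; apply: (C1on_eq hA _ _ cf) => // p x Ax.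
by rewrite (C1on_dd p hA cf).
Qed.

Lemma C1_cont A f : C1 A f -> cont A f. Proof. by case. Qed.

Lemma C1_dd_cont A f p : C1 A f -> cont A (dd p f).
Proof. by move=> [_ /(_ p)[]]. Qed.

Lemma C1_sub A B f : A `<=` B -> C1 B f -> C1 A f.
Proof. exact: C1on_sub. Qed.

Lemma C1_cst A (c : R) : hopen A -> C1 A (fun=> c).
Proof. by move=> hA; exact: C1onW hA (C1on_cst A c). Qed.

Lemma C1D A f g : hopen A -> C1 A f -> C1 A g -> C1 A (fun x => f x + g x).
Proof. by move=> hA cf cg; exact: C1onW hA (C1onD cf cg). Qed.

Lemma C1M A f g : hopen A -> C1 A f -> C1 A g -> C1 A (fun x => f x * g x).
Proof. by move=> hA cf cg; exact: C1onW hA (C1onM hA cf cg). Qed.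

Lemma C1N A f : hopen A -> C1 A f -> C1 A (fun x => - f x).
Proof.
move=> hA cf; under eq_fun do rewrite -mulN1r.
by apply: C1M => //; exact: C1_cst.
Qed.

Lemma C1B A f g : hopen A -> C1 A f -> C1 A g -> C1 A (fun x => f x - g x).
Proof. by move=> hA cf cg; apply: C1D => //; exact: C1N. Qed.

Lemma C1V A f : hopen A -> (forall x, A x -> f x != 0) -> C1 A f ->
  C1 A (fun x => (f x)^-1).
Proof. by move=> hA f0 cf; exact: C1onW hA (C1onV hA f0 cf). Qed.

Lemma C1X A f m : hopen A -> C1 A f -> C1 A (fun x => f x ^+ m).
Proof.
move=> hA cf; elim: m => [|m IH].
  by under eq_fun do rewrite expr0; exact: C1_cst.
by under eq_fun do rewrite exprS; exact: C1M.
Qed.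

Lemma C1_sum A (I : Type) (s : seq I) (F : I -> V -> R) : hopen A ->
  (forall j, C1 A (F j)) -> C1 A (fun x => \sum_(j <- s) F j x).
Proof. by move=> hA cF; exact: C1onW hA (C1on_sum s cF). Qed.

Lemma C1_coord A c : hopen A -> C1 A (fun x => x 0 c).
Proof. by move=> hA; exact: C1onW hA (C1on_coord c hA). Qed.

Lemma C1_eq A f g : hopen A -> (forall x, A x -> f x = g x) -> C1 A f -> C1 A g.
Proof. by move=> hA fg cf; apply: (C1onW hA); exact: (C1on_eq hA fg _ cf). Qed.

Lemma dd_cst A (c : R) p x : hopen A -> A x -> dd p (fun=> c) x = 0.
Proof. by move=> hA Ax; rewrite (C1on_dd p hA (C1on_cst A c)). Qed.

Lemma ddM A f g p x : hopen A -> C1 A f -> C1 A g -> A x ->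
  dd p (fun x => f x * g x) x = dd p f x * g x + f x * dd p g x.
Proof. by move=> hA cf cg Ax; rewrite (C1on_dd p hA (C1onM hA cf cg)). Qed.

Lemma ddN A f p x : hopen A -> C1 A f -> A x -> dd p (fun x => - f x) x = - dd p f x.
Proof.
move=> hA cf Ax; under eq_fun do rewrite -mulN1r.
rewrite (@ddM A) //; last exact: C1_cst.
by rewrite (@dd_cst A)// mul0r add0r mulN1r.
Qed.

Lemma ddV A f p x : hopen A -> (forall x, A x -> f x != 0) -> C1 A f -> A x ->
  dd p (fun x => (f x)^-1) x = - dd p f x / f x ^+ 2.
Proof. by move=> hA f0 cf Ax; rewrite (C1on_dd p hA (C1onV hA f0 cf)). Qed.

Lemma dd_sum A (I : Type) (s : seq I) (F : I -> V -> R) p x : hopen A ->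
  (forall j, C1 A (F j)) -> A x ->
  dd p (fun x => \sum_(j <- s) F j x) x = \sum_(j <- s) dd p (F j) x.
Proof. by move=> hA cF Ax; rewrite (C1on_dd p hA (C1on_sum s cF)). Qed.

Lemma dd_coord A c p x : hopen A -> A x -> dd p (fun x => x 0 c) x = (p == c)%:R.
Proof. by move=> hA Ax; rewrite (C1on_dd p hA (C1on_coord c hA)). Qed.

Lemma dd_eq A f g p x : hopen A -> (forall x, A x -> f x = g x) -> C1 A f -> A x ->
  dd p f x = dd p g x.
Proof.
move=> hA fg cf Ax.
by rewrite (C1on_dd p hA (C1on_eq hA fg (fun _ _ _ => erefl) cf)).
Qed.

Lemma ddX A f p x m : hopen A -> C1 A f -> A x ->
  dd p (fun x => f x ^+ m) x = m%:R * f x ^+ m.-1 * dd p f x.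
Proof.
move=> hA cf Ax; elim: m => [|m IH].
  under eq_fun do rewrite expr0.
  by rewrite (@dd_cst A)// !mul0r.
under eq_fun do rewrite exprS.
rewrite (@ddM A)//; last exact: C1X.
rewrite IH; case: m {IH} => [|m] /=; first by rewrite !expr0; ring.
by rewrite -[m.+2]addn1 natrD !exprS; ring.
Qed.

(* A 1-form that is a finite sum of products a df of C^1 functions, with its
   exterior derivative. *)
Definition scurl A (w : 'I_n.+1 -> V -> R) (K : 'I_n.+1 -> 'I_n.+1 -> V -> R) : Prop :=
  exists (I : finType) (a f : I -> V -> R),
    [/\ forall j, C1 A (a j) /\ C1 A (f j),
        forall q x, A x -> w q x = \sum_j a j x * dd q (f j) x &
        forall p q x, A x -> K p q x =
          \sum_j (dd p (a j) x * dd q (f j) x - dd q (a j) x * dd p (f j) x)].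

Lemma scurl_eq A w w2 K K2 : (forall q x, A x -> w q x = w2 q x) ->
  (forall p q x, A x -> K p q x = K2 p q x) -> scurl A w K -> scurl A w2 K2.
Proof.
move=> ww KK [I [a [f [c1 Hw HK]]]]; exists I, a, f; split => //.
  by move=> q x Ax; rewrite -ww// Hw.
by move=> p q x Ax; rewrite -KK// HK.
Qed.

Lemma scurl_sub A B w K : A `<=` B -> scurl B w K -> scurl A w K.
Proof.
move=> AB [I [a [f [c1 Hw HK]]]]; exists I, a, f; split.
- by move=> j; have [] := c1 j; split; exact: C1_sub AB _.
- by move=> q x /AB; exact: Hw.
- by move=> p q x /AB; exact: HK.
Qed.

Lemma scurl_wdf A a f : C1 A a -> C1 A f ->
  scurl A (fun q x => a x * dd q f x)
    (fun p q x => dd p a x * dd q f x - dd q a x * dd p f x).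
Proof.
move=> ca cf; exists unit, (fun=> a), (fun=> f); split => //.
- by move=> q x Ax; rewrite big_const card_unit /= addr0.
- by move=> p q x Ax; rewrite big_const card_unit /= addr0.
Qed.

Lemma scurlD A w w2 K K2 : scurl A w K -> scurl A w2 K2 ->
  scurl A (fun q x => w q x + w2 q x) (fun p q x => K p q x + K2 p q x).
Proof.
move=> [I [a [f [c1 Hw HK]]]] [I2 [a2 [f2 [c12 Hw2 HK2]]]].
exists (I + I2)%type, (fun j => match j with inl j => a j | inr j => a2 j end),
  (fun j => match j with inl j => f j | inr j => f2 j end).
split.
- by case.
- by move=> q x Ax; rewrite Hw// Hw2// big_sumType.
- by move=> p q x Ax; rewrite HK// HK2// big_sumType.
Qed.

Lemma scurl_fin A (I : finType) w K : (forall i : I, scurl A (w i) (K i)) ->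
  scurl A (fun q x => \sum_i w i q x) (fun p q x => \sum_i K i p q x).
Proof.
move=> H1.
suff : forall s : seq I, scurl A (fun q x => \sum_(i <- s) w i q x)
    (fun p q x => \sum_(i <- s) K i p q x) by exact.
elim=> [|i s IH].
  exists void, (fun _ _ => 0), (fun _ _ => 0); split; first by case.
  - move=> q x Ax; rewrite big_nil big1//; by case.
  - move=> p q x Ax; rewrite big_nil big1//; by case.
by apply: scurl_eq (scurlD (H1 i) IH) => *; rewrite big_cons.
Qed.

(** The product rule d(l w) = l dw + dl wedge w; in the sum of terms a df, [l] is absorbed into the
    coefficients. *)
Lemma scurlZ A l w K : hopen A -> C1 A l -> scurl A w K ->
  scurl A (fun q x => l x * w q x)
    (fun p q x => l x * K p q x + (dd p l x * w q x - dd q l x * w p x)).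
Proof.
move=> hA cl [I [a [f [c1 Hw HK]]]].
exists I, (fun j x => l x * a j x), f; split.
- by move=> j; have [ca cf] := c1 j; split => //; exact: C1M.
- by move=> q x Ax; rewrite Hw// mulr_sumr; apply: eq_bigr => j _; rewrite mulrA.
- move=> p q x Ax; rewrite HK// !Hw// !mulr_sumr -sumrB -big_split/=.
  apply: eq_bigr => j _; have [ca cf] := c1 j.
  by rewrite !(@ddM A)//; ring.
Qed.

(** Written as the sum of [u j] times the differential of coordinate [j], a form with C^1
    coefficients gets its classical exterior derivative. *)
Lemma scurl_form A u : hopen A -> (forall q, C1 A (u q)) ->
  scurl A u (fun p q x => dd p (u q) x - dd q (u p) x).
Proof.
move=> hA cu; exists 'I_n.+1, u, (fun j x => x 0 j); split.
- by move=> j; split => //; exact: C1_coord.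
- move=> q x Ax; rewrite (bigD1 q)//= (@dd_coord A)// eqxx mulr1 big1 ?addr0//.
  by move=> i iq; rewrite (@dd_coord A)// eq_sym (negPf iq) mulr0.
- move=> p q x Ax; rewrite sumrB; congr (_ - _).
    rewrite (bigD1 q)//= (@dd_coord A)// eqxx mulr1 big1 ?addr0//.
    by move=> i iq; rewrite (@dd_coord A)// eq_sym (negPf iq) mulr0.
  rewrite (bigD1 p)//= (@dd_coord A)// eqxx mulr1 big1 ?addr0//.
  by move=> i iq; rewrite (@dd_coord A)// eq_sym (negPf iq) mulr0.
Qed.

Lemma scurl_cont A w K : scurl A w K ->
  (forall q, cont A (w q)) /\ (forall p q, cont A (K p q)).
Proof.
move=> [I [a [f [c1 Hw HK]]]]; split.
  move=> q; apply: (@cont_eq _ _ _ (fun x => \sum_j a j x * dd q (f j) x)).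
    by move=> x /Hw.
  by apply: cont_sum => j; have [ca cf] := c1 j;
    apply: contM; [exact: C1_cont|exact: C1_dd_cont].
move=> p q; apply: (@cont_eq _ _ _ (fun x =>
    \sum_j (dd p (a j) x * dd q (f j) x - dd q (a j) x * dd p (f j) x))).
  by move=> x /HK.
by apply: cont_sum => j; have [ca cf] := c1 j;
  apply: contB; apply: contM; exact: C1_dd_cont.
Qed.

Lemma scurl_antisym A w K p q x : scurl A w K -> A x -> K p q x = - K q p x.
Proof.
move=> [I [a [f [c1 Hw HK]]]] Ax; rewrite !HK// -sumrN.
by apply: eq_bigr => j _; rewrite opprB.
Qed.

Lemma scurl_weak A w K : iopen A -> scurl A w K -> weak_curl A w K.
Proof.
move=> iA [I [a [f [c1 Hw HK]]]].
apply: (@weak_curl_eq _ _ A (fun q x => \sum_j a j x * dd q (f j) x) _ (fun p q x =>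
    \sum_j (dd p (a j) x * dd q (f j) x - dd q (a j) x * dd p (f j) x))) => //.
- by move=> q x /Hw.
- by move=> p q x /HK.
have cw j q : cont A (fun x => a j x * dd q (f j) x).
  by have [ca cf] := c1 j; apply: contM; [exact: C1_cont|exact: C1_dd_cont].
have cK j p q : cont A (fun x => dd p (a j) x * dd q (f j) x - dd q (a j) x * dd p (f j) x).
  by have [ca cf] := c1 j; apply: contB; apply: contM; exact: C1_dd_cont.
elim: (index_enum I) => [|j s IH].
  (* The empty sum is treated as the term 0 d0. *)
  have := weak_curl_wdf iA (C1_cst 0 iA.1) (C1_cst 0 iA.1).
  apply: weak_curl_eq => //.
    by move=> q x Ax; rewrite big_nil mul0r.
  by move=> p q x Ax; rewrite big_nil !(@dd_cst A) ?mul0r ?subrr//; case: iA.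
have [ca cf] := c1 j.
have := weak_curlD iA (cw j) _ (cK j) _ (weak_curl_wdf iA ca cf) IH.
move=> /(_ _ _)Wa.
apply: (weak_curl_eq iA _ _ (Wa _ _)) => [q x Ax|p q x Ax|q|p q].
- by rewrite big_cons.
- by rewrite big_cons.
- by apply: cont_sum => i; exact: cw.
- by apply: cont_sum => i; exact: cK.
Qed.

(** [K] is read off a chosen sum of terms a df; passing to the weak exterior derivative shows that
    it depends on the form [w] alone. *)
Lemma scurl_unique A w K K2 p q x : iopen A -> scurl A w K -> scurl A w K2 -> A x ->
  K p q x = K2 p q x.
Proof.
move=> iA H1 H2 Ax.
apply: (weak_curl_unique iA _ _ (scurl_weak iA H1) (scurl_weak iA H2)) => // p' q'.
  by case: (scurl_cont H1).
by case: (scurl_cont H2).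
Qed.

(** The form df has two representations: the single term 1 df, whose exterior derivative vanishes,
    and the sum of [dd j f] times coordinate differentials, whose exterior derivative is the
    commutator of second derivatives. Uniqueness equates them in the interior, and density extends
    this to the boundary. *)
Lemma schwarz A f p q x : hopen A -> C1 A f -> (forall i, C1 A (dd i f)) -> A x ->
  dd p (dd q f) x = dd q (dd p f) x.
Proof.
move=> hA cf cdf.
have iA : iopen (A `&` [set x | 0 < x 0 0]).
  by split; [exact: hopen_interior|move=> y []].
apply: (cont_eq_interior hA); [exact: C1_dd_cont|exact: C1_dd_cont|].
move=> {}x Ax x0; apply/eqP; rewrite -subr_eq0; apply/eqP.
pose A0 := A `&` [set x | 0 < x 0 0].
have A0A : A0 `<=` A by move=> y [].
have S1 := scurl_wdf (C1_cst 1 iA.1) (C1_sub A0A cf).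
have S2 := scurl_form iA.1 (fun q => C1_sub A0A (cdf q)).
have {}S1 : scurl A0 (fun q => dd q f) (fun _ _ _ => 0).
  apply: scurl_eq S1 => [i y Ay|i j y Ay]; first by rewrite mul1r.
  by rewrite !(@dd_cst A0) ?mul0r ?subrr//; case: iA.
by rewrite (scurl_unique p q iA S2 S1).
Qed.

End Canonical.

Lemma pair_sym_sum {R : realType} {n : nat} (B : 'I_n -> 'I_n -> R) (u v : 'I_n -> R) :
  (forall c d, B c d = B d c) ->
  \sum_c \sum_d B c d * u c * v d = \sum_c \sum_d B c d * v c * u d.
Proof.
move=> Bs; rewrite exchange_big; apply: eq_bigr => c _; apply: eq_bigr => d _.
by rewrite Bs; ring.
Qed.

(** * The metric induced by gbar *)

Section InducedMetric.
Context {R : realType} {m n : nat}.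
Notation V := ('rV[R]_m.+1).
Variables (A : set V) (F : 'I_n -> V -> R) (B : 'I_n -> 'I_n -> V -> R).
Hypothesis hA : hopen A.
Hypothesis cF : forall c, C1 A (F c).
Hypothesis ccF : forall c p, C1 A (dd p (F c)).
Hypothesis cB : forall c d, C1 A (B c d).
Hypothesis ccB : forall c d p, C1 A (dd p (B c d)).
Hypothesis B_sym : forall c d x, A x -> B c d x = B d c x.

Definition ind_metric k l (x : V) : R :=
  \sum_c \sum_d B c d x * dd k (F c) x * dd l (F d) x.

Lemma ind_metric_C1 k l : C1 A (ind_metric k l).
Proof.
apply: C1_sum => // c; apply: C1_sum => // d.
by apply: C1M => //; apply: C1M.
Qed.

Definition gamma1 (h : 'I_m.+1 -> 'I_m.+1 -> V -> R) a b c (x : V) : R :=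
  2^-1 * (dd a (h b c) x + dd b (h a c) x - dd c (h a b) x).

Lemma dd_ind_metric q k l x : A x -> dd q (ind_metric k l) x =
  \sum_c \sum_d dd q (B c d) x * dd k (F c) x * dd l (F d) x
  + \sum_c \sum_d B c d x * dd q (dd k (F c)) x * dd l (F d) x
  + \sum_c \sum_d B c d x * dd k (F c) x * dd q (dd l (F d)) x.
Proof.
move=> Ax; rewrite (dd_sum _ _ hA _ Ax); last first.
  move=> c; apply: C1_sum => // d.
  by apply: C1M => //; apply: C1M.
rewrite -!big_split/=; apply: eq_bigr => c _.
rewrite (dd_sum _ _ hA _ Ax); last by move=> d; apply: C1M => //; apply: C1M.
rewrite -!big_split/=; apply: eq_bigr => d _.
have cc : C1 A (fun x => B c d x * dd k (F c) x) by apply: C1M.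
rewrite (ddM q hA cc (ccF d l) Ax) (ddM q hA (cB c d) (ccF c k) Ax).
by ring.
Qed.

(** The terms in which the derivative falls on the ambient metric [B]. They contain only first
    derivatives of the immersion, hence are of class C^1. *)
Definition gamma_rest k l q (x : V) : R := 2^-1 *
  (\sum_c \sum_d dd q (B c d) x * dd k (F c) x * dd l (F d) x +
   \sum_c \sum_d dd k (B c d) x * dd q (F c) x * dd l (F d) x -
   \sum_c \sum_d dd l (B c d) x * dd q (F c) x * dd k (F d) x).

(* The only second derivatives of the immersion left in the Christoffel symbols
   are those of dd k (F c), in the direction q of the form. *)
Lemma gamma1_ind_metric q k l x : A x -> gamma1 ind_metric q k l x =
  \sum_c \sum_d B c d x * dd l (F d) x * dd q (dd k (F c)) x + gamma_rest k l q x.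
Proof.
move=> Ax; rewrite /gamma1 !dd_ind_metric// /gamma_rest.
have sw i j c : dd i (dd j (F c)) x = dd j (dd i (F c)) x by apply: (schwarz _ _ hA).
(* Four of the six sums with second derivatives cancel, by Schwarz and the symmetry of [B]; the
   other two coincide and absorb the factor [2^-1]. *)
have e1 : \sum_c \sum_d B c d x * dd k (dd q (F c)) x * dd l (F d) x =
    \sum_c \sum_d B c d x * dd q (dd k (F c)) x * dd l (F d) x.
  by apply: eq_bigr => c _; apply: eq_bigr => d _; rewrite (sw k q).
have e2 : \sum_c \sum_d B c d x * dd q (F c) x * dd k (dd l (F d)) x =
    \sum_c \sum_d B c d x * dd q (F c) x * dd l (dd k (F d)) x.
  by apply: eq_bigr => c _; apply: eq_bigr => d _; rewrite (sw k l).
have e3 : \sum_c \sum_d B c d x * dd l (dd q (F c)) x * dd k (F d) x =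
    \sum_c \sum_d B c d x * dd k (F c) x * dd q (dd l (F d)) x.
  rewrite (@pair_sym_sum _ _ (fun c d => B c d x) (fun c => dd l (dd q (F c)) x)
    (fun d => dd k (F d) x)); last by move=> c d; exact: B_sym.
  by apply: eq_bigr => c _; apply: eq_bigr => d _; rewrite (sw l q).
have e4 : \sum_c \sum_d B c d x * dd l (F d) x * dd q (dd k (F c)) x =
   \sum_c \sum_d B c d x * dd q (dd k (F c)) x * dd l (F d) x.
  by apply: eq_bigr => c _; apply: eq_bigr => d _; rewrite mulrAC.
rewrite e1 e2 e3 e4.
by do !set S := (\sum_c _); field.
Qed.

Lemma gamma_rest_C1 k l q : C1 A (gamma_rest k l q).
Proof.
have cc i j l' : C1 A (fun x => \sum_c \sum_d
    dd i (B c d) x * dd j (F c) x * dd l' (F d) x).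
  apply: C1_sum => // c; apply: C1_sum => // d.
  by apply: C1M => //; apply: C1M.
by apply: C1M; [|exact: C1_cst|apply: C1B => //; apply: C1D].
Qed.

Lemma ind_metric_scurl k l :
  exists K, scurl A (fun q => gamma1 ind_metric q k l) K.
Proof.
pose S c d := scurl_wdf (C1M hA (cB c d) (ccF d l)) (ccF c k).
have S1 := scurl_fin (fun c => scurl_fin (fun d => S c d)).
have S2 := scurl_form hA (gamma_rest_C1 k l).
eexists; apply: scurl_eq (scurlD S1 S2); last by [].
by move=> q x Ax; rewrite gamma1_ind_metric.
Qed.

End InducedMetric.

Lemma C1_comp {R : realType} {m n : nat} (A : set 'rV[R]_m.+1) (B : set 'rV[R]_n.+1)
    (F : 'rV[R]_m.+1 -> 'rV[R]_n.+1) (g : 'rV[R]_n.+1 -> R) :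
  hopen A -> hopen B -> (forall x, A x -> B (F x)) ->
  (forall c, C1 A (fun x => F x 0 c)) -> C1 B g ->
  C1 A (fun x => g (F x)) /\
  forall i x, A x -> dd i (fun x => g (F x)) x =
    \sum_c dd c g (F x) * dd i (fun x => F x 0 c) x.
Proof.
move=> hA hB AB cF cg; have C := C1on_comp hA hB AB cF cg.
split; first exact: C1onW hA C.
by move=> i x Ax; rewrite (C1on_dd i hA C).
Qed.

(** * Linear algebra of inner products and Gram determinants *)

Section Beta.
Context {R : realType} {m : nat}.
Implicit Types (M : 'M[R]_m) (u v : 'I_m -> R).

(** A bilinear form on index functions, so that a Christoffel symbol with its last index free can be
    inserted directly as a covector. *)
Definition beta M u v : R := \sum_s \sum_t M s t * u s * v t.

Lemma betaDl M u u2 v : beta M (fun s => u s + u2 s) v = beta M u v + beta M u2 v.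
Proof.
rewrite /beta -big_split; apply: eq_bigr => s _; rewrite -big_split.
by apply: eq_bigr => t _ /=; ring.
Qed.

Lemma betaZl M a u v : beta M (fun s => a * u s) v = a * beta M u v.
Proof.
rewrite /beta mulr_sumr; apply: eq_bigr => s _; rewrite mulr_sumr.
by apply: eq_bigr => t _ /=; ring.
Qed.

Lemma betaBl M u u2 v : beta M (fun s => u s - u2 s) v = beta M u v - beta M u2 v.
Proof.
rewrite -[- beta _ _ _]mulN1r -betaZl -betaDl; congr beta.
by apply/funext => s; rewrite mulN1r.
Qed.

Lemma betaDr M u v v2 : beta M u (fun s => v s + v2 s) = beta M u v + beta M u v2.
Proof.
rewrite /beta -big_split; apply: eq_bigr => s _; rewrite -big_split.
by apply: eq_bigr => t _ /=; ring.
Qed.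

Lemma betaZr M a u v : beta M u (fun s => a * v s) = a * beta M u v.
Proof.
rewrite /beta mulr_sumr; apply: eq_bigr => s _; rewrite mulr_sumr.
by apply: eq_bigr => t _ /=; ring.
Qed.

Lemma betaBr M u v v2 : beta M u (fun s => v s - v2 s) = beta M u v - beta M u v2.
Proof.
rewrite -[- beta _ _ _]mulN1r -betaZr -betaDr; congr beta.
by apply/funext => s; rewrite mulN1r.
Qed.

Lemma beta_lin M a b u u2 v v2 :
  beta M (fun s => a * u s - b * u2 s) (fun s => a * v s - b * v2 s) =
  a ^+ 2 * beta M u v - a * b * (beta M u v2 + beta M u2 v) + b ^+ 2 * beta M u2 v2.
Proof.
rewrite betaBl !betaBr !betaZl !betaZr.
by move: (beta _ _ _) (beta _ _ _) (beta _ _ _) (beta _ _ _) => *; ring.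
Qed.

Lemma beta_scale M a u v : beta (a *: M) u v = a * beta M u v.
Proof.
rewrite /beta mulr_sumr; apply: eq_bigr => s _; rewrite mulr_sumr.
by apply: eq_bigr => t _ /=; rewrite mxE; ring.
Qed.

Lemma beta_sym M u v : M^T = M -> beta M u v = beta M v u.
Proof.
move=> Ms; rewrite /beta exchange_big; apply: eq_bigr => s _; apply: eq_bigr => t _.
by rewrite -{1}Ms mxE; ring.
Qed.

Lemma betaE M u v : beta M u v = ip M (\row_s u s) (\row_s v s).
Proof.
rewrite /ip mxE /beta exchange_big; apply: eq_bigr => t _.
rewrite !mxE mulr_suml; apply: eq_bigr => s _; rewrite !mxE; ring.
Qed.

(** Row [k] of the metric is the covector dual to the basis vector e_k, so pairing it with [v] by
    the inverse metric evaluates [v] at [k]. *)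
Lemma beta_invl (G : 'M[R]_m) k v : G^T = G -> G \in unitmx ->
  beta (invmx G) (fun s => G k s) v = v k.
Proof.
move=> Gs Gu; rewrite betaE /ip.
rewrite (_ : (\row_s G k s) = row k G); last by apply/rowP => s; rewrite !mxE.
by rewrite -row_mul mulmxV// row1 -rowE !mxE.
Qed.

Lemma invmx_sym (G : 'M[R]_m) : G^T = G -> (invmx G)^T = invmx G.
Proof. by move=> Gs; rewrite trmx_inv Gs. Qed.

Lemma beta_invr (G : 'M[R]_m) k u : G^T = G -> G \in unitmx ->
  beta (invmx G) u (fun s => G k s) = u k.
Proof. by move=> Gs Gu; rewrite beta_sym ?invmx_sym// beta_invl. Qed.

Lemma cont_beta {T : topologicalType} (A : set T) (M : T -> 'M[R]_m) (u v : 'I_m -> T -> R) :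
  contmx A M -> (forall s, cont A (u s)) -> (forall s, cont A (v s)) ->
  cont A (fun x => beta (M x) (u^~ x) (v^~ x)).
Proof.
move=> cM cu cv; apply: cont_sum => s; apply: cont_sum => t.
by apply: contM => //; apply: contM.
Qed.

End Beta.

Section InnerProduct.
Context {R : realType} {m : nat}.
Implicit Types (M : 'M[R]_m) (u v w : 'rV[R]_m).

Lemma ipZl M a u v : ip M (a *: u) v = a * ip M u v.
Proof. by rewrite /ip -!scalemxAl mxE. Qed.

Lemma ipZr M a u v : ip M u (a *: v) = a * ip M u v.
Proof. by rewrite /ip linearZ/= -scalemxAr mxE. Qed.

Lemma ipBl M u v w : ip M (u - v) w = ip M u w - ip M v w.
Proof. by rewrite /ip !mulmxBl !mxE. Qed.

Lemma ipBr M u v w : ip M u (v - w) = ip M u v - ip M u w.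
Proof. by rewrite /ip linearB/= mulmxBr !mxE. Qed.

Lemma ip_scale M a u v : ip (a *: M) u v = a * ip M u v.
Proof. by rewrite /ip -scalemxAr -scalemxAl mxE. Qed.

Lemma ip_sym M u v : M^T = M -> ip M u v = ip M v u.
Proof.
move=> Ms; rewrite /ip.
have -> : (u *m M *m v^T) 0 0 = (u *m M *m v^T)^T 0 0 by rewrite [RHS]mxE.
by rewrite !trmx_mul trmxK Ms mulmxA.
Qed.

Lemma ip_sum M u v : ip M u v = \sum_s \sum_t M s t * u 0 s * v 0 t.
Proof.
rewrite -/(beta M (u 0) (v 0)) betaE; congr ip; apply/rowP => s; rewrite mxE//.
Qed.

Lemma posdef_unit M : (forall v, v != 0 -> 0 < ip M v v) -> M \in unitmx.
Proof.
move=> pos; rewrite -row_free_unit -kermx_eq0; apply/rowV0P => v /sub_kermxP vM.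
apply/eqP; apply: contraT => /pos.
by rewrite /ip vM mul0mx mxE ltxx.
Qed.

(** The inverse form at [v] is the form itself at [v *m invmx M]. *)
Lemma ip_inv_pos M v : M^T = M -> (forall v, v != 0 -> 0 < ip M v v) -> v != 0 ->
  0 < ip (invmx M) v v.
Proof.
move=> Ms pos v0; have Mu := posdef_unit pos.
have := pos (v *m invmx M); rewrite /ip trmx_mul trmx_inv Ms !mulmxA.
rewrite mulmxKV// => -> //; apply: contra v0 => /eqP vM.
by rewrite -(mulmxKV Mu v) vM mul0mx.
Qed.

Definition gram M u v : R := ip M u u * ip M v v - ip M u v ^+ 2.

(** A Gram-Schmidt step: squared base times squared height of the parallelogram. *)
Lemma gram_proj M u v : M^T = M -> ip M u u != 0 ->
  gram M u v = ip M u u *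
    ip M (v - (ip M u v / ip M u u) *: u) (v - (ip M u v / ip M u u) *: u).
Proof.
move=> Ms u0; rewrite /gram ipBl !ipBr !ipZl !ipZr (ip_sym v u Ms).
by move: (ip M u u) u0 (ip M v v) (ip M u v) => a a0 b c; field.
Qed.

Lemma free2 u v : row_free (col_mx u v) -> u != 0 /\ forall t, v - t *: u != 0.
Proof.
move=> uv; have H (a b : R) : a *: u + b *: v = 0 -> a = 0 /\ b = 0.
  move=> ab.
  have : row_mx a%:M b%:M *m col_mx u v = 0.
    by rewrite mul_row_col !mul_scalar_mx.
  move/eqP; rewrite mulmx_free_eq0// => /eqP/rowP E.
  have Ea := E (lshift 1 0); have Eb := E (rshift 1 0).
  by move: Ea Eb; rewrite row_mxEl row_mxEr !mxE eqxx !mulr1n.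
split=> [|t]; apply/eqP => E.
  have [] := H 1 0; first by rewrite scale1r scale0r addr0.
  by move/eqP; rewrite oner_eq0.
have [|_] := H (- t) 1; first by rewrite scale1r addrC scaleNr.
by move/eqP; rewrite oner_eq0.
Qed.

End InnerProduct.

(** * Quadrilinear forms and estimates uniform over planes *)

Section Quadrilinear.
Context {R : realType} {m : nat}.
Implicit Types (E : 'I_m -> 'I_m -> 'I_m -> 'I_m -> R) (u v a b : 'rV[R]_m).

(** The numerator of a sectional curvature, with the two middle slots kept apart so that [v] can be
    modified in one of them at a time. *)
Definition quad E u a b : R := \sum_p \sum_q \sum_k \sum_l
  E p q k l * u 0 p * a 0 q * b 0 k * u 0 l.

Lemma quad_eq E E2 u a b : (forall p q k l, E p q k l = E2 p q k l) ->
  quad E u a b = quad E2 u a b.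
Proof.
by move=> EE; do 4 (apply: eq_bigr => ? _); rewrite EE.
Qed.

Lemma quadD E E2 u a b :
  quad (fun p q k l => E p q k l + E2 p q k l) u a b = quad E u a b + quad E2 u a b.
Proof.
by rewrite /quad; do 4 (rewrite -big_split; apply: eq_bigr => ? _); rewrite /=; ring.
Qed.

Lemma quadZ E c u a b :
  quad (fun p q k l => c * E p q k l) u a b = c * quad E u a b.
Proof.
by rewrite /quad; do 4 (rewrite mulr_sumr; apply: eq_bigr => ? _); ring.
Qed.

(** Antisymmetry in the first two indices kills the value with [u] in both of the first slots. *)
Lemma quadBl E u v t b : (forall p q k l, E p q k l = - E q p k l) ->
  quad E u (v - t *: u) b = quad E u v b.
Proof.
move=> anti; have Z : quad E u u b = 0.
  have : quad E u u b = - quad E u u b.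
    rewrite {1}/quad exchange_big /quad -sumrN; apply: eq_bigr => q _.
    rewrite -sumrN; apply: eq_bigr => p _; rewrite -sumrN; apply: eq_bigr => k _.
    by rewrite -sumrN; apply: eq_bigr => l _; rewrite anti; ring.
  by move=> /eqP; rewrite -subr_eq0 opprK -mulr2n mulrn_eq0 => /orP[//|/eqP].
suff -> : quad E u (v - t *: u) b = quad E u v b - t * quad E u u b by rewrite Z mulr0 subr0.
rewrite /quad; do 4 (rewrite mulr_sumr -sumrB; apply: eq_bigr => ? _).
by rewrite !mxE; ring.
Qed.

Lemma quadBr E u v t a : (forall p q k l, E p q k l = - E p q l k) ->
  quad E u a (v - t *: u) = quad E u a v.
Proof.
move=> anti; have Z : quad E u a u = 0.
  have : quad E u a u = - quad E u a u.
    transitivity (quad (fun p q k l => E p q l k) u a u).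
      rewrite /quad; apply: eq_bigr => p _; apply: eq_bigr => q _.
      rewrite exchange_big; apply: eq_bigr => k _; apply: eq_bigr => l _.
      by rewrite mulrAC.
    rewrite -mulN1r -quadZ; apply: quad_eq => p q k l.
    by rewrite mulN1r anti.
  by move=> /eqP; rewrite -subr_eq0 opprK -mulr2n mulrn_eq0 => /orP[//|/eqP].
suff -> : quad E u a (v - t *: u) = quad E u a v - t * quad E u a u by rewrite Z mulr0 subr0.
rewrite /quad; do 4 (rewrite mulr_sumr -sumrB; apply: eq_bigr => ? _).
by rewrite !mxE; ring.
Qed.

(** In the sign convention of [sectional] this is the curvature tensor of constant curvature 1, so
    its numerator equals the denominator. *)
Lemma quad_lead (G : 'M[R]_m) u v : G^T = G ->
  quad (fun p q k l => G q k * G p l - G p k * G q l) u v v = gram G u v.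
Proof.
move=> Gs; rewrite /gram.
have E1 : quad (fun p q k l => G q k * G p l) u v v = ip G u u * ip G v v.
  rewrite /quad !ip_sum mulr_suml; apply: eq_bigr => p _.
  under eq_bigr do rewrite exchange_big /=.
  rewrite exchange_big mulr_suml; apply: eq_bigr => l _ /=.
  rewrite mulr_sumr; apply: eq_bigr => q _; rewrite mulr_sumr.
  by apply: eq_bigr => k _; ring.
have E2 : quad (fun p q k l => G p k * G q l) u v v = ip G u v * ip G v u.
  rewrite /quad !ip_sum mulr_suml; apply: eq_bigr => p _.
  rewrite exchange_big mulr_suml; apply: eq_bigr => k _ /=.
  rewrite mulr_sumr; apply: eq_bigr => q _; rewrite mulr_sumr.
  by apply: eq_bigr => l _; ring.
rewrite expr2 {2}(ip_sym u v Gs) -E1 -E2 -[X in _ - X]mul1r -mulNr -quadZ -quadD.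
by apply: quad_eq => p q k l; rewrite mulN1r.
Qed.

End Quadrilinear.

Lemma quad_bound {R : realType} {m : nat} (E : 'I_m.+1 -> 'I_m.+1 -> 'I_m.+1 -> 'I_m.+1 -> R)
    (u a : 'rV[R]_m.+1) (K : R) :
  (forall p q k l, `|E p q k l| <= K) ->
  `|quad E u a a| <= m.+1%:R ^+ 4 * K * (`|u| ^+ 2 * `|a| ^+ 2).
Proof.
move=> EK; have K0 : 0 <= K by apply: le_trans (EK 0 0 0 0).
rewrite /quad.
have step (c : R) (F : 'I_m.+1 -> R) : (forall i, `|F i| <= c) ->
    `|\sum_i F i| <= m.+1%:R * c.
  move=> Fc; apply: (le_trans (ler_norm_sum _ _ _)).
  apply: (@le_trans _ _ (\sum_(i < m.+1) c)); first by apply: ler_sum => i _.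
  by rewrite sumr_const card_ord mulr_natl.
have -> : m.+1%:R ^+ 4 * K * (`|u| ^+ 2 * `|a| ^+ 2) = m.+1%:R * (m.+1%:R * (m.+1%:R *
  (m.+1%:R * (K * `|u| * `|a| * `|a| * `|u|)))) by ring.
do 4 (apply: (step) => ?).
by rewrite !normrM; do 4 (apply: ler_pM; rewrite ?mulr_ge0//; last exact: entry_norm).
Qed.

(** Numerator and Gram determinant both see only the component [v'] of [v] orthogonal to [u]. After
    this replacement the numerator is at most, and by coercivity the denominator at least, a
    constant times |u|^2 |v'|^2, so the bound does not depend on the angle between [u] and [v]. The
    factor [m.+1%:R ^+ 4] counts index quadruples. *)
Lemma curvature_bound {R : realType} {m : nat} (G : 'M[R]_m.+1)
    (E : 'I_m.+1 -> 'I_m.+1 -> 'I_m.+1 -> 'I_m.+1 -> R) (u v : 'rV[R]_m.+1) (c K : R) :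
  G^T = G -> 0 < c -> (forall w : 'rV[R]_m.+1, c * `|w| ^+ 2 <= ip G w w) ->
  (forall p q k l, E p q k l = - E q p k l) ->
  (forall p q k l, E p q k l = - E p q l k) ->
  (forall p q k l, `|E p q k l| <= K) -> row_free (col_mx u v) ->
  0 < gram G u v /\ `|quad E u v v / gram G u v| <= m.+1%:R ^+ 4 * K / c ^+ 2.
Proof.
move=> Gs c0 Gc a1 a2 EK uv; have [u0 vu] := free2 uv.
have K0 : 0 <= K by apply: le_trans (EK 0 0 0 0).
have ip0 w : w != 0 -> 0 < ip G w w.
  by move=> w0; apply: lt_le_trans (Gc w); rewrite mulr_gt0// exprn_gt0// normr_gt0.
have iu0 : ip G u u != 0 by rewrite gt_eqF// ip0.
pose t := ip G u v / ip G u u; pose v' := v - t *: u.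
have gE : gram G u v = ip G u u * ip G v' v' by rewrite gram_proj.
have g0 : 0 < gram G u v by rewrite gE mulr_gt0// ip0//; exact: vu.
split => //.
rewrite -(quadBl u v t v a1) -(quadBr u v t _ a2) -/v'.
rewrite normrM normfV (gtr0_norm g0) ler_pdivrMr// (le_trans (quad_bound _ _ EK))//.
rewrite -mulrA; apply: (@le_trans _ _ (m.+1%:R ^+ 4 * K * (c ^+ 2)^-1 *
   ((c * `|u| ^+ 2) * (c * `|v'| ^+ 2)))).
  by rewrite le_eqVlt; apply/orP; left; apply/eqP; field; rewrite gt_eqF.
rewrite gE; apply: ler_wpM2l.
  by rewrite !mulr_ge0 ?exprn_ge0// invr_ge0 exprn_ge0// ltW.
by apply: ler_pM; rewrite ?mulr_ge0 ?exprn_ge0// ltW.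
Qed.

(** [c] is the minimum of the form on the unit sphere of the max norm, which is compact; homogeneity
    does the rest. *)
Lemma posdef_coercive {R : realType} {m : nat} (G : 'M[R]_m.+1) :
  (forall v : 'rV[R]_m.+1, v != 0 -> 0 < ip G v v) ->
  exists2 c : R, 0 < c & forall v : 'rV[R]_m.+1, c * `|v| ^+ 2 <= ip G v v.
Proof.
move=> pos.
pose S : set 'rV[R]_m.+1 := [set v | `|v| = 1].
have cS : compact S.
  apply: bounded_closed_compact.
    by exists 1; split => // M M1 v /= ->; exact: ltW.
  have := @closed_comp _ _ (fun v : 'rV[R]_m.+1 => `|v|) [set 1] _ (@closed_eq _ 1).
  by apply => v _; exact: norm_continuous.
have S0 : S !=set0.
  exists (const_mx 1).
  apply/eqP; rewrite /= eq_le; apply/andP; split.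
    by apply: norm_entries => // i; rewrite mxE normr1.
  by have := entry_norm (const_mx 1 : 'rV[R]_m.+1) 0; rewrite mxE normr1.
have cip : {within S, continuous (fun v => ip G v v)}.
  apply/contP; apply: cont_ip; [exact: contmx_cst| |] => i j x _;
  by apply: cvg_within_filter; exact: coord_continuous.
have [v vS vmin] := EVT_min_rV S0 cS cip.
have v1 : S v by move: vS; rewrite inE.
exists (ip G v v).
  apply: pos; rewrite -normr_gt0; have -> : `|v| = 1 by exact: v1.
  exact: ltr01.
move=> w; have [->|w0] := eqVneq w 0.
  by rewrite normr0 expr0n mulr0 /ip mul0mx mul0mx mxE.
have wn : 0 < `|w| by rewrite normr_gt0.
pose w1 := `|w|^-1 *: w.
have w1n : `|w1| = 1 by rewrite normrZ normfV normr_id mulVf// gt_eqF.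
have -> : ip G w w = ip G w1 w1 * `|w| ^+ 2.
  by rewrite ipZl ipZr; field; rewrite gt_eqF.
apply: ler_wpM2r; first by rewrite exprn_ge0.
by apply: vmin; rewrite inE.
Qed.

Lemma coercive_near {R : realType} {m : nat} (T : topologicalType) (A : set T)
    (G : T -> 'M[R]_m.+1) x : contmx A G -> A x ->
  (forall v : 'rV[R]_m.+1, v != 0 -> 0 < ip (G x) v v) ->
  exists2 c : R, 0 < c & \forall y \near within A (nbhs x),
    forall v : 'rV[R]_m.+1, c * `|v| ^+ 2 <= ip (G y) v v.
Proof.
move=> cG Ax /posdef_coercive[c c0 Gc].
pose N : R := m.+1%:R.
have N0 : 0 < N by rewrite ltr0n.
(* Changing each of the [N ^+ 2] entries by less than [e] changes the form by at most half of its
   lower bound at [x]. *)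
pose e := c / 2 / N ^+ 2.
have e0 : 0 < e by rewrite !divr_gt0// exprn_gt0.
exists (c / 2); first by rewrite divr_gt0.
have : \forall y \near within A (nbhs x), forall s t, `|G x s t - G y s t| < e.
  apply: filter_forall => s; apply: filter_forall => t.
  by have /cvgr_dist_lt := cG s t x Ax; apply.
apply: filterS => y Hy v.
have : `|ip (G y) v v - ip (G x) v v| <= c / 2 * `|v| ^+ 2.
  rewrite !ip_sum -sumrB.
  have step (d : R) (F : 'I_m.+1 -> R) : (forall i, `|F i| <= d) -> `|\sum_i F i| <= N * d.
    move=> Fd; apply: (le_trans (ler_norm_sum _ _ _)).
    apply: (@le_trans _ _ (\sum_(i < m.+1) d)); first by apply: ler_sum => i _.
    by rewrite sumr_const card_ord mulr_natl.
  have -> : c / 2 * `|v| ^+ 2 = N * (N * (e * `|v| * `|v|)).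
    by rewrite /e; field; rewrite gt_eqF.
  apply: (step) => s; rewrite -sumrB; apply: (step) => t.
  rewrite -!mulrBl !normrM; apply: ler_pM; rewrite ?mulr_ge0 //; last exact: entry_norm.
  apply: ler_pM => //; last exact: entry_norm.
  by rewrite distrC ltW.
rewrite ler_distl => /andP[H1 _].
by apply: le_trans H1; have := Gc v; lra.
Qed.

Lemma cont_bounded {R : realType} (T : topologicalType) (A : set T) (f : T -> R) x :
  cont A f -> A x -> \forall y \near within A (nbhs x), `|f y| <= `|f x| + 1.
Proof.
move=> cf Ax; have /cvgr_norm_le := cf x Ax; apply.
by rewrite ltrDl.
Qed.

(** * Curvature of the conformally compact metric hb / rho^2 *)

Section Conformal.
Context {R : realType} {m : nat}.
Notation V := ('rV[R]_m.+1).
Variables (A U : set V) (hb : 'I_m.+1 -> 'I_m.+1 -> V -> R) (rho : V -> R).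
Variable Kb : 'I_m.+1 -> 'I_m.+1 -> 'I_m.+1 -> 'I_m.+1 -> V -> R.
Hypotheses (hA : hopen A) (iU : iopen U) (UA : U `<=` A).
Hypothesis chb : forall k l, C1 A (hb k l).
Definition hbm (x : V) : 'M[R]_m.+1 := \matrix_(k, l) hb k l x.
Hypothesis hb_sym : forall k l x, A x -> hb k l x = hb l k x.
Hypothesis hb_pos : forall x (v : V), A x -> v != 0 -> 0 < ip (hbm x) v v.
Hypothesis hbK : forall k l, scurl A (fun q => gamma1 hb q k l) (Kb k l).
Hypotheses (crho : C1 A rho) (ccrho : forall p, C1 A (dd p rho)).
Hypothesis rho0 : forall x, U x -> rho x != 0.

Notation P p x := (dd p rho x).
Notation Gb := (gamma1 hb).

Definition conf k l (x : V) : R := (rho x ^+ 2)^-1 * hb k l x.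

(* The first Christoffel symbols of hb / rho^2 are rho^-2 Gb - rho^-3 Tq. *)
Definition Tq q k l (x : V) : R := P q x * hb k l x + P k x * hb q l x - P l x * hb q k x.

Let hU : hopen U := iU.1.

Lemma hb_unit x : A x -> hbm x \in unitmx.
Proof. by move=> Ax; apply: posdef_unit => v; exact: hb_pos. Qed.

Lemma hbm_sym x : A x -> (hbm x)^T = hbm x.
Proof. by move=> Ax; apply/matrixP => k l; rewrite !mxE hb_sym. Qed.

Lemma rho20 x : U x -> rho x ^+ 2 != 0.
Proof. by move=> Ux; rewrite sqrf_eq0 rho0. Qed.

Lemma lam_C1 : C1 U (fun x => (rho x ^+ 2)^-1).
Proof. by apply: (C1V hU rho20); apply: (C1X _ hU); exact: C1_sub UA _. Qed.

Lemma dd_lam p x : U x -> dd p (fun x => (rho x ^+ 2)^-1) x = - 2 * P p x / rho x ^+ 3.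
Proof.
move=> Ux; have cr := C1_sub UA crho.
rewrite (ddV p hU rho20 (C1X 2 hU cr) Ux) (ddX p 2 hU cr Ux) expr1.
by move: (P p x) => D; field; rewrite rho0.
Qed.

Lemma dd_conf p k l x : U x -> dd p (conf k l) x =
  - 2 * P p x / rho x ^+ 3 * hb k l x + (rho x ^+ 2)^-1 * dd p (hb k l) x.
Proof.
move=> Ux; rewrite (ddM p hU lam_C1 (C1_sub UA (chb k l)) Ux).
by rewrite dd_lam.
Qed.

Lemma conf_C1 k l : C1 U (conf k l).
Proof. by apply: C1M hU lam_C1 _; exact: C1_sub UA (chb k l). Qed.

Lemma gamma1_conf q k l x : U x -> gamma1 conf q k l x =
  (rho x ^+ 2)^-1 * Gb q k l x - (rho x ^+ 3)^-1 * Tq q k l x.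
Proof.
move=> Ux; rewrite /gamma1 !dd_conf// /Tq.
by move: (dd q (hb _ _) x) (dd k (hb _ _) x) (dd l (hb _ _) x) (P q x) (P k x) (P l x)
  => a b c d e f; field; rewrite rho0.
Qed.

Lemma Tq_C1 q k l : C1 A (Tq q k l).
Proof. by apply: C1B => //; [apply: C1D => //|]; apply: C1M. Qed.

Lemma sigma_C1 q k l : C1 U (fun x => - (rho x ^+ 3)^-1 * Tq q k l x).
Proof.
apply: C1M => //; last exact: C1_sub UA (Tq_C1 q k l).
apply: C1N => //; apply: (C1V hU); last by apply: (C1X _ hU); exact: C1_sub UA _.
by move=> x Ux; rewrite expf_neq0// rho0.
Qed.

Lemma dd_sigma p q k l x : U x ->
  dd p (fun x => - (rho x ^+ 3)^-1 * Tq q k l x) x =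
  3 * P p x / rho x ^+ 4 * Tq q k l x - (rho x ^+ 3)^-1 * dd p (Tq q k l) x.
Proof.
move=> Ux; have cr := C1_sub UA crho.
have r30 y : U y -> rho y ^+ 3 != 0 by move=> Uy; rewrite expf_neq0// rho0.
have c3 := C1V hU r30 (C1X 3 hU cr).
rewrite (ddM p hU (C1N hU c3) (C1_sub UA (Tq_C1 q k l)) Ux).
rewrite (ddN p hU c3 Ux) (ddV p hU r30 (C1X 3 hU cr) Ux) (ddX p 3 hU cr Ux) /=.
by move: (P p x) (Tq q k l x) (dd p (Tq q k l) x) => a b c; field; rewrite rho0.
Qed.

(** The exterior derivative of rho^-2 Gb - rho^-3 Tq by the product rule; the factors 2 and 3 come
    from differentiating the powers of [rho]. Since [Tq] is of class C^1, only the term with [Kb]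
    goes beyond classical derivatives. *)
Definition Kc k l p q (x : V) : R :=
  (rho x ^+ 2)^-1 * Kb k l p q x
  - 2 / rho x ^+ 3 * (P p x * Gb q k l x - P q x * Gb p k l x)
  + 3 / rho x ^+ 4 * (P p x * Tq q k l x - P q x * Tq p k l x)
  - (rho x ^+ 3)^-1 * (dd p (Tq q k l) x - dd q (Tq p k l) x).

Lemma conf_scurl k l : scurl U (fun q => gamma1 conf q k l) (Kc k l).
Proof.
have S1 := scurlZ hU lam_C1 (scurl_sub UA (hbK k l)).
have S2 := scurl_form hU (fun q => sigma_C1 q k l).
apply: scurl_eq (scurlD S1 S2) => [q x Ux|p q x Ux].
  by rewrite gamma1_conf// mulNr.
rewrite !dd_sigma// !dd_lam// /Kc.
move: (P p x) (P q x) (Tq q k l x) (Tq p k l x) (dd p (Tq q k l) x) (dd q (Tq p k l) x)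
  (Gb q k l x) (Gb p k l x) (Kb k l p q x) => *; field.
by rewrite rho0.
Qed.

Definition cip (h : 'I_m.+1 -> 'I_m.+1 -> V -> R) a b c d (x : V) : R :=
  beta (invmx (\matrix_(k, l) h k l x)) (fun s => gamma1 h a b s x)
    (fun s => gamma1 h c d s x).

Definition Rmc p q k l (x : V) : R :=
  Kc k l p q x - cip conf q k p l x + cip conf p k q l x.

Notation Bt x := (beta (invmx (hbm x))).

Definition dr2 (x : V) : R := Bt x (fun s => P s x) (fun s => P s x).

Definition err_ip a b c d (x : V) : R :=
  rho x * Bt x (fun s => Gb a b s x) (fun s => Gb c d s x)
  - (Bt x (fun s => Gb a b s x) (fun s => Tq c d s x)
     + Bt x (fun s => Tq a b s x) (fun s => Gb c d s x)).

(** What remains of [rho ^+ 4] times the curvature after the leading terms, divided by [rho]. No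
    negative power of [rho] survives, so it is continuous up to the boundary. *)
Definition err p q k l (x : V) : R :=
  rho x * Kb k l p q x - 2 * (P p x * Gb q k l x - P q x * Gb p k l x)
  - (dd p (Tq q k l) x - dd q (Tq p k l) x)
  - err_ip q k p l x + err_ip p k q l x.

Lemma cip_conf a b c d x : U x -> cip conf a b c d x =
  (rho x ^+ 4)^-1 * (Bt x (fun s => Tq a b s x) (fun s => Tq c d s x)
    + rho x * err_ip a b c d x).
Proof.
move=> Ux; rewrite /cip /err_ip.
have -> : \matrix_(k, l) conf k l x = (rho x ^+ 2)^-1 *: hbm x.
  by apply/matrixP => k l; rewrite !mxE.
rewrite invmxZ; last first.
- rewrite unitmxE detZ unitfE mulf_neq0 ?expf_neq0 ?invr_eq0 ?rho20//.
  by rewrite -unitfE -unitmxE hb_unit//; exact: UA.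
rewrite invrK beta_scale.
have E i j : (fun s => gamma1 conf i j s x) =
    (fun s => (rho x ^+ 2)^-1 * Gb i j s x - (rho x ^+ 3)^-1 * Tq i j s x).
  by apply/funext => s; rewrite gamma1_conf.
rewrite !E beta_lin.
move: (Bt x _ _) (Bt x _ _) (Bt x _ _) (Bt x _ _) => *; field.
by rewrite rho0.
Qed.

(** As a covector in its last index, [Tq] is a combination of two rows of [hb] and of d rho. Pairing
    with a row is evaluation, so the only pairing left is |d rho|^2. *)
Lemma beta_T a b c d x : A x ->
  Bt x (fun s => Tq a b s x) (fun s => Tq c d s x) =
  P a x * Tq c d b x + P b x * Tq c d a x
  - hb a b x * (P c x * P d x + P d x * P c x - dr2 x * hb c d x).
Proof.
move=> Ax.
have E i j : (fun s => Tq i j s x) = (fun s => P i x * hbm x j s + P j x * hbm x i s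
    - hb i j x * P s x).
  by apply/funext => s; rewrite /Tq !mxE [hb i j x * _]mulrC.
have hs := hbm_sym Ax; have hu := hb_unit Ax.
rewrite [in LHS](E a b) betaBl betaDl !betaZl !beta_invl//.
rewrite (E c d) betaBr betaDr !betaZr !beta_invr// -/(dr2 x).
by ring.
Qed.

(** These are the coefficients of rho^-4 in the curvature: the 3 comes from differentiating rho^-3,
    the other two terms from products of Christoffel symbols. All products of two derivatives of
    [rho] cancel except those collected in [dr2]. *)
Lemma lead_identity p q k l x : A x ->
  3 * (P p x * Tq q k l x - P q x * Tq p k l x)
  - Bt x (fun s => Tq q k s x) (fun s => Tq p l s x)
  + Bt x (fun s => Tq p k s x) (fun s => Tq q l s x) =
  - dr2 x * (hb q k x * hb p l x - hb p k x * hb q l x).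
Proof.
move=> Ax; rewrite !beta_T// /Tq.
rewrite ?(hb_sym q p Ax) ?(hb_sym k p Ax) ?(hb_sym k q Ax) ?(hb_sym l p Ax)
  ?(hb_sym l q Ax) ?(hb_sym l k Ax).
by move: (dr2 x) (P p x) (P q x) (P k x) (P l x) => *; ring.
Qed.

Lemma Rmc_expand p q k l x : U x -> rho x ^+ 4 * Rmc p q k l x =
  - dr2 x * (hb q k x * hb p l x - hb p k x * hb q l x) + rho x * err p q k l x.
Proof.
move=> Ux; rewrite -lead_identity; last exact: UA.
rewrite /Rmc !cip_conf// /err /Kc.
move: (Bt x _ _) (Bt x _ _) (err_ip _ _ _ _ x) (err_ip _ _ _ _ x) (P p x) (P q x)
 (Tq q k l x) (Tq p k l x) (dd p _ x) (dd q _ x) (Gb q k l x) (Gb p k l x)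
 (Kb k l p q x) => *; field.
by rewrite rho0.
Qed.

Lemma gamma1_cont a b c : cont A (Gb a b c).
Proof. by have [H1 _] := scurl_cont (hbK b c); exact: H1. Qed.

Lemma hbm_inv_cont : contmx A (fun x => invmx (hbm x)).
Proof.
apply: contmx_inv hb_unit _ => k l; under eq_fun do rewrite mxE.
exact: C1_cont.
Qed.

Lemma dr2_cont : cont A dr2.
Proof.
by apply: cont_beta hbm_inv_cont _ _ => s; apply: C1_dd_cont.
Qed.

Lemma err_cont p q k l : cont A (err p q k l).
Proof.
have cT a b c : cont A (Tq a b c) by exact: C1_cont (Tq_C1 a b c).
have ce a b c d : cont A (err_ip a b c d).
  apply: contB; first (apply: contM; first exact: C1_cont).
    by apply: cont_beta hbm_inv_cont _ _ => s; exact: gamma1_cont.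
  by apply: contD; apply: cont_beta hbm_inv_cont _ _ => s //; exact: gamma1_cont.
have cP i : cont A (fun x => P i x) by apply: C1_dd_cont.
apply: contD => //; apply: contB => //; apply: contB; last first.
  by apply: contB; apply: C1_dd_cont; exact: Tq_C1.
apply: contB.
  apply: contM; first exact: C1_cont.
  by have [_ H1] := scurl_cont (hbK k l); exact: H1.
apply: contM; first exact: cont_cst.
by apply: contB; apply: contM => //; exact: gamma1_cont.
Qed.

(** Gamma_{qkl} + Gamma_{qlk} = d_q h_kl is metric compatibility. The differential of a C^1 function
    has exterior derivative 0, and uniqueness makes the two curls add up to 0 although second
    derivatives of the metric need not exist. *)
Lemma Kc_antisym k l p q x : U x -> Kc k l p q x = - Kc l k p q x.
Proof.
move=> Ux; apply/eqP; rewrite -addr_eq0; apply/eqP.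
have S1 := scurlD (conf_scurl k l) (conf_scurl l k).
have S2 : scurl U (fun q x => gamma1 conf q k l x + gamma1 conf q l k x)
    (fun _ _ _ => 0).
  apply: scurl_eq (scurl_wdf (C1_cst 1 hU) (conf_C1 k l)) => [i y Uy|i j y Uy].
    rewrite mul1r /gamma1 [dd i (conf l k) y](dd_eq i hU _ (conf_C1 l k) Uy (g := conf k l)).
      by move: (dd i _ y) (dd k _ y) (dd l _ y) => *; field.
    by move=> z Uz; rewrite /conf hb_sym//; exact: UA.
  by rewrite !(@dd_cst _ _ U)// !mul0r subrr.
exact: (scurl_unique p q iU S1 S2 Ux).
Qed.

Lemma cip_sym a b c d x : U x -> cip conf a b c d x = cip conf c d a b x.
Proof.
move=> Ux; apply: beta_sym; apply: invmx_sym; apply/matrixP => k l.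
by rewrite !mxE /conf hb_sym//; exact: UA.
Qed.

Lemma Rmc_antisym_kl p q k l x : U x -> Rmc p q k l x = - Rmc p q l k x.
Proof.
move=> Ux; rewrite /Rmc (Kc_antisym k l)// (cip_sym q k)// (cip_sym p k)//.
by ring.
Qed.

Lemma Rmc_antisym_pq p q k l x : U x -> Rmc p q k l x = - Rmc q p k l x.
Proof.
by move=> Ux; rewrite /Rmc (scurl_antisym p q (conf_scurl k l) Ux); ring.
Qed.

(** Curvature and leading term both have these antisymmetries, hence so has [rho * err]; the
    division by [rho] confines the argument to [U], where the limit of the sectional curvatures is
    taken. *)
Lemma err_antisym p q k l x : U x ->
  err p q k l x = - err q p k l x /\ err p q k l x = - err p q l k x.
Proof.
move=> Ux; have r0 := rho0 Ux.
have E1 := Rmc_expand p q k l Ux.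
have E2 := Rmc_expand q p k l Ux.
have E3 := Rmc_expand p q l k Ux.
rewrite Rmc_antisym_pq// in E1.
split; apply: (mulfI r0).
  have : rho x * err p q k l x + rho x * err q p k l x = 0.
    by rewrite -(addKr (- dr2 x * (hb q k x * hb p l x - hb p k x * hb q l x)) (rho x * err p q k l x)) -E1
     -(addKr (- dr2 x * (hb p k x * hb q l x - hb q k x * hb p l x)) (rho x * err q p k l x)) -E2; ring.
  by move=> /eqP; rewrite addr_eq0 mulrN => /eqP.
rewrite -Rmc_antisym_pq// Rmc_antisym_kl// in E1.
have : rho x * err p q k l x + rho x * err p q l k x = 0.
  by rewrite -(addKr (- dr2 x * (hb q k x * hb p l x - hb p k x * hb q l x)) (rho x * err p q k l x)) -E1
     -(addKr (- dr2 x * (hb q l x * hb p k x - hb p l x * hb q k x)) (rho x * err p q l k x)) -E3; ring.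
by move=> /eqP; rewrite addr_eq0 mulrN => /eqP.
Qed.

Notation cmat x := (\matrix_(k, l) conf k l x).

Lemma conf_sectional u v x : U x -> row_free (col_mx u v) ->
  sectional (fun x => cmat x) (Rmc) u v x = - dr2 x +
  rho x * (quad (fun p q k l => err p q k l x) u v v / gram (hbm x) u v).
Proof.
move=> Ux uv; have Ax := UA Ux; have r0 := rho0 Ux.
have Gs := hbm_sym Ax.
have [u0 vu] := free2 uv.
have g0 : gram (hbm x) u v != 0.
  have iu0 : ip (hbm x) u u != 0 by rewrite gt_eqF// hb_pos.
  rewrite gram_proj// mulf_neq0// gt_eqF// hb_pos//; exact: vu.
have cE : cmat x = (rho x ^+ 2)^-1 *: hbm x by apply/matrixP => k l; rewrite !mxE.
rewrite /sectional -/(gram (cmat x) u v) -/(quad (fun p q k l => Rmc p q k l x) u v v).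
have -> : gram (cmat x) u v = (rho x ^+ 4)^-1 * gram (hbm x) u v.
  rewrite /gram cE !ip_scale.
  by move: (ip _ u u) (ip _ v v) (ip _ u v) => *; field.
have -> : quad (fun p q k l => Rmc p q k l x) u v v =
  (rho x ^+ 4)^-1 * (- dr2 x * gram (hbm x) u v +
     rho x * quad (fun p q k l => err p q k l x) u v v).
  rewrite -quad_lead// -!quadZ -quadD -quadZ; apply: quad_eq => p q k l.
  rewrite !mxE -Rmc_expand//.
  by rewrite mulKf// expf_neq0.
by field; rewrite r0 g0.
Qed.

Lemma conf_sectional_cvg y0 (e : R) : A y0 -> rho y0 = 0 -> 0 < e ->
  \forall x \near within U (nbhs y0), forall u v : V, row_free (col_mx u v) ->
    `|sectional (fun x => cmat x) (Rmc) u v x - - dr2 y0| < e.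
Proof.
move=> Ay ry e0.
have chm : contmx A (hbm).
  by move=> k l; under eq_fun do rewrite mxE; exact: C1_cont.
have [c c0 Hc] := coercive_near chm Ay (fun v => hb_pos Ay).
(* Near [y0] each entry of [err] is at most its absolute value there plus 1; the sum over all
   indices is a common bound. *)
pose K := \sum_p \sum_q \sum_k \sum_l (`|err p q k l y0| + 1).
have HK : \forall x \near within A (nbhs y0), forall p q k l,
    `|err p q k l x| <= K.
  apply: filter_forall => p; apply: filter_forall => q; apply: filter_forall => k.
  apply: filter_forall => l.
  have C := @err_cont p q k l.
  apply: filterS (cont_bounded C Ay) => x /le_trans; apply.
  have sg (F : 'I_m.+1 -> R) i : (forall j, 0 <= F j) -> F i <= \sum_j F j.
    by move=> F0; rewrite (bigD1 i)//= lerDl sumr_ge0.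
  rewrite /K; apply: le_trans (sg _ p _); last first.
    by move=> *; do 3 (apply: sumr_ge0 => ? _); rewrite addr_ge0.
  apply: le_trans (sg _ q _); last first.
    by move=> *; do 2 (apply: sumr_ge0 => ? _); rewrite addr_ge0.
  apply: le_trans (sg _ k _); last first.
    by move=> *; do 1 (apply: sumr_ge0 => ? _); rewrite addr_ge0.
  by apply: le_trans (sg _ l _) => // *; rewrite addr_ge0.
(* One more than the bound of [curvature_bound], hence positive and safe to divide by. *)
pose B := m.+1%:R ^+ 4 * K / c ^+ 2 + 1.
have K0 : 0 <= K by do 4 (apply: sumr_ge0 => ? _); rewrite addr_ge0.
have B0 : 0 < B.
  have c20 : 0 <= c ^+ 2 by rewrite exprn_ge0// ltW.
  by rewrite ltr_wpDl// divr_ge0// mulr_ge0// exprn_ge0.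
have Hr : \forall x \near within A (nbhs y0), `|rho x| < e / 2 / B.
  have := C1_cont crho Ay; rewrite ry => /cvgr0_norm_lt; apply.
  by rewrite !divr_gt0.
have Hd : \forall x \near within A (nbhs y0), `|dr2 y0 - dr2 x| < e / 2.
  have := dr2_cont Ay.
  by move=> /cvgr_dist_lt; apply; rewrite divr_gt0.
have toU P : (\forall x \near within A (nbhs y0), P x) ->
    \forall x \near within U (nbhs y0), P x.
  rewrite !near_withinE => HP; apply: filterS HP => x HP Ux; apply: HP.
  exact: UA.
move: Hc HK Hr Hd => /toU Hc /toU HK /toU Hr /toU Hd.
have HU : \forall x \near within U (nbhs y0), U x by exact: withinT.
near=> x => u v uv.
have Ux : U x by near: x.
have Ax := UA Ux.
have Hcx : forall w : V, c * `|w| ^+ 2 <= ip (hbm x) w w by near: x.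
have HKx : forall p q k l, `|err p q k l x| <= K by near: x.
have Hrx : `|rho x| < e / 2 / B by near: x.
have Hdx : `|dr2 y0 - dr2 x| < e / 2 by near: x.
have [_] := @curvature_bound _ _ (hbm x) (fun p q k l => err p q k l x)
   u v c K (hbm_sym Ax) c0 Hcx (fun p q k l => (err_antisym p q k l Ux).1)
   (fun p q k l => (err_antisym p q k l Ux).2) HKx uv.
rewrite conf_sectional//; set X := (_ / _) => HX.
have XB : `|X| < B by rewrite (le_lt_trans HX)// ltrDl.
have : `|rho x * X| < e / 2.
  rewrite normrM -[ltRHS](divfK (lt0r_neq0 B0)).
  by apply: ltr_pM.
rewrite (_ : _ - _ = (dr2 y0 - dr2 x) + rho x * X); last by ring.
move=> H2; rewrite (le_lt_trans (ler_normD _ _))// [e]splitr.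
exact: ltrD.
Unshelve. all: by end_near. Qed.

End Conformal.

(** * Mean curvature under the conformal change *)

(* Pointwise data: J is the Jacobian of iota, J2 its second derivatives, Gb = gbar,
   Gam the Christoffel symbols of gbar, dr the differential of r and rho its value;
   mcov is the covariant Hessian of iota for g = rho^-2 gbar and mQ that for gbar. *)
Section MeanCurvature.
Context {R : realType} {n k : nat}.
Variables (J : 'M[R]_(k.+1, n.+1)) (Gb : 'M[R]_n.+1) (rho : R) (dr : 'rV[R]_n.+1).
Variables (Gam : 'I_n.+1 -> 'I_n.+1 -> 'I_n.+1 -> R).
Variables (J2 : 'I_k.+1 -> 'I_k.+1 -> 'rV[R]_n.+1).
Hypotheses (Gs : Gb^T = Gb) (Gu : Gb \in unitmx).

Definition mhb : 'M[R]_k.+1 := J *m Gb *m J^T.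
Hypothesis hu : mhb \in unitmx.
Hypothesis r0 : rho != 0.

Definition mT b d e : R := dr 0 b * Gb d e + dr 0 d * Gb b e - dr 0 e * Gb b d.
(** The pullback of dr along iota, that is d rho. *)
Definition mP : 'rV[R]_k.+1 := dr *m J^T.
Definition mQ p q : 'rV[R]_n.+1 := \row_c (J2 p q 0 c +
  \sum_b \sum_d \sum_e invmx Gb c e * Gam b d e * J p b * J q d).
(** Right multiplication by this matrix is the [Gb]-orthogonal projection to the normal space; it is
    the same for all metrics conformal to [Gb]. *)
Definition mN : 'M[R]_n.+1 := 1%:M - Gb *m J^T *m invmx mhb *m J.
Definition mgrad : 'rV[R]_n.+1 := dr *m invmx Gb.

Definition mcov p q : 'rV[R]_n.+1 := \row_c (J2 p q 0 c +
  \sum_b \sum_d \sum_e invmx ((rho ^+ 2)^-1 *: Gb) c e *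
    ((rho ^+ 2)^-1 * Gam b d e - (rho ^+ 3)^-1 * mT b d e) * J p b * J q d).

Definition mind : 'M[R]_k.+1 := J *m ((rho ^+ 2)^-1 *: Gb) *m J^T.

Definition mnorm (w : 'rV[R]_n.+1) : 'rV[R]_n.+1 :=
  w - w *m ((rho ^+ 2)^-1 *: Gb) *m J^T *m invmx mind *m J.

Definition mmean : 'rV[R]_n.+1 := \sum_p \sum_q invmx mind p q *: mnorm (mcov p q).

(** The mean curvature vector of the immersion for gbar. *)
Definition mZ : 'rV[R]_n.+1 := \sum_p \sum_q invmx mhb p q *: (mQ p q *m mN).

Let r2u : (rho ^+ 2)^-1 \is a GRing.unit.
Proof. by rewrite unitfE invr_eq0 sqrf_eq0. Qed.

Lemma invG_scale m (M : 'M[R]_m) : M \in unitmx ->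
  invmx ((rho ^+ 2)^-1 *: M) = rho ^+ 2 *: invmx M.
Proof.
move=> Mu; rewrite invmxZ ?invrK//.
by rewrite unitmxE detZ unitrM unitrX//= -unitmxE.
Qed.

Lemma mindE : mind = (rho ^+ 2)^-1 *: mhb.
Proof. by rewrite /mind -scalemxAr -scalemxAl. Qed.

Lemma mhb_sym : mhb^T = mhb.
Proof. by rewrite /mhb !trmx_mul trmxK Gs mulmxA. Qed.

Lemma mnormE w : mnorm w = w *m mN.
Proof.
rewrite /mnorm mindE invG_scale// /mN mulmxBr mulmx1 !mulmxA; congr (_ - _).
rewrite -!scalemxAr -!scalemxAl -?scalemxAr -?scalemxAl scalerA.
by rewrite divff ?sqrf_eq0// scale1r.
Qed.

Lemma JN : J *m mN = 0.
Proof. by rewrite /mN mulmxBr mulmx1 !mulmxA mulmxV// mul1mx subrr. Qed.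

Lemma sum_inv_delta c d : \sum_e invmx Gb c e * Gb d e = (c == d)%:R.
Proof.
have := congr1 (fun M : 'M[R]_n.+1 => M c d) (mulVmx Gu).
by rewrite !mxE => <-; apply: eq_bigr => e _; rewrite -{2}Gs mxE.
Qed.

(** Raising the last index turns the metric rows in [mT] into basis vectors and dr into the gradient
    of [r]. The outcome is tangent to the submanifold up to a multiple of that gradient. *)
Lemma mT_contract c p q :
  \sum_b \sum_d \sum_e invmx Gb c e * mT b d e * J p b * J q d =
  mP 0 p * J q c + mP 0 q * J p c - mhb p q * mgrad 0 c.
Proof.
have E b d : \sum_e invmx Gb c e * mT b d e * J p b * J q d =
    (dr 0 b * J p b) * ((c == d)%:R * J q d) + (dr 0 d * J q d) * ((c == b)%:R * J p b)
    - mgrad 0 c * (J p b * Gb b d * J q d).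
  rewrite -!sum_inv_delta /mgrad mxE !mulr_suml !mulr_sumr -big_split -sumrB.
  apply: eq_bigr => e _; have -> : invmx Gb c e = invmx Gb e c.
    by rewrite -{1}(invmx_sym Gs) mxE.
  by rewrite /mT /=; ring.
under eq_bigr do under eq_bigr do rewrite E.
have S1 : \sum_b \sum_d (dr 0 b * J p b) * ((c == d)%:R * J q d) = mP 0 p * J q c.
  rewrite /mP mxE mulr_suml; apply: eq_bigr => b _; rewrite -mulr_sumr mxE.
  congr (_ * _); rewrite (bigD1 c)//= eqxx mul1r big1 ?addr0// => d dc.
  by rewrite eq_sym (negPf dc) mul0r.
have S2 : \sum_b \sum_d (dr 0 d * J q d) * ((c == b)%:R * J p b) = mP 0 q * J p c.
  rewrite exchange_big /mP mxE mulr_suml; apply: eq_bigr => d _; rewrite -mulr_sumr mxE.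
  congr (_ * _); rewrite (bigD1 c)//= eqxx mul1r big1 ?addr0// => b bc.
  by rewrite eq_sym (negPf bc) mul0r.
have S3 : \sum_b \sum_d mgrad 0 c * (J p b * Gb b d * J q d) = mhb p q * mgrad 0 c.
  rewrite [RHS]mulrC; move: (mgrad 0 c) => g.
  rewrite /mhb [(_ *m J^T) p q]mxE mulr_sumr exchange_big; apply: eq_bigr => d _ /=.
  rewrite !mxE mulr_suml mulr_sumr; apply: eq_bigr => b _.
  by [].
rewrite -S1 -S2 -S3 -big_split -sumrB; apply: eq_bigr => b _ /=.
by rewrite -big_split -sumrB.
Qed.

Lemma mcovE p q : mcov p q = mQ p q -
  rho^-1 *: (mP 0 p *: row q J + mP 0 q *: row p J - mhb p q *: mgrad).
Proof.
apply/rowP => c.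
have -> : (mQ p q - rho^-1 *: (mP 0 p *: row q J + mP 0 q *: row p J
    - mhb p q *: mgrad)) 0 c = mQ p q 0 c -
    rho^-1 * (mP 0 p * J q c + mP 0 q * J p c - mhb p q * mgrad 0 c).
  by move: (mQ p q) (mP 0 p) (mP 0 q) (mhb p q) mgrad => Q x y z w; rewrite !mxE.
rewrite -mT_contract [LHS]mxE [mQ p q 0 c]mxE -addrA; congr (_ + _).
rewrite mulr_sumr -sumrB; apply: eq_bigr => b _.
rewrite mulr_sumr -sumrB; apply: eq_bigr => d _.
rewrite mulr_sumr -sumrB; apply: eq_bigr => e _.
rewrite invG_scale// [(_ *: invmx Gb) c e]mxE.
by move: (invmx Gb c e) (Gam b d e) (mT b d e) => *; field.
Qed.

Lemma trace_hb : \sum_p \sum_q invmx mhb p q * mhb p q = k.+1%:R.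
Proof.
have := congr1 (fun M : 'M[R]_k.+1 => \tr M) (mulVmx hu).
rewrite mxtrace1 => <-; rewrite /mxtrace; apply: eq_bigr => p _; rewrite mxE.
by apply: eq_bigr => q _; rewrite -{2}mhb_sym mxE.
Qed.

(** The normal projection kills the rows of [J], so the conformal change contributes only multiples
    of the normal gradient, and tracing [mhb] with its inverse produces [k.+1]. The inverse induced
    metric brings in [rho ^+ 2], one power of which is used up by the change of connection, of order
    [rho^-1]. *)
Lemma mmeanE : mmean = rho *: (rho *: mZ + k.+1%:R *: (mgrad *m mN)).
Proof.
rewrite /mmean mindE invG_scale// -trace_hb.
rewrite /mZ scaler_suml scaler_sumr -big_split scaler_sumr; apply: eq_bigr => p _ /=.
rewrite scaler_suml scaler_sumr -big_split scaler_sumr; apply: eq_bigr => q _ /=.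
rewrite mnormE mcovE mulmxBl -scalemxAl mulmxBl mulmxDl -!scalemxAl.
rewrite -!row_mul JN !row0 !scaler0 !addr0 sub0r scalerN opprK.
rewrite [(_ *: invmx mhb) p q]mxE.
move: (invmx mhb p q : R) (mhb p q : R) (mQ p q *m mN) (mgrad *m mN) => a h Q g.
by apply/rowP => c; rewrite !mxE; field.
Qed.

Lemma mean_norm : ip ((rho ^+ 2)^-1 *: Gb) mmean mmean =
  ip Gb (rho *: mZ + k.+1%:R *: (mgrad *m mN)) (rho *: mZ + k.+1%:R *: (mgrad *m mN)).
Proof.
rewrite mmeanE ip_scale ipZl ipZr mulrA mulrA.
by rewrite (_ : _ * rho * rho = 1) ?mul1r//; field.
Qed.

(** Pythagoras: the tangential part of the gradient of [r] is the gradient of [rho] in the induced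
    metric, whose squared length is the subtracted term. *)
Lemma normal_grad : ip Gb (mgrad *m mN) (mgrad *m mN) =
  ip (invmx Gb) dr dr - ip (invmx mhb) mP mP.
Proof.
have NG : mN *m Gb *m mN^T = Gb - Gb *m J^T *m invmx mhb *m J *m Gb.
  have NT : mN^T = 1%:M - J^T *m invmx mhb *m J *m Gb.
    rewrite /mN linearB/= trmx1; congr (_ - _).
    by rewrite !trmx_mul trmxK Gs (invmx_sym mhb_sym) !mulmxA.
  rewrite NT mulmxBr mulmx1 !mulmxA (_ : mN *m Gb *m J^T = 0).
    by rewrite !mul0mx subr0 /mN mulmxBl mul1mx.
  have -> : mN *m Gb *m J^T = (J *m Gb *m mN^T)^T.
    by rewrite !trmx_mul !trmxK Gs mulmxA.
  by rewrite NT mulmxBr mulmx1 !mulmxA mulmxV// mul1mx subrr trmx0.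
rewrite /ip trmx_mul !mulmxA -(mulmxA _ mN Gb) -(mulmxA _ (mN *m Gb)) NG.
have -> : mgrad *m (Gb - Gb *m J^T *m invmx mhb *m J *m Gb) =
    dr - mP *m invmx mhb *m J *m Gb.
  by rewrite /mgrad /mP mulmxBr !mulmxA mulmxKV.
rewrite /mgrad trmx_mul (invmx_sym Gs) mulmxBl !mulmxA mulmxK// [LHS]mxE [X in _ + X = _]mxE.
by rewrite /mP trmx_mul trmxK !mulmxA.
Qed.

End MeanCurvature.

(** * Charts and defining functions *)

Section Regularity.
Context {R : realType} {n : nat}.
Notation V := ('rV[R]_n.+1).
Notation H := (@half_space R n).
Notation e_ i := (delta_mx 0 i : V).
Implicit Types (A : set V).

Definition C2 A (f : V -> R) : Prop := C1 A f /\ forall p, C1 A (dd p f).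

Lemma Ck1_C1 A f : hopen A -> Ck 1 A f -> C1 A f.
Proof. by move=> hA /(Ck1_C1on hA) cf; exact: C1onW hA cf. Qed.

Lemma C1_Ck1 A f : hopen A -> C1 A f -> Ck 1 A f.
Proof. by move=> hA cf; exact: C1on_Ck1 hA cf. Qed.

Lemma pd_dd A p f x : hopen A -> A x -> pd A p f x = dd p f x.
Proof. by move=> hA Ax; rewrite pd_hopen// ddE. Qed.

Lemma Creg_Ck (B : set V -> (V -> R) -> Prop) k A f : Creg B k.+1 A f -> Ck k A f.
Proof.
elim: k f => [|k IH] f; first by case.
move=> [cf H1]; split => // i; have [H2 H3] := H1 i; split => //.
exact: IH.
Qed.

Lemma Creg2_C2 (B : set V -> (V -> R) -> Prop) A f :
  (forall g, B A g -> C0 A g) -> hopen A -> Creg B 2 A f -> C2 A f.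
Proof.
move=> BC hA [cf H1].
have c1 : C1 A f.
  apply: Ck1_C1 => //; split => // i; have [H2 [H3 _]] := H1 i; split => //.
split => // p; have [_ [H3 H4]] := H1 p.
apply: (@C1_eq _ _ A (pd A p f)) => //; first by move=> x Ax; rewrite pd_dd.
apply: Ck1_C1 => //; split => // i; have [H5 H6] := H4 i; split => //.
exact: BC.
Qed.

Lemma Coo_C2 A f : hopen A -> Coo A f -> C2 A f.
Proof. by move=> hA cf; apply: Creg2_C2 hA (cf 2). Qed.

Lemma loc_holder_C0 (theta : R) A f : 0 < theta -> loc_holder theta A f -> C0 A f.
Proof.
move=> t0 hf; apply/contP => x Ax.
have [L [d [d0 Hd]]] := hf x Ax.
apply/cvgrPdist_lt => e e0.
(* The constant [L] may be zero or negative; [M] is a positive bound for it, and [d1] below solves M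
   d1^theta = e. *)
pose M := `|L| + 1.
have M0 : 0 < M by rewrite ltr_wpDl.
have eM : 0 < e / M by rewrite divr_gt0.
pose d1 := (e / M) `^ theta^-1.
have d10 : 0 < d1 by rewrite powR_gt0.
have Hn : \forall y \near x, `|x - y| < Num.min d d1.
  apply/nbhs_ballP; exists (Num.min d d1); first by rewrite /= lt_min d0.
  by move=> y; rewrite -ball_normE.
rewrite near_withinE; apply: filterS Hn => y + Ay.
rewrite lt_min distrC => /andP[yd yd1].
rewrite distrC (le_lt_trans (Hd y x Ay Ax yd _))//; first by rewrite subrr normr0.
apply: (@le_lt_trans _ _ (M * `|y - x| `^ theta)).
  by rewrite ler_wpM2r ?powR_ge0// /M (le_trans (ler_norm L))// lerDl.
rewrite mulrC -ltr_pdivlMr//.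
have -> : e / M = d1 `^ theta.
  by rewrite /d1 -powRrM mulVf ?gt_eqF// powRr1// ltW.
by apply: gt0_ltr_powR; rewrite // ?nnegrE// ltW.
Qed.

Lemma dd_tangential A f p x : hopen A -> C1 A f -> A x -> x 0 0 = 0 -> p != 0 ->
  (forall y, A y -> y 0 0 = 0 -> f y = 0) -> dd p f x = 0.
Proof.
move=> hA cf Ax x0 p0 f0.
rewrite ddE; apply: pd_unique; first exact: hA.1.
apply: (@pd_cvg_eq _ _ A p x (cst 0)) => //; last exact: cvg_cst.
move=> h h0 Ah; rewrite /diff_quot (f0 _ Ah) ?(f0 _ Ax)// ?subrr ?mulr0//.
by rewrite coordD x0 eq_sym (negPf p0) mulr0 addr0.
Qed.

Lemma dd_min A f p x : hopen A -> C1 A f -> A x -> 0 < x 0 0 ->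
  (forall y, A y -> f x <= f y) -> dd p f x = 0.
Proof.
move=> hA cf Ax x0 fmin.
have hI := hopen_interior hA.
have iI : iopen (A `&` [set x | 0 < x 0 0]) by split => // y [].
have [d /= d0 Hd] := dir_cvg0 p (iopen_nbhs iI (conj Ax x0)).
have sub t : t \in `]-d, d[%R -> A (x + t *: e_ p) /\ 0 < (x + t *: e_ p) 0 0.
  rewrite in_itv/= => td; apply: Hd => /=; rewrite sub0r normrN.
  by rewrite ltr_norml.
have D t : t \in `]-d, d[%R ->
    is_derive t (1 : R) (fun s : R => f (x + s *: e_ p)) (dd p f (x + t *: e_ p)).
  by move=> /sub[At t0]; apply: (C1on_is_derive cf) => //; rewrite t0 orbT.
have z : 0 \in `]-d, d[%R by rewrite in_itv/= oppr_lt0 d0.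
have D0 := D _ z; rewrite scale0r addr0 in D0.
have D1 : is_derive (0 : R) (1 : R) (fun s : R => f (x + s *: e_ p)) 0.
  apply: (@derive1_at_min R _ (- d) d 0) => //.
  - by rewrite lerNl (le_trans _ (ltW d0))// oppr_le0 ltW.
  - by move=> t /D[].
  - by move=> t /sub[At _]; rewrite scale0r addr0; exact: fmin.
have [_ <-] := D0; by have [_ ->] := D1.
Qed.

(** Density of the interior, applied to the equation |f| = f. *)
Lemma cont_ge0_interior A (f : V -> R) x : hopen A -> cont A f ->
  (forall y, A y -> 0 < y 0 0 -> 0 <= f y) -> A x -> 0 <= f x.
Proof.
move=> hA cf f0 Ax.
have E := @cont_eq_interior _ _ A (fun y => `|f y|) f hA _ cf.
rewrite -E //; first by move=> y Ay; apply: cvg_norm; exact: cf.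
by move=> y Ay y0; rewrite ger0_norm// f0.
Qed.

Lemma hopen_lt A (f : V -> R) (d : R) : hopen A -> cont A f ->
  hopen (A `&` [set x | f x < d]).
Proof.
move=> [AH Ao] cf; split; first by move=> x [/AH].
move=> x [Ax fx]; have fn : \forall y \near within A (nbhs x), f y < d.
  by have /cvgr_lt := cf x Ax; apply.
have {}fn : \forall y \near x, A y -> f y < d := fn.
apply: filterS2 (Ao x Ax) fn => y Ay fy Hy.
by split; [exact: Ay|apply: fy; exact: Ay].
Qed.

End Regularity.

Lemma C2_comp {R : realType} {m n : nat} (A : set 'rV[R]_m.+1) (B : set 'rV[R]_n.+1)
    (F : 'rV[R]_m.+1 -> 'rV[R]_n.+1) (g : 'rV[R]_n.+1 -> R) :
  hopen A -> hopen B -> (forall x, A x -> B (F x)) ->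
  (forall c, C2 A (fun x => F x 0 c)) -> C2 B g -> C2 A (fun x => g (F x)).
Proof.
move=> hA hB AB cF [cg cdg].
have [c1 E] := C1_comp hA hB AB (fun c => (cF c).1) cg.
split => // p.
apply: (@C1_eq _ _ A (fun x => \sum_c dd c g (F x) * dd p (fun x => F x 0 c) x)) => //.
  by move=> x Ax; rewrite E.
apply: C1_sum => // c; apply: C1M => //; last exact: (cF c).2.
by have [] := C1_comp hA hB AB (fun c => (cF c).1) (cdg c).
Qed.

Section Charts.
Context {R : realType} {n : nat} (X : bmanifold R n).
Notation V := ('rV[R]_n.+1).
Implicit Types (i : chart X) (x : V) (D : set X).
Notation im i := (phi i @` dom i).

Lemma im_psi i x : im i x -> dom i (psi i x) /\ phi i (psi i x) = x.
Proof. by move=> [p ip <-]; rewrite phiK. Qed.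

Lemma cdomP D i x : cdom D i x <-> im i x /\ D (psi i x).
Proof.
split; first by move=> [p [ip Dp] <-]; rewrite phiK//; split => //; exists p.
by move=> [/im_psi[ip px] Dp]; exists (psi i x).
Qed.

Lemma cdomT i : cdom setT i = im i.
Proof. by rewrite /cdom setIT. Qed.

Lemma psi_near i x (O : set X) : im i x -> nbhs (psi i x) O ->
  \forall y \near x, im i y -> O (psi i y).
Proof.
move=> ix Ox; have /subspace_continuousP H := @psi_continuous _ _ X i.
exact: (H x ix _ Ox).
Qed.

Lemma hopen_im i : hopen (im i).
Proof.
have [W [oW E]] := phi_image i; rewrite E; split; first by move=> x [].
by move=> x [Wx _]; apply: filterS (open_nbhs_nbhs (conj oW Wx)) => y Wy Hy.
Qed.

Lemma hopen_cdom D i : open D -> hopen (cdom D i).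
Proof.
move=> oD; have [iH io] := hopen_im i; split.
  by move=> x /cdomP[/iH].
move=> x /cdomP[ix Dx].
apply: filterS2 (io x ix) (psi_near ix (open_nbhs_nbhs (conj oD Dx))) => y iy Dy Hy.
by apply/cdomP; split; [exact: iy|apply: Dy; exact: iy].
Qed.

Lemma transition_C2 i j c : C2 (cdom (dom j) i) (fun x => phi j (psi i x) 0 c).
Proof.
apply: Coo_C2; last exact: transition_smooth.
by apply: hopen_cdom; exact: dom_open.
Qed.

Variables (r : X -> R) (rd : defining_function r).
Notation rl i := (fun x => r (psi i x)).

Lemma rloc_C2 i : C2 (im i) (rl i).
Proof. by case: rd => + _ _ _; move=> H; apply: Coo_C2; [exact: hopen_im|exact: H]. Qed.

Lemma def_fun_ge0 p : 0 <= r p.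
Proof.
case: rd => _ r1 r2 _; have [/r2 ->//|/r1/ltW//] := EM (bdry X p).
Qed.

(** [bdry] asks for some chart in which coordinate 0 vanishes; a defining function makes this
    independent of the chart. Were [x 0 0] positive, [r] would have a minimum at an interior point
    of the chart image and its differential would vanish there, against the definition of a defining
    function. *)
Lemma bdry_coord i x : im i x -> bdry X (psi i x) <-> x 0 0 = 0.
Proof.
move=> ix; split; last first.
  by move=> x0; exists i; have [ip ->] := im_psi ix.
move=> bx; have [iH io] := hopen_im i.
have := iH x ix; rewrite /half_space/= le_eqVlt => /predU1P[<-//|x0].
have [_ _ r2 r3] := rd.
have [|a] := r3 i x; first by apply/cdomP.
rewrite (pd_dd a _ (hopen_im i) ix) => /eqP[].
apply: (@dd_min _ _ (im i) (rl i) a x (hopen_im i) (rloc_C2 i).1 ix x0) => y iy.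
by rewrite (r2 _ bx) def_fun_ge0.
Qed.

Lemma cdom_bdryP i x : cdom (bdry X) i x <-> im i x /\ x 0 0 = 0.
Proof.
rewrite cdomP; split => -[ix H]; split => //; first by apply/(bdry_coord ix).
by apply/(bdry_coord ix).
Qed.

Lemma cdom_interP i x : cdom (inter X) i x <-> im i x /\ 0 < x 0 0.
Proof.
rewrite cdomP; split => -[ix H]; split => //.
  have := (hopen_im i).1 x ix; rewrite /half_space/= le_eqVlt => /predU1P[x0|//].
  by case: H; apply/(bdry_coord ix).
by move=> /(bdry_coord ix) x0; move: H; rewrite x0 ltxx.
Qed.

Lemma iopen_inter i : iopen (cdom (inter X) i).
Proof.
have -> : cdom (inter X) i = im i `&` [set x | 0 < x 0 0].
  by apply/seteqP; split => x /cdom_interP.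
split; last by move=> x [].
by apply: hopen_interior; exact: hopen_im.
Qed.

Lemma rloc_tangential i x p : cdom (bdry X) i x -> p != 0 -> dd p (rl i) x = 0.
Proof.
move=> /cdom_bdryP[ix x0] p0.
apply: (dd_tangential (hopen_im i) (rloc_C2 i).1 ix x0 p0) => y iy y0.
by case: rd => _ _ + _; apply; apply/(bdry_coord iy).
Qed.

Lemma rloc_normal i x : cdom (bdry X) i x -> dd 0 (rl i) x != 0.
Proof.
move=> bx; have [_ _ _ r3] := rd; have [a] := r3 i x bx.
have [ix _] := (cdomP _ _ _).1 bx.
rewrite (pd_dd a _ (hopen_im i) ix).
by have [->//|a0] := eqVneq a 0; rewrite rloc_tangential// eqxx.
Qed.

End Charts.

(** * From local exterior derivatives to the Riemann tensor *)

Section RiemannTensor.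
Context {R : realType} {m : nat}.
Notation V := 'rV[R]_m.+1.
Implicit Types (U A : set V) (h : 'I_m.+1 -> 'I_m.+1 -> V -> R).

Lemma gamma1_eq A h h2 a b c x : hopen A -> (forall p q y, A y -> h p q y = h2 p q y) ->
  (forall p q, C1 A (h p q)) -> A x -> gamma1 h a b c x = gamma1 h2 a b c x.
Proof.
move=> hA hh ch Ax; rewrite /gamma1; congr (_ * (_ + _ - _));
  by apply: (@dd_eq _ _ A) => // y; exact: hh.
Qed.

Lemma cip_eq A h h2 a b c d x : hopen A -> (forall p q y, A y -> h p q y = h2 p q y) ->
  (forall p q, C1 A (h p q)) -> A x -> cip h a b c d x = cip h2 a b c d x.
Proof.
move=> hA hh ch Ax; rewrite /cip.
have -> : \matrix_(k, l) h k l x = \matrix_(k, l) h2 k l x.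
  by apply/matrixP => k l; rewrite !mxE hh.
apply: eq_bigr => s _; apply: eq_bigr => t _.
by rewrite -(gamma1_eq _ _ _ hA hh ch Ax) -(gamma1_eq _ _ _ hA hh ch Ax).
Qed.

(** The sets [B] carry the representations by terms a df, but a rectangle in [U] need not fit into
    one of them. The weak exterior derivative is therefore glued over [U] first and integrated over
    rectangles afterwards. *)
Lemma riemann_tensor_scurl U (G : V -> 'M[R]_m.+1)
    (K : 'I_m.+1 -> 'I_m.+1 -> 'I_m.+1 -> 'I_m.+1 -> V -> R) (h := fun a b x => G x a b) :
  iopen U -> (forall a b, C1 U (h a b)) -> (forall x, U x -> G x \in unitmx) ->
  (forall x, U x -> exists2 B, iopen B /\ B `<=` U & B x /\
     forall k l, scurl B (fun q => gamma1 h q k l) (K k l)) ->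
  riemann_tensor U G (fun p q k l x =>
    K k l p q x - cip h q k p l x + cip h p k q l x).
Proof.
move=> iU ch uG loc; have hU := iU.1.
have mxG x : \matrix_(a, b) h a b x = G x by apply/matrixP => a b; rewrite mxE.
have cg a b c : cont U (gamma1 h a b c).
  apply: cont_local => x /loc[B [iB BU] [Bx /(_ b c)/scurl_cont[+ _]]].
  by exists B; [exact: iopen_nbhs|rewrite (setIidr BU)].
have cK k l p q : cont U (K k l p q).
  apply: cont_local => x /loc[B [iB BU] [Bx /(_ k l)/scurl_cont[_ +]]].
  by exists B; [exact: iopen_nbhs|rewrite (setIidr BU)].
have wK k l : weak_curl U (fun q => gamma1 h q k l) (K k l).
  apply: weak_curl_local => // x /loc[B [iB BU] [Bx sB]].
  exists B; first exact: iopen_nbhs.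
  by rewrite (setIidr BU); exact: (scurl_weak iB (sB k l)).
have cc a b c d : cont U (cip h a b c d).
  apply: cont_beta => [|s|s] //; apply: contmx_inv => [x Ux|k l]; first by rewrite mxG uG.
  by apply: (cont_eq _ (C1_cont (ch k l))) => x Ux; rewrite mxE.
have chrE a b c x : U x -> christoffel U G a b c x = gamma1 h a b c x.
  by move=> Ux; rewrite /christoffel /gamma1 !pd_dd.
have cipE a b c d x : U x -> christoffel_ip U G a b c d x = cip h a b c d x.
  move=> Ux; rewrite /christoffel_ip /cip mxG.
  by apply: eq_bigr => s _; apply: eq_bigr => t _; rewrite !chrE.
split => [a b|p q k l|p q k l x s t pt s0 t0 Upt].
- by apply: C1_Ck1 => //; exact: (ch a b).
- by apply/contP; apply: contD; [exact: contB|].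
have in0 (c d : R) : d \in `[0, c] -> 0 <= d <= c by rewrite in_itv.
have cc1 (c : R) : 0 <= c -> 0 <= c <= c by move=> ->; rewrite lexx.
have s00 (c : R) : 0 <= c -> 0 <= (0 : R) <= c by move=> ->; rewrite lexx.
have Ipt a b : a \in `[0, s] -> b \in `[0, t] -> U (pt a b).
  by move=> /in0 Ha /in0 Hb; exact: Upt.
transitivity (\int[lebesgue_measure]_(a in `[0, s])
   \int[lebesgue_measure]_(b in `[0, t]) K k l p q (pt a b)).
  rewrite -(weak_curl_rect iU _ _ (wK k l)) //.
  congr (_ - _); apply: eq_Rintegral => c /[!inE] /in0 Hc.
    by rewrite !chrE//; apply: Upt => //; auto.
  by rewrite !chrE//; apply: Upt => //; auto.
apply: eq_Rintegral => a /[!inE] Ha; apply: eq_Rintegral => b /[!inE] Hb.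
by rewrite !cipE; [ring|exact: Ipt|exact: Ipt].
Qed.

End RiemannTensor.

(** * The immersed submanifold *)

Section Immersed.
Context {R : realType} {n k : nat} (X : bmanifold R n) (Y : bmanifold R k).
Variables (iota : Y -> X) (g gbar : tensor_field X) (r : X -> R) (theta : R).
Hypothesis theta0 : 0 < theta.
Hypothesis rd : defining_function r.
Hypothesis gbar_metric : is_metric (Ckh 3 theta) setT gbar.
Hypothesis gbarE : forall a x, cdom (inter X) a x -> gbar a x = r (psi a x) ^+ 2 *: g a x.
Hypothesis imm : immersion_C2h iota theta.
Hypothesis iota_inter : forall p, inter Y p -> inter X (iota p).
Variables (rY : Y -> R) (rYd : defining_function rY).

Section TwoCharts.
Variables (i : chart Y) (a : chart X).
Notation A := (ldom iota i a).
Notation U := (A `&` cdom (inter Y) i).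
Notation F := (fun (c : 'I_n.+1) y => loc iota i a y 0 c).
Notation lc := (loc iota i a).
Notation G c d := (fun x => gbar a x c d).
Notation rX := (fun x => r (psi a x)).

Definition imm_rho (y : 'rV[R]_k.+1) : R := rX (lc y).
Definition imm_hb : 'I_k.+1 -> 'I_k.+1 -> 'rV[R]_k.+1 -> R :=
  ind_metric F (fun c d y => gbar a (lc y) c d).
Notation rho := imm_rho.
Notation hb := imm_hb.

Lemma ldomP y : A y <-> (phi i @` dom i) y /\ dom a (iota (psi i y)).
Proof. exact: cdomP. Qed.

Lemma hopen_ldom : hopen A.
Proof.
apply: hopen_cdom; have [ci _ _] := imm.
by have /continuousP := ci; apply; exact: dom_open.
Qed.

Lemma loc_im y : A y -> (phi a @` dom a) (lc y).
Proof. by move=> /ldomP[_ ay]; exists (iota (psi i y)). Qed.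

Lemma psi_loc y : A y -> psi a (lc y) = iota (psi i y).
Proof. by move=> /ldomP[_ ay]; exact: phiK. Qed.

Lemma loc_C2 c : C2 A (F c).
Proof.
have [_ H _] := imm; apply: Creg2_C2 hopen_ldom (H i a c) => f.
exact: loc_holder_C0.
Qed.

Lemma gbar_C2 c d : C2 (phi a @` dom a) (G c d).
Proof.
have [H _ _ _] := gbar_metric; have {}H := H a c d; rewrite cdomT in H.
have H2 : Ck 2 (phi a @` dom a) (G c d) by exact: (@Creg_Ck R n (loc_holder theta) 2 _ _ H).
by apply: (@Creg2_C2 _ _ (@C0 R n) _ _ _ (hopen_im a) H2).
Qed.

Lemma gbar_sym x : (phi a @` dom a) x -> (gbar a x)^T = gbar a x.
Proof. by have [_ H _ _] := gbar_metric; rewrite -(cdomT a) => /H. Qed.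

Lemma gbar_pos x v : (phi a @` dom a) x -> v != 0 -> 0 < ip (gbar a x) v v.
Proof. by have [_ _ H _] := gbar_metric; rewrite -(cdomT a) => /H; apply. Qed.

Lemma gbar_unit x : (phi a @` dom a) x -> gbar a x \in unitmx.
Proof. by move=> ax; apply: posdef_unit => v; exact: gbar_pos. Qed.

Lemma gbar_loc_C2 c d : C2 A (fun y => gbar a (lc y) c d).
Proof.
exact: (C2_comp hopen_ldom (hopen_im a) loc_im loc_C2 (gbar_C2 c d)).
Qed.

Lemma rho_C2 : C2 A rho.
Proof.
exact: (C2_comp hopen_ldom (hopen_im a) loc_im loc_C2 (rloc_C2 rd a)).
Qed.

Lemma dd_rho p y : A y -> dd p rho y = \sum_c dd c rX (lc y) * dd p (F c) y.
Proof.
move=> Ay.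
have [_ ->//] := C1_comp hopen_ldom (hopen_im a) loc_im (fun c => (loc_C2 c).1)
  (rloc_C2 rd a).1.
Qed.

Lemma ljacE y : A y -> ljac iota i a y = \matrix_(p, c) dd p (F c) y.
Proof.
by move=> Ay; apply/matrixP => p c; rewrite !mxE pd_dd//; exact: hopen_ldom.
Qed.

Lemma hbE y : A y -> hbm hb y = ljac iota i a y *m gbar a (lc y) *m (ljac iota i a y)^T.
Proof.
move=> Ay; rewrite ljacE//; apply/matrixP => p q; rewrite !mxE /hb /ind_metric.
rewrite exchange_big; apply: eq_bigr => d _; rewrite !mxE mulr_suml.
by apply: eq_bigr => c _; rewrite !mxE; ring.
Qed.

Lemma hb_symm p q y : A y -> hb p q y = hb q p y.
Proof.
move=> Ay; have Gs := gbar_sym (loc_im Ay).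
rewrite /hb /ind_metric (@pair_sym_sum _ _ (fun c d => gbar a (lc y) c d)
  (fun c => dd p (F c) y) (fun c => dd q (F c) y))//.
by move=> c d; rewrite -{1}Gs mxE.
Qed.

Lemma ljac_neq0 y (v : 'rV[R]_k.+1) : A y -> v != 0 -> v *m ljac iota i a y != 0.
Proof.
by move=> Ay v0; have [_ _ H] := imm; rewrite mulmx_free_eq0//; exact: H.
Qed.

Lemma hb_posdef y (v : 'rV[R]_k.+1) : A y -> v != 0 -> 0 < ip (hbm hb y) v v.
Proof.
move=> Ay v0; rewrite hbE//.
have := gbar_pos (loc_im Ay) (ljac_neq0 Ay v0).
by rewrite /ip trmx_mul !mulmxA.
Qed.

Lemma hb_C1 p q : C1 A (hb p q).
Proof.
apply: ind_metric_C1 => [|c l|c d]; first exact: hopen_ldom.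
  exact: (loc_C2 c).2.
exact: (gbar_loc_C2 c d).1.
Qed.

Lemma hb_scurl p q : exists K, scurl A (fun s => gamma1 hb s p q) K.
Proof.
apply: (ind_metric_scurl hopen_ldom).
- by move=> c; exact: (loc_C2 c).1.
- by move=> c; exact: (loc_C2 c).2.
- by move=> c d; exact: (gbar_loc_C2 c d).1.
- by move=> c d; exact: (gbar_loc_C2 c d).2.
- move=> c d y Ay; have Gs := gbar_sym (loc_im Ay).
  by rewrite -{1}Gs mxE.
Qed.

Lemma iopen_U : iopen U.
Proof.
have [hI I0] := iopen_inter rYd i.
by split; [exact: hopenI hopen_ldom hI|move=> y [_ /I0]].
Qed.

Lemma loc_inter y : U y -> cdom (inter X) a (lc y).
Proof.
move=> [Ay /cdomP[_ Iy]]; apply/cdomP; split; first exact: loc_im.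
by rewrite psi_loc//; exact: iota_inter.
Qed.

Lemma rho_pos y : U y -> 0 < rho y.
Proof.
move=> Uy; have /cdomP[_ Ix] := loc_inter Uy.
by case: rd => _ + _ _; apply.
Qed.

Lemma rho_neq0 y : U y -> rho y != 0.
Proof. by move=> /rho_pos/lt0r_neq0. Qed.

Lemma gE y : U y -> g a (lc y) = (rho y ^+ 2)^-1 *: gbar a (lc y).
Proof.
move=> Uy; rewrite gbarE//; last exact: loc_inter.
by rewrite -/(rho y) scalerA mulVf ?scale1r// sqrf_eq0 rho_neq0.
Qed.

Lemma inducedE y : U y ->
  Defs.induced iota g i a y = \matrix_(p, q) conf hb rho p q y.
Proof.
move=> Uy; rewrite /Defs.induced gE// -scalemxAr -scalemxAl -hbE; last by case: Uy.
by apply/matrixP => p q; rewrite !mxE.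
Qed.

Definition imm_dr (y : 'rV[R]_k.+1) : 'rV[R]_n.+1 := \row_c dd c rX (lc y).
Definition imm_J2 (y : 'rV[R]_k.+1) p q : 'rV[R]_n.+1 := \row_c dd p (dd q (F c)) y.
Definition imm_Gam (y : 'rV[R]_k.+1) b d e : R :=
  gamma1 (fun c d x => gbar a x c d) b d e (lc y).
Notation J y := (ljac iota i a y).
Notation Gl y := (gbar a (lc y)).
Notation dr := imm_dr.
Notation J2 := imm_J2.
Notation Gam := imm_Gam.

(** The conformal formula for Christoffel symbols, now on X itself with gbar and [r] in the roles of
    hb and rho. *)
Lemma christoffelE b d e y : U y ->
  christoffel (cdom (inter X) a) (g a) b d e (lc y) =
  (rho y ^+ 2)^-1 * Gam y b d e - (rho y ^+ 3)^-1 * mT (Gl y) (dr y) b d e.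
Proof.
move=> Uy; have Ix := loc_inter Uy.
have [hI I0] := iopen_inter rd a.
have Isub : cdom (inter X) a `<=` phi a @` dom a by move=> x /cdomP[].
have r0 x : cdom (inter X) a x -> rX x != 0.
  by move=> /cdomP[_ Ipx]; case: rd => _ r1 _ _; rewrite gt_eqF// r1.
pose Gc c d x := gbar a x c d.
have cE c d' x : cdom (inter X) a x -> conf Gc rX c d' x = g a x c d'.
  by move=> Ixx; rewrite /conf /Gc gbarE// mxE mulKf// sqrf_eq0 r0.
have cC c d' : C1 (cdom (inter X) a) (conf Gc rX c d').
  apply: (conf_C1 (iopen_inter rd a) Isub (hb := Gc)) => [c1 d1||x Ixx].
  - exact: (gbar_C2 c1 d1).1.
  - exact: (rloc_C2 rd a).1.
  - exact: r0.
have pE p c d' : pd (cdom (inter X) a) p (fun x => g a x c d') (lc y) =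
    dd p (conf Gc rX c d') (lc y).
  by rewrite pd_dd//; apply/esym; apply: (dd_eq _ hI _ (cC c d') Ix) => x; exact: cE.
rewrite /christoffel !pE -/(gamma1 (conf Gc rX) b d e (lc y)).
rewrite (gamma1_conf (iopen_inter rd a) Isub (hb := Gc) (rho := rX)) //.
- by rewrite /Tq /mT !mxE.
- by move=> c1 d1; exact: (gbar_C2 c1 d1).1.
- exact: (rloc_C2 rd a).1.
Qed.

Lemma cov_hessianE p q y : U y -> cov_hessian iota g i a p q y =
  mcov (J y) (Gl y) (rho y) (dr y) (Gam y) (J2 y) p q.
Proof.
move=> Uy; have Ay : A y by case: Uy.
apply/rowP => c; rewrite [LHS]mxE [RHS]mxE; congr (_ + _).
  rewrite /J2 mxE pd_dd//; last exact: hopen_ldom.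
  apply/esym; apply: (@dd_eq _ _ A) => //; first exact: hopen_ldom.
    by move=> z Az; rewrite pd_dd//; exact: hopen_ldom.
  exact: (loc_C2 c).2.
by do 3 (apply: eq_bigr => ? _); rewrite gE// christoffelE.
Qed.

Lemma mhbE y : A y -> mhb (J y) (Gl y) = hbm hb y.
Proof. by move=> Ay; rewrite hbE. Qed.

Lemma mhb_unit y : A y -> mhb (J y) (Gl y) \in unitmx.
Proof. by move=> Ay; rewrite mhbE//; apply: posdef_unit => v; exact: hb_posdef. Qed.

Lemma mean_curvatureE y : U y -> mean_curvature iota g i a y =
  mmean (J y) (Gl y) (rho y) (dr y) (Gam y) (J2 y).
Proof.
move=> Uy; rewrite /mean_curvature /mmean /mind /Defs.induced gE//.
apply: eq_bigr => p _; apply: eq_bigr => q _; congr (_ *: _).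
by rewrite /second_fundamental_form /normal_part /Defs.induced gE// cov_hessianE.
Qed.

(** The mean curvature vector H divided by rho. Its gbar-length is the g-length of H, and its
    formula makes sense up to the boundary. *)
Definition mean_limit (y : 'rV[R]_k.+1) : 'rV[R]_n.+1 :=
  rho y *: mZ (J y) (Gl y) (Gam y) (J2 y) +
  k.+1%:R *: (mgrad (Gl y) (dr y) *m mN (J y) (Gl y)).

Lemma mean_curvature_norm y : U y ->
  ip (g a (lc y)) (mean_curvature iota g i a y) (mean_curvature iota g i a y) =
  ip (Gl y) (mean_limit y) (mean_limit y).
Proof.
move=> Uy; have Ay : A y by case: Uy.
have Gs := gbar_sym (loc_im Ay); have Gu := gbar_unit (loc_im Ay).
rewrite mean_curvatureE// gE//.
by rewrite (mean_norm (dr y) (Gam y) (J2 y) Gs Gu (mhb_unit Ay) (rho_neq0 Uy)).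
Qed.

Lemma cont_loc (f : 'rV[R]_n.+1 -> R) : cont (phi a @` dom a) f ->
  cont A (fun y => f (lc y)).
Proof.
apply: cont_comp loc_im _ => y Ay.
apply: (@contmx_cvg _ _ A 1 n.+1 lc) => // j c; rewrite ord1.
exact: C1_cont (loc_C2 c).1.
Qed.

Lemma Gl_cont : contmx A (fun y => Gl y).
Proof. by move=> c d; exact: C1_cont (gbar_loc_C2 c d).1. Qed.

Lemma J_cont : contmx A (fun y => J y).
Proof.
move=> p c; apply: (@cont_eq _ _ _ (fun y => dd p (F c) y)).
  by move=> y Ay; rewrite ljacE// mxE.
exact: C1_dd_cont (loc_C2 c).1.
Qed.

Lemma mean_limit_cont : contmx A mean_limit.
Proof.
have cdr : contmx A dr.
  move=> j c; under eq_fun do rewrite mxE.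
  by apply: cont_loc; exact: C1_dd_cont (rloc_C2 rd a).1.
have cGi : contmx A (fun y => invmx (Gl y)).
  by apply: contmx_inv Gl_cont => y Ay; exact: gbar_unit (loc_im Ay).
have chi : contmx A (fun y => invmx (mhb (J y) (Gl y))).
  apply: contmx_inv; first by move=> y; exact: mhb_unit.
  by apply: contmx_mul (contmx_tr J_cont); exact: contmx_mul J_cont Gl_cont.
have cN : contmx A (fun y => mN (J y) (Gl y)).
  apply: contmxD; first exact: contmx_cst.
  apply: contmxN; apply: contmx_mul J_cont; apply: contmx_mul chi.
  exact: contmx_mul Gl_cont (contmx_tr J_cont).
have cGam b d e : cont A (fun y => Gam y b d e).
  apply: cont_loc; apply: contM; first exact: cont_cst.
  by apply: contB; [apply: contD|]; apply: C1_dd_cont; exact: (gbar_C2 _ _).1.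
have cQ p q : contmx A (fun y => mQ (J y) (Gl y) (Gam y) (J2 y) p q).
  move=> j c; under eq_fun do rewrite mxE; apply: contD.
    under eq_fun do rewrite mxE; exact: C1_dd_cont ((loc_C2 c).2 q).
  apply: cont_sum => b; apply: cont_sum => d; apply: cont_sum => e.
  by apply: contM; last exact: J_cont; apply: contM; last exact: J_cont;
    apply: contM.
apply: contmxD; apply: contmxZ.
- exact: C1_cont rho_C2.1.
- apply: contmx_sum => p; apply: contmx_sum => q; apply: contmxZ; first exact: chi.
  exact: contmx_mul (cQ p q) cN.
- exact: cont_cst.
- by apply: contmx_mul cN; exact: contmx_mul cdr cGi.
Qed.

Lemma mP_rho y : A y -> mP (J y) (dr y) = \row_p dd p rho y.
Proof.
move=> Ay; apply/rowP => p; rewrite !mxE dd_rho//; apply: eq_bigr => c _.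
by rewrite ljacE// !mxE.
Qed.

Lemma dr2E y : A y -> dr2 hb rho y = ip (invmx (hbm hb y)) (mP (J y) (dr y)) (mP (J y) (dr y)).
Proof. by move=> Ay; rewrite /dr2 betaE mP_rho. Qed.

Lemma mean_limit_bdry y : A y -> rho y = 0 ->
  ip (Gl y) (mean_limit y) (mean_limit y) =
  k.+1%:R ^+ 2 * (ip (invmx (Gl y)) (dr y) (dr y) - dr2 hb rho y).
Proof.
move=> Ay ry; have Gs := gbar_sym (loc_im Ay); have Gu := gbar_unit (loc_im Ay).
rewrite /mean_limit ry scale0r add0r ipZl ipZr.
by rewrite (normal_grad (dr y) Gs Gu (mhb_unit Ay)) mhbE// -dr2E// mulrA.
Qed.

Lemma rho_bdry y : (forall q, bdry Y q -> bdry X (iota q)) ->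
  A y -> bdry Y (psi i y) -> rho y = 0.
Proof.
by move=> bb Ay /bb bx; rewrite /imm_rho psi_loc//; case: rd => _ _ + _; apply.
Qed.

Lemma dr2_value (C : R) y : boundary_dr2 g 1 -> mean_curvature_limit iota g C ->
  (forall q, bdry Y q -> bdry X (iota q)) -> A y -> bdry Y (psi i y) ->
  dr2 hb rho y = 1 - C ^+ 2 / k.+1%:R ^+ 2.
Proof.
move=> gdr HC bb Ay by_.
have ry := rho_bdry bb Ay by_.
have hA := hopen_ldom.
have dr1 : ip (invmx (Gl y)) (dr y) (dr y) = 1.
  have cpt : compactification C0 g r gbar.
    split => //; have [m1 m2 m3 m4] := gbar_metric; split => // c a' b'.
    by have [] := m1 c a' b'.
  have bx : cdom (bdry X) a (lc y).
    by apply/cdomP; split; [exact: loc_im|rewrite psi_loc//; exact: bb].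
  have := gdr r gbar cpt a (lc y) bx.
  rewrite (_ : \row_c _ = dr y)//; apply/rowP => c; rewrite !mxE pd_dd//.
    exact: hopen_im.
  exact: loc_im.
have [K [d [d0 HK]]] := HC r rd.
pose f z := ip (Gl z) (mean_limit z) (mean_limit z) - C ^+ 2.
have cf : cont A f.
  apply: contB; last exact: cont_cst.
  by apply: cont_ip; [exact: Gl_cont|exact: mean_limit_cont|exact: mean_limit_cont].
have crho : cont A rho by exact: C1_cont rho_C2.1.
(* The inequality |f| <= K rho holds at interior points with [rho < d]. By density [h] is
   nonnegative at the boundary point [y] as well, where [rho] vanishes and hence [f] too. *)
pose h z := K * rho z - `|f z|.
have : 0 <= h y.
  apply: (@cont_ge0_interior _ _ (A `&` [set z | rho z < d])).
  - exact: hopen_lt.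
  - apply: (@cont_sub _ _ _ A) => [z []//|]; apply: contB.
      by apply: contM => //; exact: cont_cst.
    by move=> z Az; apply: cvg_norm; exact: cf.
  - move=> z [Az rz] z0; have [iz az] := (ldomP z).1 Az.
    have Iz : cdom (inter Y) i z by apply/(cdom_interP rYd).
    have /cdomP[_ Ipz] := Iz.
    have := HK i a z; rewrite mean_curvature_norm//.
    rewrite (_ : r (iota _) = rho z); last by rewrite /imm_rho psi_loc.
    move=> H1; rewrite subr_ge0; apply: H1 => //.
    by apply/cdomP.
  - by split => //; rewrite /= ry.
rewrite /h ry mulr0 sub0r oppr_ge0 normr_le0 /f mean_limit_bdry// dr1.
rewrite subr_eq0 => /eqP E.
have k0 : k.+1%:R ^+ 2 != 0 :> R by rewrite expf_neq0// pnatr_eq0.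
rewrite -E mulrAC divff// mul1r; ring.
Qed.

Lemma dd_rho_neq0 y : (forall q, bdry Y q -> bdry X (iota q)) ->
  transverse_to_boundary iota -> A y -> bdry Y (psi i y) ->
  \row_p dd p rho y != 0 /\ forall p, p != 0 -> dd p rho y = 0.
Proof.
move=> bb tr Ay by_.
have [iy _] := (ldomP y).1 Ay.
have bx : cdom (bdry X) a (lc y).
  by apply/cdomP; split; [exact: loc_im|rewrite psi_loc//; exact: bb].
split; last first.
  move=> p p0; apply: (dd_tangential hopen_ldom rho_C2.1 Ay _ p0).
    by apply/(bdry_coord rYd iy).
  move=> z Az z0; apply: rho_bdry => //.
  by have [iz _] := (ldomP z).1 Az; apply/(bdry_coord rYd iz).
rewrite -mP_rho//; apply/eqP => mP0.
(* The inward direction of X is the image of some [v] up to a vector tangent to the boundary. As dr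
   sees only coordinate 0, it would vanish on that direction if d rho were 0. *)
have [v [t [t0 E]]] := tr i a y Ay (bb _ by_) (delta_mx 0 0).
have vJ : (v *m J y) 0 0 = 1.
  have := congr1 (fun w : 'rV[R]_n.+1 => w 0 0) E.
  by rewrite [RHS]mxE t0 addr0 mxE eqxx => <-.
have : (dr y *m (v *m J y)^T) 0 0 = 0.
  by rewrite trmx_mul mulmxA -/(mP (J y) (dr y)) mP0 mul0mx mxE.
rewrite mxE (bigD1 0)//= big1 ?addr0; last first.
  by move=> c c0; rewrite mxE (rloc_tangential rd bx c0) mul0r.
rewrite [(_^T) 0 0]mxE vJ mulr1 mxE => /eqP.
by rewrite (negPf (rloc_normal rd bx)).
Qed.

(** Combined with the value of [dr2] on the boundary, this makes the asymptotic curvature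
    negative. *)
Lemma dr2_gt0 y : (forall q, bdry Y q -> bdry X (iota q)) ->
  transverse_to_boundary iota -> A y -> bdry Y (psi i y) -> 0 < dr2 hb rho y.
Proof.
move=> bb tr Ay by_; rewrite dr2E// mP_rho//; apply: ip_inv_pos.
- by apply/matrixP => p q; rewrite !mxE hb_symm.
- by move=> v; exact: hb_posdef.
- by have [] := dd_rho_neq0 bb tr Ay by_.
Qed.

End TwoCharts.

(** * Change of charts of X, and the pullback metric on Y *)

Lemma ljac_chain i a b y : ldom iota i a y -> ldom iota i b y ->
  ljac iota i b y = ljac iota i a y *m
    jac (cdom (dom b) a) (fun x => phi b (psi a x)) (loc iota i a y).
Proof.
move=> Aa Ab; rewrite !ljacE//.
pose A2 := ldom iota i a `&` ldom iota i b.
have hA2 : hopen A2 by apply: hopenI; exact: hopen_ldom.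
have hB : hopen (cdom (dom b) a) by apply: hopen_cdom; exact: dom_open.
have map z : A2 z -> cdom (dom b) a (loc iota i a z).
  move=> [Az Bz]; apply/cdomP; split; first exact: loc_im.
  by rewrite psi_loc//; move: Bz => /ldomP[].
have cF c : C1 A2 (fun z => loc iota i a z 0 c).
  by apply: C1_sub (loc_C2 i a c).1 => z [].
apply/matrixP => p c; rewrite !mxE.
have [C E] := C1_comp hA2 hB map cF (transition_C2 a b c).1.
have Ay : A2 y by [].
rewrite -(@dd_eq _ _ A2 (fun z => phi b (psi a (loc iota i a z)) 0 c))//; last first.
  by move=> z [Az Bz]; rewrite psi_loc.
rewrite E//; apply: eq_bigr => e _; rewrite !mxE pd_dd//; last exact: map.
by rewrite mulrC.
Qed.

Hypothesis g_trans : forall a b x, cdom (dom b `&` inter X) a x ->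
  let J := jac (cdom (dom b) a) (fun z => phi b (psi a z)) x in
  g a x = J *m g b (phi b (psi a x)) *m J^T.

(** [pullback] uses a chart of X chosen separately at each point. The transformation law of [g] and
    the chain rule for [ljac] allow one fixed chart [a] instead, in which the entries can be
    differentiated. *)
Lemma pullbackE i a y : ldom iota i a y -> cdom (inter Y) i y ->
  pullback iota g i y = Defs.induced iota g i a y.
Proof.
move=> Ay Iy; rewrite /pullback /Defs.induced; set b := chart_at _.
have by_ : ldom iota i b y.
  have [iy _] := (ldomP i a y).1 Ay; apply/ldomP; split => //.
  rewrite /b /chart_at; case: cid => //.
have gE : g a (loc iota i a y) = jac (cdom (dom b) a) (fun x => phi b (psi a x))
    (loc iota i a y) *m g b (loc iota i b y) *m
    (jac (cdom (dom b) a) (fun x => phi b (psi a x)) (loc iota i a y))^T.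
  rewrite [LHS](@g_trans a b).
    by rewrite psi_loc.
  apply/cdomP; split; first exact: loc_im.
  rewrite psi_loc//; split; first by move: by_ => /ldomP[].
  by apply: iota_inter; have /cdomP[] := Iy.
by rewrite gE (ljac_chain Ay by_) trmx_mul !mulmxA.
Qed.

Lemma chart_at_ldom i y : (phi i @` dom i) y ->
  ldom iota i (chart_at (iota (psi i y))) y.
Proof. by move=> iy; apply/ldomP; split => //; rewrite /chart_at; case: cid. Qed.

Lemma pullback_conf i a y p q : ldom iota i a y -> cdom (inter Y) i y ->
  pullback iota g i y p q = conf (imm_hb i a) (imm_rho i a) p q y.
Proof. by move=> Ay Iy; rewrite (pullbackE Ay Iy) inducedE// mxE. Qed.

(* Along the inner normal direction e_0 both r' and rho vanish to first order,
   so dividing r'^2 (rho^2 g) = rho^2 (r'^2 g) by the square of the distance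
   compares the two compactifications at the boundary point. *)
Lemma boundary_dr2_pullback (c : R) : (forall q, bdry Y q -> bdry X (iota q)) ->
  transverse_to_boundary iota ->
  (forall i a y, ldom iota i a y -> bdry Y (psi i y) ->
     dr2 (imm_hb i a) (imm_rho i a) y = c) ->
  boundary_dr2 (pullback iota g) c.
Proof.
move=> bb tr Hc r' h' [r'd [m1 _ _ _] h'E] i y byc d.
have /cdomP[iy by_] := byc.
have Ay := chart_at_ldom iy; move: (chart_at _) Ay => a Ay.
pose rho := imm_rho i a; pose hb := imm_hb i a.
pose f z := r' (psi i z).
have ry : rho y = 0 by apply: rho_bdry.
have fy : f y = 0 by case: r'd => _ _ + _; apply.
have hA := hopen_ldom i a.
have Aim : ldom iota i a `<=` phi i @` dom i by move=> z /ldomP[].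
have cf := (rloc_C2 r'd i).1; have cr := (rho_C2 i a).1.
have Hy : half_space y by exact: hA.1.
have key p q : dd 0 rho y ^+ 2 * h' i y p q = dd 0 f y ^+ 2 * hb p q y.
  have PF := pd_nbhs_proper 0 Hy.
  have dr_ : diff_quot rho 0 y @ pd_nbhs (@half_space R k) 0 y --> dd 0 rho y.
    exact: (cr.2 0).1.
  have df_ : diff_quot f 0 y @ pd_nbhs (@half_space R k) 0 y --> dd 0 f y.
    exact: (cf.2 0).1.
  have ch' : cont (ldom iota i a) (fun z => h' i z p q).
    apply: (@cont_sub _ _ _ (cdom setT i)); first by rewrite cdomT.
    by apply/contP; exact: m1.
  pose F := pd_nbhs (@half_space R k) 0 y.
  have hbc : cont (ldom iota i a) (hb p q) by exact: C1_cont (hb_C1 i a p q).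
  have L1 : (fun h => diff_quot rho 0 y h * diff_quot rho 0 y h *
      h' i (y + h *: delta_mx 0 0) p q) @ F --> dd 0 rho y * dd 0 rho y * h' i y p q.
    apply: cvgM; first exact: cvgM.
    exact: (diff_quot_shift 0 Ay ch' hA).
  have L2 : (fun h => diff_quot f 0 y h * diff_quot f 0 y h *
      hb p q (y + h *: delta_mx 0 0)) @ F --> dd 0 f y * dd 0 f y * hb p q y.
    apply: cvgM; first exact: cvgM.
    exact: (diff_quot_shift 0 Ay hbc hA).
  rewrite !expr2; suff L3 : (fun h => diff_quot rho 0 y h * diff_quot rho 0 y h *
      h' i (y + h *: delta_mx 0 0) p q) @ F --> dd 0 f y * dd 0 f y * hb p q y.
    by apply: cvg_unique L1 L3; exact: norm_hausdorff.
  apply: (pd_cvg_eq hA Ay) L2 => h h0 Ah /=.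
  have hy0 : y 0 0 = 0 by apply/(bdry_coord rYd iy).
  have hpos : 0 < (y + h *: delta_mx 0 0) 0 0.
    have := hA.1 _ Ah; rewrite /half_space/= coordD hy0 eqxx mulr1 add0r.
    by rewrite le_eqVlt eq_sym (negPf h0).
  have Iz : cdom (inter Y) i (y + h *: delta_mx 0 0).
    by apply/(cdom_interP rYd); split => //; exact: Aim.
  have Uz : (ldom iota i a `&` cdom (inter Y) i) (y + h *: delta_mx 0 0) by [].
  rewrite /diff_quot ry fy !subr0 h'E// mxE (pullback_conf p q Ah Iz) /conf.
  rewrite -/rho -/hb -/(f _); have := rho_neq0 Uz; rewrite -/rho => rz.
  move: (rho _) rz (f _) (hb _ _ _) => x x0 z w.
  by field; rewrite x0 h0.
have [rn0 rt] := dd_rho_neq0 bb tr Ay by_.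
have r0 : dd 0 rho y != 0.
  apply: contra rn0 => /eqP r0; apply/eqP/rowP => p; rewrite !mxE.
  by have [->//|p0] := eqVneq p 0; rewrite rt.
have f0 : dd 0 f y != 0 by exact: rloc_normal.
(* At [y] the two compactified metrics differ by the factor [t ^+ 2] and, since tangential
   derivatives vanish, the differentials of the defining functions by [t]; these factors cancel in
   the squared length. *)
pose t := dd 0 f y / dd 0 rho y.
have t0 : t != 0 by rewrite mulf_neq0// invr_eq0.
have h'y : h' i y = t ^+ 2 *: hbm hb y.
  apply/matrixP => p q; rewrite !mxE; have E := key p q.
  apply: (mulfI (expf_neq0 2 r0)); rewrite E /t.
  by move: (hb p q y) => w; field.
have dE : d = t *: \row_p dd p rho y.
  apply/rowP => p; rewrite !mxE pd_dd//; last exact: hopen_im.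
  have [->|p0] := eqVneq p 0; first by rewrite /t divfK.
  by rewrite rt// mulr0 (rloc_tangential r'd byc p0).
rewrite -(Hc i a y Ay by_) dr2E// mP_rho// h'y dE ipZl ipZr invmxZ; last first.
- rewrite unitmxE detZ unitrM unitrX ?unitfE ?sqrf_eq0//=.
  by rewrite -unitfE -unitmxE; apply: posdef_unit => v; exact: hb_posdef.
rewrite ip_scale -/hb -/rho; move: (ip _ _ _) => w; field => //.
Qed.

Lemma sectional_limit_pullback (c : R) :
  is_metric C0 (inter Y) (pullback iota g) ->
  (forall q, bdry Y q -> bdry X (iota q)) ->
  (forall i a y, ldom iota i a y -> bdry Y (psi i y) ->
     dr2 (imm_hb i a) (imm_rho i a) y = c) ->
  sectional_limit (pullback iota g) (- c).
Proof.
move=> [_ _ pos _] bb Hc i.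
pose Kb a p q := sval (cid (hb_scurl i a p q)).
have hbK a p q : scurl (ldom iota i a) (fun s => gamma1 (imm_hb i a) s p q) (Kb a p q).
  by rewrite /Kb; case: cid.
pose hc a := conf (imm_hb i a) (imm_rho i a).
pose Ka a := Kc (imm_hb i a) (imm_rho i a) (Kb a).
pose U := cdom (inter Y) i.
pose Ua a := ldom iota i a `&` U.
pose h p q x := pullback iota g i x p q.
have iU : iopen U by exact: (iopen_inter rYd i).
have iUa a : iopen (Ua a) by exact: iopen_U.
have UaA a : Ua a `<=` ldom iota i a by move=> y [].
have UaU a : Ua a `<=` U by move=> y [].
have rho0 a y : Ua a y -> imm_rho i a y != 0 by exact: rho_neq0.
have hE a p q y : Ua a y -> hc a p q y = h p q y.
  by move=> [Ay Iy]; rewrite /h (pullback_conf p q Ay Iy).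
have chc a p q : C1 (Ua a) (hc a p q).
  apply: (conf_C1 (iUa a) (UaA a)) => //; first exact: hb_C1.
    exact: (rho_C2 i a).1.
  exact: rho0.
have gE a q p l y : Ua a y -> gamma1 (hc a) q p l y = gamma1 h q p l y.
  by apply: gamma1_eq (iUa a).1 _ _ => //; exact: hE.
have sch a p l : scurl (Ua a) (fun q => gamma1 h q p l) (Ka a p l).
  apply: (@scurl_eq _ _ _ (fun q => gamma1 (hc a) q p l) _ (Ka a p l)) => //.
    by move=> q x; exact: gE.
  apply: (conf_scurl (hopen_ldom i a) (iUa a) (UaA a)) => //.
  - exact: hb_C1.
  - exact: (rho_C2 i a).1.
  - exact: (rho_C2 i a).2.
  - exact: rho0.
(* Different charts of X give the same curvature form because a 1-form has at most
   one weak exterior derivative. *)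
pose K p l s q y := Ka (chart_at (iota (psi i y))) p l s q y.
have ca y : U y -> Ua (chart_at (iota (psi i y))) y.
  by move=> Uy; split => //; apply: chart_at_ldom; move: Uy => /cdomP[].
have KE a p l s q y : Ua a y -> Ka a p l s q y = K p l s q y.
  move=> Uy; have Uby := ca y (UaU a y Uy); rewrite /K; move: (chart_at _) Uby => b Uby.
  have iW : iopen (Ua a `&` Ua b) by apply: iopenI => //; exact: (iUa b).1.
  apply: (scurl_unique s q iW _ _ (conj Uy Uby)).
    by apply: scurl_sub (sch a p l) => z [].
  by apply: scurl_sub (sch b p l) => z [].
exists (fun p q s l x => K s l p q x - cip h q s p l x + cip h p s q l x).
  apply: riemann_tensor_scurl => //.
  - move=> p q; apply: C1on_local => x Ux; set a := chart_at (iota (psi i x)).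
    exists (Ua a); first by apply: iopen_nbhs => //; exact: ca.
    rewrite (setIidr (UaU a)); apply: (C1_eq (iUa a).1 _ (chc a p q)).
    by move=> y; exact: hE.
  - by move=> x Ux; apply: posdef_unit => v v0; exact: pos.
  - move=> x Ux; set a := chart_at (iota (psi i x)); exists (Ua a) => //.
    split; first exact: ca.
    move=> p l; apply: scurl_eq (sch a p l) => // s q y; exact: KE.
move=> y0 y0b e e0; have [iy by0] := (cdomP _ _ _).1 y0b.
have Ay := chart_at_ldom iy; move: (chart_at _) Ay => a Ay.
have L := conf_sectional_cvg (hopen_ldom i a) (iUa a) (UaA a) (hb_C1 i a)
  (fun p q y => @hb_symm i a p q y) (fun y v => @hb_posdef i a y v) (hbK a)
  (rho_C2 i a).1 (rho_C2 i a).2 (rho0 a) Ay (rho_bdry bb Ay by0) e0.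
rewrite (Hc _ _ _ Ay by0) in L; move: L; rewrite !near_withinE => L.
(* Near [y0] a single chart [a] of X is enough, and there the glued tensor is that of hb / rho^2. *)
apply: filterS2 L ((hopen_ldom i a).2 _ Ay) => x L HA Ux u v uv.
have Uax : Ua a x by split => //; apply: HA; exact: iU.1.1.
have := L Uax u v uv; congr (`|_ - _| < _); rewrite /sectional.
have -> : \matrix_(p, q) conf (imm_hb i a) (imm_rho i a) p q x = pullback iota g i x.
  by apply/matrixP => p q; rewrite mxE -/(hc a) (hE a).
congr (_ / _); apply: eq_bigr => p _; apply: eq_bigr => q _.
apply: eq_bigr => s _; apply: eq_bigr => l _; congr (_ * _ * _ * _ * _).
rewrite /Rmc -/(Ka a) (KE _ _ _ _ _ _ Uax).
by congr (_ - _ + _); exact: (cip_eq _ _ _ _ (iUa a).1 (hE a) (chc a) Uax).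
Qed.

End Immersed.

(** * Asymptotic hyperbolicity of the pullback metric *)

Lemma asym_hyperbolic_pullback (R : realType) (n k : nat) (theta C : R)
    (X : bmanifold R n) (Y : bmanifold R k) (g : tensor_field X) (iota : Y -> X) :
  0 < theta -> conf_compact (Ckh 3 theta) g -> boundary_dr2 g 1 ->
  asym_CMC iota g theta C ->
  asym_hyperbolic (pullback iota g) (- (1 - C ^+ 2 / k.+1%:R ^+ 2)).
Proof.
move=> theta0 [[_ _ _ g_trans] _ [r [gbar [rd gbar_metric gbarE]]]] g1
  [[imm iota_inter ccY [bb _] tr] _ mcl].
have [mY _ [rY [hbar [rYd _ _]]]] := ccY.
have val i a y (Ay : ldom iota i a y) (yb : bdry Y (psi i y)) :=
  dr2_value theta0 rd gbar_metric gbarE imm iota_inter rYd g1 mcl bb Ay yb.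
(* The sign is checked at a single boundary point of Y, which the definition of [bmanifold]
   provides. *)
have c0 : 0 < 1 - C ^+ 2 / k.+1%:R ^+ 2.
  have [p [i [ip p0]]] := @bm_boundary _ _ Y.
  have iy : (phi i @` dom i) (phi i p) by exists p.
  have pb : bdry Y (psi i (phi i p)) by rewrite phiK//; exists i.
  have Ay := chart_at_ldom iota iy.
  rewrite -(val _ _ _ Ay pb).
  exact: (dr2_gt0 theta0 rd gbar_metric imm rYd bb tr Ay pb).
split; rewrite ?oppr_lt0 ?opprK//.
- exact: (sectional_limit_pullback theta0 rd gbar_metric gbarE imm iota_inter rYd g_trans mY bb val).
- exact: (boundary_dr2_pullback theta0 rd gbar_metric gbarE imm iota_inter rYd g_trans bb tr val).
Qed.

Theorem proposition1p8 (R : realType) (n k : nat) (theta C : R)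
    (X : bmanifold R n) (Y : bmanifold R k)
    (g : tensor_field X) (iota : Y -> X)
    (theta01 : 0 < theta < 1)
    (g_reg : conf_compact (Ckh 3 theta) g)
    (g_AH : asym_hyperbolic g (- 1))
    (Y_CMC : asym_CMC iota g theta C) :
  asym_hyperbolic (pullback iota g) (- (1 - C ^+ 2 / k.+1%:R ^+ 2)) /\
  (asym_minimal iota g theta -> asym_hyperbolic (pullback iota g) (- 1)).
Proof.
have /andP[theta0 _] := theta01.
have g1 : boundary_dr2 g 1 by have [_ _ _] := g_AH; rewrite opprK.
split; first exact: (asym_hyperbolic_pullback theta0 g_reg g1 Y_CMC).
move=> Ymin; have := asym_hyperbolic_pullback theta0 g_reg g1 Ymin.
by rewrite expr0n mul0r subr0.
Qed.
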